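(* Let $p\in(0,1)$, $d=1-p$, and let $\mathrm{Cap}(D_0)$ be the capacity (in nats per channel use) of the geometric deletion channel, i.e. the binary repeat channel with replication distribution $D_0(y)=(1-p)p^y$, $y=0,1,2,\dots$. With $\Delta(x)$, $R_p(x)$, $\Lambda_1$, $\Lambda_2$, $\mathrm{Li}$ as defined in the context, the following two bounds hold. (1) Let $\delta=\min\big(\exp(-(\Delta(1)-1/2)/d),\,1\big)$, $\Delta_\delta(x)=\Delta(x)-d\log\delta+d^x\log\delta$ and $\epsilon_\delta(p)=\inf_{x\ge1}\Delta_\delta(x)$ (infimum over integers $x$). For $q\in(0,1)$ define $$\frac1\alpha=\delta+\sum_{y=1}^\infty\binom{y/p-1}{y}q^ye^{-yh(p)/p},\qquad \mu_q=\sum_{y=1}^\infty\alpha\,y\binom{y/p-1}{y}q^ye^{-yh(p)/p}.$$ Then $$\mathrm{Cap}(D_0)\le\sup_{q\in(0,1):\ \mu_q\ge p/(1-p)}\frac{p\left(-\epsilon_\delta(p)-d\log\delta-\log\alpha-\mu_q\log q\right)}{d(1+\mu_q)}.$$ (2) Let $\overline\delta=\exp(-R_p(1)/d)$, $\overline\Delta_{\overline\delta}(x)=R_p(x)-d\log\overline\delta+d^x\log\overline\delta$ and $\overline\epsilon_{\overline\delta}(p)=\inf_{x\ge1}\overline\Delta_{\overline\delta}(x)$ (infimum over integers $x$). For $q\in(0,1)$ define $$\frac1{\overline\alpha}=\overline\delta+\sum_{y=1}^\infty\frac{q^ye^{\Lambda_2(y)-\Lambda_1(y)-y\mathrm{Li}(1/(1+2p))-yh(p)/p}}{y!},\qquad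 \overline\mu_q=\sum_{y=1}^\infty\frac{\overline\alpha\,y\,q^ye^{\Lambda_2(y)-\Lambda_1(y)-y\mathrm{Li}(1/(1+2p))-yh(p)/p}}{y!}.$$ Then $$\mathrm{Cap}(D_0)\le\sup_{q\in(0,1):\ \overline\mu_q\ge p/(1-p)}\frac{p\left(-\overline\epsilon_{\overline\delta}(p)-d\log\overline\delta-\log\overline\alpha-\overline\mu_q\log q\right)}{d(1+\overline\mu_q)}.$$
   Context: $\log$ is the natural logarithm and $h(p)=-p\log p-(1-p)\log(1-p)$; all information quantities are in nats. Repeat channel: for a random variable $D$ on the non-negative integers, the repeat channel with replication distribution $D$ takes a bit string $x_1\cdots x_n$ and outputs the string obtained by replacing each $x_i$ by $D_i$ consecutive copies of $x_i$ (deleting $x_i$ if $D_i=0$), the $D_i$ being i.i.d. copies of $D$; the receiver sees only the concatenated output string. $\mathrm{Cap}(D)$ is its Shannon capacity per input bit, equal to $\lim_{n\to\infty}\frac1n\sup_{X^n}I(X^n;Y)$, where $X^n$ ranges over random $n$-bit inputs and $Y$ is the output string. Notation: $\binom ab=\frac{\Gamma(a+1)}{\Gamma(b+1)\Gamma(a-b+1)}$ for real arguments, and $\binom{-1}{0}=1$. For integers $x\ge1$, $Y_x$ is the negative binomial distribution $Y_x(y)=\binom{y+x-1}{y}(1-p)^xp^y$, $y=0,1,2,\dots$. Then $$\Delta(x)=\mathbb{E}\left[\log\frac{\binom{Y_x/p-1}{Y_x}}{\binom{Y_x+x-1}{Y_x}}\right],\qquad R_p(x)=-\int_{\frac{2p}{1+2p}}^1\frac{(1-t)^{x-1}\left(1-\left(\frac{1-p}{1-p(1-t)}\right)^x\right)}{t\log(1-t)}\,dt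 .$$ $\mathrm{Li}(z)=\int_0^z\frac{dt}{\log t}$ for $z\in(0,1)$. For integers $y\ge 0$, $$\Lambda_1(y)=\int_0^{\frac{2p}{1+2p}}\frac{1+t-ty(1-p)/p-\left(\frac{p-t}{p(1-t)}\right)^y/(1-t)}{t\log(1-t)}\,dt,$$ $$\Lambda_2(y)=\int_0^{\frac{2p}{1+2p}}\frac{1+t-ty/p-\left(\frac{p-t(1+p)}{p(1-t)}\right)^y/(1-t)}{t\log(1-t)}\,dt.$$ *)

(* Defs.v *)
From mathcomp Require Import all_boot all_order all_algebra.
From mathcomp Require Import all_classical all_reals all_analysis.

Set Implicit Arguments.
Unset Strict Implicit.
Unset Printing Implicit Defensive.
Import Order.TTheory GRing.Theory Num.Theory.
Import numFieldNormedType.Exports.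

Local Open Scope classical_set_scope.
Local Open Scope ring_scope.

Definition repeat_string (k : seq nat) (x : seq bool) : seq bool :=
  flatten [seq nseq kb.1 kb.2 | kb <- zip k x].

(* Probability that the input x yields the output y, when the replication
   numbers are i.i.d. with probability mass function D: the total mass of the
   vectors of replication numbers that turn x into y. *)
Definition repeat_law {R : realType} (D : nat -> R) (n : nat)
    (x : n.-tuple bool) (y : seq bool) : R :=
  fine (\esum_(k in [set k : n.-tuple nat | repeat_string k x = y])
          (\prod_(i < n) D (tnth k i))%:E)%E.

Definition input_dist {R : realType} (X : finType) : set {ffun X -> R} :=
  [set P | (forall x, 0 <= P x) /\ \sum_x P x = 1].
Arguments input_dist {R} X.

(* Mutual information, in nats, between an input of law P and the output of
   the channel W with discrete output alphabet Y. For a fixed y, the inner sum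
   is Pr[Y = y] times the divergence of the law of the input given y from P,
   hence it is nonnegative, as esum requires. Terms of zero joint probability
   vanish because of the factor P x * W x y. *)
Definition mutual_info {R : realType} {X : finType} {Y : choiceType}
    (P : {ffun X -> R}) (W : X -> Y -> R) : \bar R :=
  (\esum_(y in [set: Y])
     (\sum_x P x * W x y *
        ln (P x * W x y / (P x * \sum_x' P x' * W x' y)))%:E)%E.

Definition repeat_capacity {R : realType} (D : nat -> R) : \bar R :=
  limn (fun n => (n%:R^-1)%:E *
    ereal_sup [set mutual_info P (@repeat_law R D n)
              | P in input_dist (n.-tuple bool)])%E.

Definition bin_entropy {R : realType} (p : R) : R :=
  - p * ln p - (1 - p) * ln (1 - p).

(* Euler's integral; Gamma is only meant to be used at positive arguments. *)
Definition Gamma {R : realType} (a : R) : R :=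
  \int[lebesgue_measure]_(t in `]0, +oo[) (t `^ (a - 1) * expR (- t)).

(* The quotient of Gammas is undefined at (-1, 0), where the convention is 1. *)
Definition gbinom {R : realType} (a b : R) : R :=
  if (a == -1) && (b == 0) then 1
  else Gamma (a + 1) / (Gamma (b + 1) * Gamma (a - b + 1)).

Definition negbin {R : realType} (p : R) (x y : nat) : R :=
  gbinom (y%:R + x%:R - 1) y%:R * (1 - p) ^+ x * p ^+ y.

Definition Delta {R : realType} (p : R) (x : nat) : R :=
  \big[+%R/0]_(0 <= y <oo)
    (negbin p x y *
       ln (gbinom (y%:R / p - 1) y%:R / gbinom (y%:R + x%:R - 1) y%:R)).

Definition Rp {R : realType} (p : R) (x : nat) : R :=
  - \int[lebesgue_measure]_(t in `[2 * p / (1 + 2 * p), 1])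
      ((1 - t) ^+ x.-1 * (1 - ((1 - p) / (1 - p * (1 - t))) ^+ x)
         / (t * ln (1 - t))).

Definition Li {R : realType} (z : R) : R :=
  \int[lebesgue_measure]_(t in `[0, z]) (ln t)^-1.

Definition Lambda1 {R : realType} (p : R) (y : nat) : R :=
  \int[lebesgue_measure]_(t in `[0, 2 * p / (1 + 2 * p)])
    ((1 + t - t * y%:R * (1 - p) / p
        - ((p - t) / (p * (1 - t))) ^+ y / (1 - t)) / (t * ln (1 - t))).

Definition Lambda2 {R : realType} (p : R) (y : nat) : R :=
  \int[lebesgue_measure]_(t in `[0, 2 * p / (1 + 2 * p)])
    ((1 + t - t * y%:R / p
        - ((p - t * (1 + p)) / (p * (1 - t))) ^+ y / (1 - t))
       / (t * ln (1 - t))).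

(* Main.v *)
Require Import Defs.
From mathcomp Require Import all_boot all_order all_algebra.
From mathcomp Require Import all_classical all_reals all_analysis.
From mathcomp Require Import measurable_realfun.
From mathcomp Require Import ring lra zify.

Set Implicit Arguments.
Unset Strict Implicit.
Unset Printing Implicit Defensive.
Import Order.TTheory GRing.Theory Num.Theory.
Import numFieldNormedType.Exports.

Local Open Scope classical_set_scope.
Local Open Scope ring_scope.

(** Code the output by its first bit and its run lengths minus one. An input run of
    [m >= 1] bits contributes a negative binomial number [NB_m] of copies, and
    convexity and additivity of relative entropy along the input show that, if a
    law [Q] satisfies [D(NB_m || Q) <= A + p / (1 - p) * m * B] for all [m >= 1]
    with [0 <= B <= A], then the capacity is at most [p (A + p / (1 - p) * B)].

    Take [Q(k) = W k * q ^ k / Z q]. Then [D(NB_m || Q) = - S m + ln (Z q) -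
    p / (1 - p) * m * ln q] with [S m = E [ln (W Y) - ln (NB_m Y)]], so that
    [A = - inf S + ln (Z q)] and [B = - ln q]. Since [Z] is unbounded near [1],
    [A = B] for some [q]; either the mean of [Q] at this [q] is already at least
    [p / (1 - p)], or it equals [p / (1 - p)] at some larger [q], where [A >= B].
    In both cases the bound is the expression of the statement at that [q].

    In part (1), [W] is a quotient of Gamma functions and [S] is [Delta] up to
    the term at [0]. In part (2), [ln] of the same products is written with
    Frullani's integral; exchanging sum and integral, the probability
    generating function of [NB_m] cancels the integrand on [[0, 2p/(1+2p)]] and
    leaves [Rp] on the rest. *)

(** * Relative entropy *)

(** Reading the input bit by bit makes the divergence recursive. Since the geometric law is
    memoryless, a bit vanishes with probability [1 - p] and otherwise leaves one copy plus a
    geometric excess. A bit of the colour of the current run only raises [m] by one; a bit of the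
    other colour gives a mixture of the old law with the product of [NB_m] and a fresh run started
    at [m = 1]. Convexity splits the mixture and additivity the product, so such a bit costs
    [p (A + p / (1 - p) * B)]. A repeated bit costs [p / (1 - p) * B], and [B <= A] is exactly what
    keeps this below the same price. The tilted law must be normalisable for all [q < 1], so each
    weight has to be shown subexponential. In (1) the weight is bounded; in (2) this needs a second
    use of the integral formula, with the parameter [r = y (1 - p) / p] in place of [m]. The point
    [2p / (1 + 2p)] is where [t / (1 - t) = 2p]: up to there the bases raised to the power [y] in
    [Lambda1] and [Lambda2] stay in [[-1, 1]], so that the generating function of [NB_m] can be
    evaluated at them. *)

(* The correction [- u + v] cancels between laws of equal mass and makes every term
   nonnegative, so that KL is an unconditional sum in [\bar R]. *)
Definition kl {R : realType} (u v : R) : R := u * ln (u / v) - u + v.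

Lemma kl0l (R : realType) (v : R) : kl 0 v = v.
Proof. by rewrite /kl; ring. Qed.

Lemma ln_le_subr1 (R : realType) (x : R) : 0 < x -> ln x <= x - 1.
Proof.
move=> x0; have -> : x = 1 + (x - 1) by ring.
rewrite addrAC subrr add0r; apply: le_ln1Dx; lra.
Qed.

Lemma kl_ge0 (R : realType) (u v : R) : 0 <= u -> 0 < v -> 0 <= kl u v.
Proof.
rewrite le_eqVlt => /predU1P[<-|u0] v0; first by rewrite kl0l ltW.
have vu0 : 0 < v / u by rewrite divr_gt0.
have := ln_le_subr1 vu0.
rewrite -[v / u]invf_div lnV ?posrE ?divr_gt0// lerBrDr.
move=> /(ler_wpM2l (ltW u0)); rewrite mulrDr mulrN mulr1 invf_div mulrCA divff ?gt_eqF// mulr1.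
by rewrite /kl; lra.
Qed.

Lemma klE (R : realType) (u v : R) : 0 < u -> 0 < v ->
  kl u v = u * (ln u - ln v) - u + v.
Proof. by move=> u0 v0; rewrite /kl ln_div. Qed.

(** The graph of [kl ^~ v] lies above its tangent at [u], the gap at [w] being [kl w u]; two such
    tangent inequalities are averaged at the mixture. *)
Lemma kl_convex (R : realType) (s u1 u2 v : R) :
  0 <= s <= 1 -> 0 <= u1 -> 0 <= u2 -> 0 < v ->
  kl (s * u1 + (1 - s) * u2) v <= s * kl u1 v + (1 - s) * kl u2 v.
Proof.
move=> /andP[s0 s1] u10 u20 v0.
have tan w u : 0 <= w -> 0 < u -> kl u v + (ln u - ln v) * (w - u) <= kl w v.
  rewrite le_eqVlt => /predU1P[<-|w0] u0.
    by rewrite klE// kl0l; lra.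
  by have := kl_ge0 (ltW w0) u0; rewrite !klE//; lra.
have a0 : 0 <= s * u1 by rewrite mulr_ge0.
have b0 : 0 <= (1 - s) * u2 by rewrite mulr_ge0// subr_ge0.
set u := (X in kl X v <= _).
have : 0 <= u by rewrite addr_ge0.
rewrite le_eqVlt => /predU1P[u0|u0].
  have su1 : s * u1 = 0 by apply/eqP; rewrite eq_le a0 andbT; rewrite /u in u0; lra.
  have su2 : (1 - s) * u2 = 0 by rewrite /u in u0; lra.
  rewrite -u0 kl0l /kl !mulrDr !mulrN !mulrA su1 su2; lra.
have l1 := ler_wpM2l s0 (tan _ _ u10 u0).
have s10 : 0 <= 1 - s by lra.
have l2 := ler_wpM2l s10 (tan _ _ u20 u0).
apply: le_trans (lerD l1 l2).
rewrite le_eqVlt; apply/orP; left; apply/eqP.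
have -> : s * (kl u v + (ln u - ln v) * (u1 - u)) +
  (1 - s) * (kl u v + (ln u - ln v) * (u2 - u)) =
   kl u v + (ln u - ln v) * (s * u1 + (1 - s) * u2 - u) by ring.
by rewrite -/u; ring.
Qed.

(** Additivity term by term, with every subtracted quantity moved across: both sides are sums of
    nonnegative terms and can be summed in [\bar R] even when the divergence is infinite. *)
Lemma kl_prod (R : realType) (u u' v v' : R) :
  0 <= u -> 0 <= v -> 0 < u' -> 0 < v' ->
  kl (u * v) (u' * v') + u' * v + u * v' =
  v * kl u u' + u * kl v v' + u * v + u' * v'.
Proof.
rewrite le_eqVlt => /predU1P[<-|u0].
  by move=> _ _ _; rewrite !(mul0r, kl0l); ring.
rewrite le_eqVlt => /predU1P[<-|v0] u'0 v'0.
  by rewrite !(mulr0, mul0r, kl0l); ring.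
rewrite !klE ?mulr_gt0// !lnM ?posrE//; ring.
Qed.

Lemma kl_scaler (R : realType) (s u v : R) :
  0 <= u -> 0 < s -> 0 < v -> kl u (s * v) + v = kl u v - u * ln s + s * v.
Proof.
rewrite le_eqVlt => /predU1P[<-|u0] s0 v0; first by rewrite !kl0l; ring.
by rewrite !klE ?mulr_gt0// lnM ?posrE//; ring.
Qed.

(** The right side exceeds the left by [kl m v], with [m] the output mass: a reference value other
    than [m] only overestimates the information. *)
Lemma kl_mixture (R : realType) (X : finType) (P W : X -> R) (v : R) :
  (forall x, 0 <= P x) -> \sum_x P x = 1 -> (forall x, 0 <= W x) -> 0 < v ->
  \sum_x P x * W x * ln (P x * W x / (P x * \sum_x' P x' * W x')) <=
  \sum_x P x * kl (W x) v.
Proof.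
move=> P0 P1 W0 v0; pose m := \sum_x P x * W x; rewrite -/m.
have PW0 x : 0 <= P x * W x by rewrite mulr_ge0.
have m0 : 0 <= m by apply: sumr_ge0.
have -> : \sum_x P x * kl (W x) v =
    \sum_x P x * W x * ln (W x / v) - m + v.
  have vE : \sum_x P x * v = v by rewrite -mulr_suml P1 mul1r.
  rewrite -[X in _ = _ + X]vE.
  rewrite -sumrB -big_split/=.
  by apply: eq_bigr => x _; rewrite /kl; ring.
apply: (@le_trans _ _ (\sum_x P x * W x * (ln (W x / v) - ln (m / v)))).
  apply: ler_sum => x _.
  have [->|PW] := eqVneq (P x * W x) 0; first by rewrite !mul0r.
  have PWp : 0 < P x * W x by rewrite lt_neqAle eq_sym PW PW0.
  have Px : 0 < P x.
    by rewrite lt_neqAle P0 andbT; apply: contra_neq PW => <-; rewrite mul0r.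
  have Wx : 0 < W x.
    by rewrite lt_neqAle W0 andbT; apply: contra_neq PW => <-; rewrite mulr0.
  have mp : 0 < m.
    apply: lt_le_trans PWp _; rewrite /m (bigD1 x)//= lerDl.
    by apply: sumr_ge0.
  rewrite ler_pM2l// -ln_div ?posrE ?divr_gt0//.
  by rewrite le_eqVlt; apply/orP; left; apply/eqP; congr ln; field;
    rewrite !gt_eqF.
under eq_bigr do rewrite mulrBr.
rewrite sumrB -mulr_suml -/m -!addrA lerD2l.
by have := kl_ge0 m0 v0; rewrite /kl; lra.
Qed.

Local Open Scope ereal_scope.

(** * Unconditional sums over products and sequences *)

Lemma esumZl (R : realType) (T : choiceType) (I : set T) (c : R)
    (f : T -> \bar R) : (0 <= c)%R -> (forall x, 0 <= f x) ->
  \esum_(i in I) (c%:E * f i) = c%:E * \esum_(i in I) f i.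
Proof.
move=> c0 f0; rewrite /esum -ereal_supZl//; last first.
  by apply/set0P; exists (\sum_(x \in set0) f x); exists set0 => //; exact: fsets_set0.
congr ereal_sup; rewrite image_comp; apply: eq_imagel => A [finA _]/=.
by rewrite !fsbig_finite//= ge0_sume_distrr.
Qed.

Lemma esum_pair (R : realType) (T1 T2 : choiceType) (f : T1 * T2 -> \bar R) :
  (forall x, 0 <= f x) ->
  \esum_(x in [set: T1 * T2]) f x =
  \esum_(i in [set: T1]) \esum_(j in [set: T2]) f (i, j).
Proof.
move=> f0; rewrite (@esum_esum _ _ _ setT (fun=> setT) (fun i j => f (i, j)))//.
have -> : [set: T1] `*`` (fun=> [set: T2]) = setT by apply/seteqP; split.
by apply: eq_esum => -[].
Qed.

Lemma esum_prod (R : realType) (T1 T2 : choiceType) (f1 : T1 -> R)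
    (f2 : T2 -> R) : (forall i, 0 <= f1 i)%R -> (forall j, 0 <= f2 j)%R ->
  \esum_(x in [set: T1 * T2]) (f1 x.1 * f2 x.2)%:E =
  (\esum_(i in [set: T1]) (f1 i)%:E) * (\esum_(j in [set: T2]) (f2 j)%:E).
Proof.
move=> f10 f20; rewrite esum_pair => [|x]; last by rewrite lee_fin mulr_ge0.
under eq_esum do (under eq_esum do rewrite EFinM/=).
under eq_esum do (rewrite esumZl; [|by []|by move=> j; rewrite lee_fin]).
rewrite muleC.
have : 0 <= \esum_(j in [set: T2]) (f2 j)%:E.
  by apply: esum_ge0 => j _; rewrite lee_fin.
move: (\esum_(j in [set: T2]) (f2 j)%:E) => [c|_|//].
  rewrite lee_fin => c0; rewrite -esumZl//.
  by apply: eq_esum => i _; rewrite muleC.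
(* Second sum infinite: either [f1] vanishes and both sides are 0, as [0 * +oo = 0], or a single
   positive [f1 i] makes both infinite. *)
have [h|] := pselect (forall i, f1 i = 0%R).
  by rewrite !esum1 ?mule0// => i _; rewrite h ?mul0e.
move=> /existsNP[i /eqP fi0]; have fi : (0 < f1 i)%R by rewrite lt_neqAle eq_sym fi0 f10.
have ge (g : T1 -> \bar R) : (forall i, 0 <= g i) -> g i <= \esum_(i in [set: T1]) g i.
  move=> g0; rewrite (esumID [set i])//.
  by rewrite setTI esum_set1// leeDl// esum_ge0.
rewrite gt0_mulye; last first.
  by apply: lt_le_trans (ge (fun i => (f1 i)%:E) _) => [|j]; rewrite ?lte_fin ?lee_fin.
apply/eqP; rewrite -leye_eq; apply: le_trans (ge _ _).
  by rewrite gt0_muley ?lte_fin.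
by move=> j; rewrite mule_ge0 ?lee_fin.
Qed.

Lemma esum_cons (R : realType) (T : choiceType) (f : seq T -> \bar R) :
  (forall s, 0 <= f s) ->
  \esum_(s in [set: seq T]) f s =
  f [::] + \esum_(x in [set: T * seq T]) f (x.1 :: x.2).
Proof.
move=> f0; rewrite (esumID [set [::]])// setTI esum_set1//; congr (_ + _).
apply: reindex_esum; split => //=.
- by move=> [a s] [b t] _ _ /= [-> ->].
- by move=> [|a s] [_ //= _]; exists (a, s).
Qed.

Lemma esum_bool (R : realType) (T : choiceType) (f : bool * T -> \bar R) (b : bool) :
  (forall x, 0 <= f x) ->
  \esum_(x in [set: bool * T]) f x =
  \esum_(j in [set: T]) f (b, j) + \esum_(j in [set: T]) f (~~ b, j).
Proof.
move=> f0; rewrite esum_pair//.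
rewrite (esumID [set b]) => [|i _]; last exact: esum_ge0.
rewrite setTI esum_set1 ?esum_ge0//; congr (_ + _).
rewrite setTI (_ : ~` [set b] = [set ~~ b]) ?esum_set1 ?esum_ge0//.
by apply/seteqP; split => -[] //=; case: b.
Qed.

(** * Divergence and total mass of discrete laws *)

Definition KL {R : realType} {T : choiceType} (f g : T -> R) : \bar R :=
  \esum_(i in [set: T]) (kl (f i) (g i))%:E.

Definition mass {R : realType} {T : choiceType} (f : T -> R) : \bar R :=
  \esum_(i in [set: T]) (f i)%:E.

Lemma mass_convex (R : realType) (T : choiceType) (s : R) (f1 f2 f : T -> R) :
  (0 <= s <= 1)%R -> (forall i, 0 <= f1 i)%R -> (forall i, 0 <= f2 i)%R ->
  (forall i, f i = s * f1 i + (1 - s) * f2 i)%R ->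
  mass f1 = 1 -> mass f2 = 1 -> mass f = 1.
Proof.
move=> /andP[s0 s1] f10 f20 fE m1 m2; rewrite /mass.
have s10 : (0 <= 1 - s)%R by rewrite subr_ge0.
under eq_esum do rewrite fE EFinD !EFinM.
rewrite esumD; try by move=> i _; rewrite mule_ge0 ?lee_fin.
rewrite !esumZl//.
rewrite -/(mass f1) -/(mass f2) m1 m2 !mule1 -EFinD.
by congr EFin; ring.
Qed.

Lemma KL_convex (R : realType) (T : choiceType) (s : R) (f1 f2 f g : T -> R) :
  (0 <= s <= 1)%R -> (forall i, 0 <= f1 i)%R -> (forall i, 0 <= f2 i)%R ->
  (forall i, 0 < g i)%R -> (forall i, f i = s * f1 i + (1 - s) * f2 i)%R ->
  KL f g <= s%:E * KL f1 g + (1 - s)%:E * KL f2 g.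
Proof.
move=> s01 f10 f20 g0 fE; have /andP[s0 s1] := s01.
have s10 : (0 <= 1 - s)%R by rewrite subr_ge0.
rewrite /KL -!esumZl//; try by move=> i; rewrite lee_fin kl_ge0.
rewrite -esumD; try by move=> i _; rewrite mule_ge0 ?lee_fin ?kl_ge0.
by apply: le_esum => i _; rewrite fE -!EFinM -EFinD lee_fin kl_convex.
Qed.

Lemma KL_prod (R : realType) (T1 T2 : choiceType) (f1 g1 : T1 -> R)
    (f2 g2 : T2 -> R) :
  (forall i, 0 <= f1 i)%R -> (forall i, 0 <= f2 i)%R ->
  (forall i, 0 < g1 i)%R -> (forall i, 0 < g2 i)%R ->
  mass f1 = 1 -> mass f2 = 1 -> mass g1 = 1 -> mass g2 = 1 ->
  KL (fun x : T1 * T2 => f1 x.1 * f2 x.2)%R (fun x => g1 x.1 * g2 x.2)%R =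
  KL f1 g1 + KL f2 g2.
Proof.
move=> f10 f20 g1p g2p mf1 mf2 mg1 mg2.
have g10 i : (0 <= g1 i)%R by rewrite ltW.
have g20 i : (0 <= g2 i)%R by rewrite ltW.
set K := KL (fun x : T1 * T2 => _) _.
have k1 i : (0 <= kl (f1 i) (g1 i))%R by rewrite kl_ge0.
have k2 i : (0 <= kl (f2 i) (g2 i))%R by rewrite kl_ge0.
have k12 (i : T1) (j : T2) : (0 <= kl (f1 i * f2 j) (g1 i * g2 j))%R.
  by rewrite kl_ge0 ?mulr_ge0 ?mulr_gt0.
(* The two units on each side are the sums of the transposed terms of [kl_prod]; being finite, they
   cancel even if [K] is [+oo]. *)
have e : K + 1 + 1 = KL f1 g1 + KL f2 g2 + 1 + 1.
  have -> : K + 1 + 1 = \esum_(x in [set: T1 * T2])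
    (kl (f1 x.1 * f2 x.2) (g1 x.1 * g2 x.2) + g1 x.1 * f2 x.2 + f1 x.1 * g2 x.2)%:E.
    under eq_esum do rewrite EFinD EFinD.
    rewrite esumD; try by move=> i _; rewrite ?adde_ge0 ?lee_fin ?k12 ?mulr_ge0.
    rewrite esumD; try by move=> i _; rewrite ?adde_ge0 ?lee_fin ?k12 ?mulr_ge0.
    by rewrite !esum_prod// -!/(mass _) mf1 mf2 mg1 mg2 !mule1.
  under eq_esum do rewrite kl_prod// EFinD EFinD EFinD [(f2 _ * _)%R]mulrC.
  rewrite esumD; try by move=> i _; rewrite ?adde_ge0 ?lee_fin ?k12 ?mulr_ge0.
  rewrite esumD; try by move=> i _; rewrite ?adde_ge0 ?lee_fin ?k12 ?mulr_ge0.
  rewrite esumD; try by move=> i _; rewrite ?adde_ge0 ?lee_fin ?k12 ?mulr_ge0.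
  rewrite (esum_prod k1 f20) (esum_prod f10 k2) !esum_prod//.
  by rewrite -!/(mass _) -!/(KL _ _) mf1 mf2 mg1 mg2 !mule1 mul1e.
move: e; rewrite -!addeA -[(1 + 1)%E]EFinD => /(congr1 (fun z => z - (1 + 1)%R%:E)).
by rewrite !addeA !addeK.
Qed.

(** As [s <= 1], the term [- ln s] is nonnegative and can be summed in [\bar R]; [s - 1] is the
    change of mass seen by the correction in [kl]. *)
Lemma KL_scaler (R : realType) (T : choiceType) (f g : T -> R) (s : R) :
  (forall i, 0 <= f i)%R -> (forall i, 0 < g i)%R -> (0 < s <= 1)%R ->
  mass f = 1 -> mass g = 1 ->
  KL f (fun i => s * g i)%R = KL f g + (- ln s + s - 1)%:E.
Proof.
move=> f0 g0 /andP[s0 s1] mf mg.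
have gg0 i : (0 <= g i)%R by rewrite ltW.
have sg0 i : (0 < s * g i)%R by rewrite mulr_gt0.
have ls : (0 <= - ln s)%R by rewrite oppr_ge0 ln_le0.
have e : KL f (fun i => s * g i)%R + 1 = KL f g + (- ln s)%:E + s%:E.
  have -> : KL f (fun i => s * g i)%R + 1 =
     \esum_(i in [set: T]) (kl (f i) (s * g i) + g i)%:E.
    under eq_esum do rewrite EFinD.
    rewrite esumD; try by move=> i _; rewrite lee_fin ?kl_ge0.
    by rewrite -!/(mass _) mg.
  have -> : KL f g + (- ln s)%:E + s%:E =
     \esum_(i in [set: T]) (kl (f i) (g i) + - ln s * f i + s * g i)%:E.
    under eq_esum do rewrite EFinD EFinD EFinM [(s * _)%:E]EFinM.
    rewrite esumD; try by move=> i _; rewrite ?mule_ge0 ?adde_ge0 ?mule_ge0 ?lee_fin ?kl_ge0// ltW.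
    rewrite esumD; try by move=> i _; rewrite ?mule_ge0 ?adde_ge0 ?mule_ge0 ?lee_fin ?kl_ge0// ltW.
    by rewrite !esumZl// ?ltW// -!/(mass _) mf mg !mule1.
  by apply: eq_esum => i _; rewrite kl_scaler//; congr EFin; ring.
move: e => /(congr1 (fun z => z - 1)); rewrite addeK// => ->.
by rewrite -!addeA; congr (_ + _); rewrite -!EFinD; congr EFin; ring.
Qed.

(* The output law is dominated through a decoding [dec] that need only be onto: charging
   [Q] on all codes of an output only increases the divergence. *)
Lemma mutual_info_le (R : realType) (X : finType) (Y T : choiceType)
    (P : {ffun X -> R}) (W : X -> Y -> R) (dec : T -> Y) (Q : T -> R) (C : R) :
  input_dist X P -> (forall x y, 0 <= W x y)%R ->
  (forall y, exists t, dec t = y) -> (forall t, 0 < Q t)%R ->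
  (forall x, KL (W x \o dec) Q <= C%:E) ->
  mutual_info P W <= C%:E.
Proof.
move=> [P0 P1] W0 decS Q0 KLC.
pose enc y := projT1 (cid (decS y)).
have encK y : dec (enc y) = y by rewrite /enc; case: cid.
pose G t := (\sum_x P x * kl (W x (dec t)) (Q t))%R.
have G0 t : (0 <= G t)%R.
  by apply: sumr_ge0 => x _; rewrite mulr_ge0 ?kl_ge0.
apply: (@le_trans _ _ (\esum_(y in [set: Y]) (G (enc y))%:E)).
  by apply: le_esum => y _; rewrite lee_fin /G encK kl_mixture.
rewrite -(esum_image setT enc (fun t => (G t)%:E)); last first.
  by move=> y1 y2 _ _ /(congr1 dec); rewrite !encK.
apply: (@le_trans _ _ (\esum_(t in [set: T]) (G t)%:E)).
  rewrite [leRHS](esumID (range enc)) => [|t _]; last by rewrite lee_fin.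
  by rewrite setTI leeDl// esum_ge0// => t _; rewrite lee_fin.
rewrite /G; under eq_esum do rewrite -sumEFin.
rewrite esum_sum; last by move=> t x _ _; rewrite lee_fin mulr_ge0 ?kl_ge0.
have -> : C%:E = \sum_x ((P x)%:E * C%:E).
  rewrite -ge0_sume_distrl; last by move=> i _; rewrite lee_fin.
  by rewrite sumEFin P1 mul1e.
apply: lee_sum => x _; under eq_esum do rewrite EFinM.
rewrite esumZl//; last by move=> t; rewrite lee_fin kl_ge0.
by rewrite lee_wpmul2l ?lee_fin// KLC.
Qed.

Local Close Scope ereal_scope.

(** * Run lengths of the channel output *)

(* The negative binomial law, for [0 < m] only: at [m = 0] the predecessor truncates. *)
Definition nb {R : realType} (p : R) (m k : nat) : R :=
  'C((k + m).-1, k)%:R * (1 - p) ^+ m * p ^+ k.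

(** Both sides are the coefficient of degree [k] of a product of three polynomials truncated at
    degree [k]. *)
Lemma convA (R : comRingType) (a b c : nat -> R) (k : nat) :
  \sum_(i < k.+1) a i * (\sum_(j < (k - i).+1) b j * c (k - i - j)%N) =
  \sum_(i < k.+1) (\sum_(j < i.+1) a j * b (i - j)%N) * c (k - i)%N.
Proof.
pose P f := \poly_(i < k.+1) (f i : R).
have PE f i : (i <= k)%N -> (P f)`_i = f i by rewrite coef_poly ltnS => ->.
transitivity ((P a * (P b * P c))`_k).
  rewrite coefM; apply: eq_bigr => i _; rewrite PE -1?ltnS// coefM.
  congr (_ * _); apply: eq_bigr => j _.
  have jk : (j <= k)%N by rewrite (leq_trans _ (leq_subr i k))// -ltnS.
  by rewrite !PE// (leq_trans (leq_subr _ _))// leq_subr.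
rewrite mulrA coefM; apply: eq_bigr => i _; rewrite [(P c)`_ _]PE ?leq_subr// coefM.
have ik : (i <= k)%N by rewrite -ltnS.
congr (_ * _); apply: eq_bigr => j _.
have ji : (j <= i)%N by rewrite -ltnS.
by rewrite !PE// ?(leq_trans ji)// (leq_trans (leq_subr _ _)).
Qed.

(** The powers of [p] and [1 - p] factor out, leaving the hockey-stick identity for binomial
    coefficients. *)
Lemma nb_conv (R : realType) (p : R) (m k : nat) : (0 < m)%N ->
  \sum_(i < k.+1) nb p m i * ((1 - p) * p ^+ (k - i)) = nb p m.+1 k.
Proof.
case: m => // m _.
transitivity ((\sum_(i < k.+1) 'C(i + m, i)%:R) * ((1 - p) ^+ m.+2 * p ^+ k)).
  rewrite mulr_suml; apply: eq_bigr => i _; rewrite /nb addnS/=.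
  have e : (i + (k - i) = k)%N by apply: subnKC; rewrite -ltnS.
  by rewrite -[X in _ = _ * (_ * p ^+ X)]e exprD [_ ^+ m.+2]exprSr; ring.
rewrite /nb addnS/= -mulrA -natr_sum; congr (_%:R * _).
elim: k => [|k IH]; first by rewrite big_ord_recr big_ord0/= !bin0.
rewrite big_ord_recr/= IH [in RHS]addSn binS -addSnnS.
by rewrite addnC.
Qed.

Section channel.
Context {R : realType} (p : R).
Hypotheses (p0 : 0 < p) (p1 : p < 1).
Local Notation D0 := (fun j : nat => (1 - p) * p ^+ j).

Definition lead (c : bool) (y : seq bool) := find (fun b => b != c) y.

(** A finite recursion for the channel law: the first bit accounts for [j] leading copies of itself,
    and [j] cannot exceed the length of the leading run. [repeat_law_outlaw] identifies it with
    [repeat_law]. *)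
Fixpoint outlaw (D : nat -> R) (x y : seq bool) : R :=
  if x is c :: x' then
    \sum_(j < (lead c y).+1) D j * outlaw D x' (drop j y)
  else (y == [::])%:R.

Lemma outlaw_consE D c x y :
  outlaw D (c :: x) y = \sum_(j < (lead c y).+1) D j * outlaw D x (drop j y).
Proof. by []. Qed.

Arguments outlaw : simpl never.

(** Runs alternate in colour and are nonempty, hence the shift by one. The empty output has two
    codes, one for each [b]. *)
Fixpoint dec (b : bool) (ks : seq nat) : seq bool :=
  if ks is k :: ks' then nseq k.+1 b ++ dec (~~ b) ks' else [::].

Lemma lead_nseq b k ks : lead b (nseq k b ++ dec (~~ b) ks) = k.
Proof.
elim: k => [|k IH] /=; last by rewrite /lead/= eqxx/=; congr _.+1.
by case: ks => //= k ks; case: b.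
Qed.

Lemma drop_nseq_cat (T : Type) (b : T) j k z : (j <= k)%N ->
  drop j (nseq k b ++ z) = nseq (k - j) b ++ z.
Proof.
move=> jk; rewrite drop_cat size_nseq; case: ltngtP jk => // [jk|->] _.
  by rewrite drop_nseq.
by rewrite subnn drop0.
Qed.

Lemma dec_surj (y : seq bool) : exists bks, dec bks.1 bks.2 = y.
Proof.
case: y => [|c y]; first by exists (true, [::]).
suff [ks h] : exists ks, dec c ks = c :: y by exists (c, ks).
elim: y c => [|c' y IH] c; first by exists [:: 0%N].
have [ks] := IH c'; have [<-|cc] := eqVneq c c' => h; last first.
  by exists (0%N :: ks); rewrite /= (_ : ~~ c = c') ?h//; case: c c' cc {h IH} => -[].
by case: ks h => [|k ks] //= [<-]; exists (k.+1 :: ks).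
Qed.

(* Joint law of the length of the leading run of [b] and of the remaining run lengths minus
   one, when [m] copies of [b] are sent before [x]. *)
Definition runlaw (b : bool) (m : nat) (x : seq bool) (kk : nat * seq nat) : R :=
  \sum_(i < kk.1.+1) nb p m i *
    outlaw D0 x (nseq (kk.1 - i) b ++ dec (~~ b) kk.2).

(** The code once a bit [b] has left at least one copy: that copy opens the run, and the excess is
    again geometric, that is [nb p 1]. The empty code is then impossible. *)
Definition taillaw (b : bool) (x : seq bool) (ks : seq nat) : R :=
  if ks is k :: ks' then runlaw b 1 x (k, ks') else 0.

Lemma nb1 k : nb p 1 k = (1 - p) * p ^+ k.
Proof. by rewrite /nb addn1/= binn mul1r expr1. Qed.

Lemma runlaw_nil b m kk : runlaw b m [::] kk = nb p m kk.1 * (kk.2 == [::])%:R.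
Proof.
case: kk => k ks; rewrite /runlaw big_ord_recr/= subnn/= big1 => [|i _].
  by rewrite add0r; case: ks => //= k' ks; rewrite (negPf _)//.
case e : (k - i)%N => [|n]; last by rewrite mulr0.
by have := ltn_ord i; lia.
Qed.

(** The geometric number of copies of the new bit adds to the [NB_m] copies of the run; this is
    associativity of convolution together with [nb_conv]. *)
Lemma runlaw_same b m x kk : (0 < m)%N ->
  runlaw b m (b :: x) kk = runlaw b m.+1 x kk.
Proof.
move=> m0; case: kk => k ks; rewrite /runlaw/=.
under [RHS]eq_bigr do rewrite -nb_conv//.
rewrite -(convA (nb p m) D0 (fun j => outlaw D0 x (nseq j b ++ dec (~~ b) ks))).
apply: eq_bigr => i _; congr (_ * _); rewrite outlaw_consE lead_nseq.
by apply: eq_bigr => j _; rewrite drop_nseq_cat// -ltnS.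
Qed.

(** The term [j = 0] is a deletion; in the others a factor [p] comes out and the shifted geometric
    law is that of [taillaw]. *)
Lemma outlaw_cons c x b ks :
  outlaw D0 (c :: x) (dec b ks) =
  (1 - p) * outlaw D0 x (dec b ks) + p * ((c == b)%:R * taillaw b x ks).
Proof.
rewrite outlaw_consE; case: ks => [|k ks].
  by rewrite big_ord_recl big_ord0 /= expr0 mulr1 !mulr0.
rewrite -[dec b (k :: ks)]/(nseq k.+1 b ++ dec (~~ b) ks).
case: eqVneq => [->|cb]; last first.
  rewrite (_ : lead c _ = 0%N) => [|]; last by rewrite /lead/= eq_sym cb.
  by rewrite big_ord_recl big_ord0 expr0 mulr1 mul0r mulr0 drop0.
rewrite lead_nseq big_ord_recl expr0 mulr1 mul1r drop0; congr (_ + _).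
rewrite /taillaw /runlaw mulr_sumr; apply: eq_bigr => i _.
rewrite nb1 drop_nseq_cat ?ltnS// -1?ltnS// lift0 subSS exprS; ring.
Qed.

(** Either the new bit is deleted and the current run stays open, or it closes the run; in the
    latter case the run length and the rest of the code are independent. *)
Lemma runlaw_diff b m x k ks :
  runlaw b m (~~ b :: x) (k, ks) =
  (1 - p) * runlaw b m x (k, ks) + p * (nb p m k * taillaw (~~ b) x ks).
Proof.
rewrite /runlaw mulr_sumr !(big_ord_recr k)/= -addrA; congr (_ + _).
  (* For [i < k] the remaining output still starts with [b], so the opposite bit must be deleted;
     only [i = k] lets it survive. *)
  apply: eq_bigr => i _; case e : (k - i)%N => [|n].
    by have := ltn_ord i; lia.
  rewrite outlaw_consE (_ : lead _ _ = 0%N); last by rewrite /lead/=; case: b.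
  by rewrite big_ord_recl big_ord0 /= expr0; ring.
by rewrite subnn /= outlaw_cons eqxx mul1r; ring.
Qed.

Lemma outlaw_ge0 x y : 0 <= outlaw D0 x y.
Proof.
elim: x y => [|c x IH] y; first by rewrite /outlaw; case: eqP.
by rewrite outlaw_consE; apply: sumr_ge0 => i _; rewrite mulr_ge0// mulr_ge0 ?exprn_ge0// ?subr_ge0 ltW.
Qed.

Lemma nb_ge0 m k : 0 <= nb p m k.
Proof. by rewrite /nb !mulr_ge0 ?exprn_ge0// ?subr_ge0 ltW. Qed.

Lemma runlaw_ge0 b m x kk : 0 <= runlaw b m x kk.
Proof. by apply: sumr_ge0 => i _; rewrite mulr_ge0 ?nb_ge0 ?outlaw_ge0. Qed.

Lemma taillaw_ge0 b x ks : 0 <= taillaw b x ks.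
Proof. by case: ks => //= k ks; exact: runlaw_ge0. Qed.

Local Open Scope ereal_scope.

Lemma lee_mix (s a b c : R) (x y : \bar R) : (0 <= s <= 1)%R ->
  x <= a%:E -> y <= b%:E -> (s * a + (1 - s) * b <= c)%R ->
  s%:E * x + (1 - s)%:E * y <= c%:E.
Proof.
move=> /andP[s0 s1] xa yb abc; have s10 : (0 <= 1 - s)%R by rewrite subr_ge0.
apply: (@le_trans _ _ (s%:E * a%:E + (1 - s)%:E * b%:E)).
  by apply: leeD; apply: lee_wpmul2l.
by rewrite -!EFinM -EFinD lee_fin.
Qed.

(** * Divergence of the run-length code from a stopped i.i.d. law *)

Section divergence.
Variables (Q1 : nat -> R) (A B th : R).
Hypotheses (Q1_gt0 : forall k, (0 < Q1 k)%R) (mQ1 : mass Q1 = 1)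
  (th0 : (0 < th)%R) (th1 : (th < 1)%R) (B0 : (0 <= B)%R) (BA : (B <= A)%R)
  (mnb : forall m, (0 < m)%N -> mass (nb p m) = 1)
  (KLnb : forall m, (0 < m)%N -> KL (nb p m) Q1 <= (A + p / (1 - p) * m%:R * B)%:E).

(* I.i.d. run lengths of law [Q1], stopped with probability [th] at each run; [th] tends
   to [0] in [repeat_capacity_le]. *)
Fixpoint Qtail (ks : seq nat) : R :=
  if ks is k :: ks' then ((1 - th) * (Q1 k * Qtail ks'))%R else th.

Let th10 : (0 < 1 - th)%R. Proof. by rewrite subr_gt0. Qed.

Lemma Qtail_gt0 ks : (0 < Qtail ks)%R.
Proof. by elim: ks => //= k ks IH; rewrite !mulr_gt0. Qed.

Let Qtail_ge0 ks : (0 <= Qtail ks)%R.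
Proof. by rewrite ltW ?Qtail_gt0. Qed.

Let Q1_ge0 k : (0 <= Q1 k)%R. Proof. by rewrite ltW. Qed.

Lemma mass_Qtail : mass Qtail = 1.
Proof.
(* The recursion [m = th + (1 - th) m] for the mass is also solved by [+oo]; truncation to codes of
   length at most [n] first shows that the mass is at most 1. *)
pose T n ks := (if (size ks <= n)%N then Qtail ks else 0)%R.
have T0 n ks : (0 <= T n ks)%R by rewrite /T; case: ifP.
have consE (F : seq nat -> R) (G : seq nat -> R) : (forall ks, 0 <= F ks)%R ->
    (forall ks, 0 <= G ks)%R ->
    F [::] = th -> (forall k ks, F (k :: ks) = (1 - th) * (Q1 k * G ks))%R ->
    mass F = th%:E + (1 - th)%:E * mass G.
  move=> F0 G0 Fn Fc; rewrite /mass esum_cons => [|ks]; last by rewrite lee_fin.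
  rewrite Fn; congr (_ + _).
  under eq_esum do rewrite Fc EFinM.
  rewrite esumZl ?(ltW th10)// => [|x]; last by rewrite lee_fin mulr_ge0.
  by rewrite (esum_prod Q1_ge0 G0) -/(mass Q1) mQ1 mul1e.
have T1 n : mass (T n) <= 1.
  elim: n => [|n IH].
    rewrite (consE _ (fun=> 0%R))// => [|k ks]; last by rewrite /T/= !mulr0.
    by rewrite /mass esum1 ?mule0 ?adde0 ?lee_fin ?ltW.
  rewrite (consE _ (T n))// => [|k ks]; last first.
    by rewrite /T/= ltnS; case: ifP => // _; rewrite !mulr0.
  apply: (@le_trans _ _ (th%:E + (1 - th)%:E * 1)).
    by rewrite leeD2l// lee_wpmul2l// lee_fin ltW.
  by rewrite mule1 -EFinD addrC subrK.
have le1 : mass Qtail <= 1.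
  apply: ge_ereal_sup => _ [X [finX _]] <-.
  pose n := (\max_(ks <- finmap.enum_fset (fset_set X)) size ks)%N.
  apply: le_trans (T1 n); apply: esum_ge; exists X => //.
  rewrite fsbig_finite//= fsbig_finite//=.
  rewrite big_seq [leRHS]big_seq; apply: lee_sum => ks ksX.
  have le : (size ks <= n)%N by apply: leq_bigmax_seq.
by rewrite /T le.
have mE := consE _ _ Qtail_ge0 Qtail_ge0 erefl (fun k ks => erefl).
have m0 : 0 <= mass Qtail by apply: esum_ge0 => i _; rewrite lee_fin.
move: mE m0 le1; case: (mass Qtail) => // r + _ _.
rewrite -EFinM -EFinD => -[e]; congr EFin.
have : (th * (1 - r) = 0)%R by lra.
by move/eqP; rewrite mulf_eq0 gt_eqF//= subr_eq0 => /eqP.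
Qed.

Lemma mass_runlaw x b m : (0 < m)%N -> mass (runlaw b m x) = 1.
Proof.
have p01 : (0 <= 1 - p <= 1)%R by have := p0; have := p1; lra.
elim: x b m => [|c x IH] b m m0.
  rewrite /mass; under eq_esum do rewrite runlaw_nil.
  rewrite (@esum_prod _ _ _ (nb p m) (fun ks : seq nat => (ks == [::])%:R))%R//.
  - rewrite -/(mass _) mnb// mul1e esum_cons => [|s]; last by rewrite lee_fin.
    by rewrite esum1 ?adde0.
  - by move=> k; exact: nb_ge0.
have [->|/negPf cb] := eqVneq c b.
  rewrite -(IH b m.+1)//; apply: eq_esum => kk _; rewrite runlaw_same//.
have {cb}-> : c = ~~ b by case: c b cb => -[].
apply: (@mass_convex _ _ (1 - p)%R (runlaw b m x)
  (fun kk => nb p m kk.1 * taillaw (~~ b) x kk.2)%R) => //.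
- by move=> kk; exact: runlaw_ge0.
- by move=> kk; rewrite mulr_ge0 ?nb_ge0 ?taillaw_ge0.
- by move=> [k ks]; rewrite runlaw_diff; ring.
- exact: IH.
rewrite /mass (esum_prod (nb_ge0 m) (taillaw_ge0 (~~ b) x)) -/(mass _) mnb// mul1e.
rewrite esum_cons => [|s]; last by rewrite lee_fin taillaw_ge0.
by rewrite /= add0e -[RHS](IH (~~ b) 1%N)//; apply: eq_esum => -[].
Qed.

Lemma mass_taillaw x b : mass (taillaw b x) = 1.
Proof.
rewrite /mass esum_cons => [|s]; last by rewrite lee_fin taillaw_ge0.
by rewrite /= add0e -[RHS](mass_runlaw x b (isT : 0 < 1)%N); apply: eq_esum => -[].
Qed.

Let Qrun (kk : nat * seq nat) : R := (Q1 kk.1 * Qtail kk.2)%R.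

Let Qrun_gt0 kk : (0 < Qrun kk)%R.
Proof. by rewrite mulr_gt0 ?Qtail_gt0. Qed.

Let mass_Qrun : mass Qrun = 1.
Proof. by rewrite /mass esum_prod// -!/(mass _) mass_Qtail mQ1 mule1. Qed.

(** The empty code adds [kl 0 th = th], which cancels the mass lost in scaling by [1 - th]; only the
    price of continuing remains. *)
Lemma KL_taillaw x b :
  KL (taillaw b x) Qtail = KL (runlaw b 1 x) Qrun + (- ln (1 - th))%:E.
Proof.
rewrite /KL esum_cons => [|s]; last by rewrite lee_fin kl_ge0 ?taillaw_ge0 ?Qtail_gt0.
rewrite /= kl0l.
have -> : \esum_(x0 in [set: nat * seq nat])
   (kl (runlaw b 1 x (x0.1, x0.2)) ((1 - th) * (Q1 x0.1 * Qtail x0.2)))%:E =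
   KL (runlaw b 1 x) (fun kk => (1 - th) * Qrun kk)%R.
  by apply: eq_esum => -[].
rewrite KL_scaler ?mass_runlaw//; last 2 first.
- by move=> kk; exact: runlaw_ge0.
- by rewrite th10/= gerBl ltW.
by rewrite addeCA -EFinD; congr (_ + EFin _); ring.
Qed.

Lemma KL_nil : KL (fun ks : seq nat => (ks == [::])%:R%R) Qtail = (- ln th)%:E.
Proof.
have := mass_Qtail; rewrite /mass esum_cons => [|s]; last by rewrite lee_fin.
rewrite [Qtail [::]]/= => /(congr1 (fun z => (- th)%:E + z)).
rewrite addeA -EFinD addNr add0e => e.
rewrite /KL esum_cons => [|s]; last by rewrite lee_fin kl_ge0 ?Qtail_gt0.
under eq_esum do rewrite eqE/= kl0l.
rewrite -[\esum_(x in _) _]/(\esum_(x in setT) (Qtail (x.1 :: x.2))%:E) e.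
by rewrite /= klE// ln1 -!EFinD; congr EFin; ring.
Qed.

(** [A] increased by the price of not stopping, paid by every run. *)
Let A' := (A - ln (1 - th))%R.
Let lam := (p / (1 - p))%R.

(** Induction on the input, charging [p (A' + lam * B)] per bit: this is the exact charge for a bit
    that changes colour, and suffices by [B <= A] for one that repeats it; [- ln th] pays for the
    final stop. *)
Lemma KL_runlaw x b m : (0 < m)%N -> KL (runlaw b m x) Qrun <=
  (A' + lam * m%:R * B + (A' + lam * B) * (p * (size x)%:R) - ln th)%:E.
Proof.
have lth : (0 <= - ln th)%R by rewrite oppr_ge0 ln_le0 ?ltW.
have lth1 : (0 <= - ln (1 - th))%R by rewrite oppr_ge0 ln_le0// gerBl ltW.
have p01 : (0 <= 1 - p <= 1)%R by have := p0; have := p1; lra.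
have lamE : (lam * (1 - p) = p)%R by rewrite /lam divfK// gt_eqF// subr_gt0.
elim: x b m => [|c x IH] b m m0.
  have -> : KL (runlaw b m [::]) Qrun = KL (nb p m) Q1 + (- ln th)%:E.
    rewrite -KL_nil -KL_prod ?mnb ?mass_Qtail//.
    - by apply: eq_esum => kk _; rewrite runlaw_nil.
    - by move=> k; exact: nb_ge0.
    - exact: Qtail_gt0.
    rewrite /mass esum_cons => [|s]; last by rewrite lee_fin.
    by rewrite esum1 ?adde0.
  apply: le_trans (leeD2r _ (KLnb m0)) _; rewrite -EFinD lee_fin /= !mulr0 /A' /lam.
  by move: lth1; lra.
have [->|/negPf cb] := eqVneq c b.
  have -> : KL (runlaw b m (b :: x)) Qrun = KL (runlaw b m.+1 x) Qrun.
    by apply: eq_esum => kk _; rewrite runlaw_same.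
  apply: le_trans (IH _ _ _) _ => //; rewrite lee_fin /=.
  rewrite -[m.+1]addn1 -[(size x).+1]addn1 !natrD.
  suff : (lam * B <= (A' + lam * B) * p)%R by lra.
  (* As [lam = p + lam * p], the claim reduces to [p * B <= p * A']. *)
  have e : (lam * B = p * B + lam * B * p)%R by rewrite -[X in _ = (X * B + _)%R]lamE; ring.
  have : (p * B <= p * A')%R by rewrite ler_pM2l// /A'; have := BA; lra.
  by lra.
have {cb}-> : c = ~~ b by case: c b cb => -[].
have h1 kk : (0 <= runlaw b m x kk)%R by exact: runlaw_ge0.
have h2 (kk : nat * seq nat) : (0 <= nb p m kk.1 * taillaw (~~ b) x kk.2)%R.
  by rewrite mulr_ge0 ?nb_ge0 ?taillaw_ge0.
have h3 kk : (runlaw b m (~~ b :: x) kk = (1 - p) * runlaw b m x kk +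
    (1 - (1 - p)) * (nb p m kk.1 * taillaw (~~ b) x kk.2))%R.
  by case: kk => k ks; rewrite runlaw_diff /=; ring.
apply: le_trans (KL_convex p01 h1 h2 Qrun_gt0 h3) _.
rewrite (KL_prod (nb_ge0 m) (taillaw_ge0 (~~ b) x) Q1_gt0 Qtail_gt0)
  ?mnb ?mass_taillaw ?mass_Qtail//.
rewrite KL_taillaw.
have e1 := IH b m m0; have e2 := IH (~~ b) 1%N isT; have e3 := KLnb m0; rewrite -/lam in e3.
have h := leeD e3 (leeD2r (- ln (1 - th))%:E e2); rewrite -!EFinD in h.
apply: (lee_mix p01 e1 h) => /=.
rewrite -[(size x).+1]addn1 natrD /A'.
by rewrite le_eqVlt; apply/orP; left; apply/eqP; ring.
Qed.

(** Before any copy survives no run is open and the empty output is still possible; the first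
    surviving bit opens a run whose colour costs [ln 2]. Whatever does not grow with [size x]
    disappears after division by the length. *)
Lemma KL_outlaw x : KL (fun bks : bool * seq nat => outlaw D0 x (dec bks.1 bks.2))
   (fun bks => 2^-1 * Qtail bks.2)%R <=
  ((A' + lam * B) * (1 + p * (size x)%:R) + 2 * ln 2 - 2 * ln th - ln (1 - th))%:E.
Proof.
have lth : (0 <= - ln th)%R by rewrite oppr_ge0 ln_le0 ?ltW.
have lth1 : (0 <= - ln (1 - th))%R by rewrite oppr_ge0 ln_le0// gerBl ltW.
have l2 : (0 <= ln (2 : R))%R by rewrite ln_ge0// ler1n.
have c10 : (0 <= A' + lam * B)%R.
  rewrite /A' addr_ge0//; first by have := BA; have := B0; lra.
  by rewrite mulr_ge0// /lam divr_ge0 ?subr_ge0// ltW.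
have p01 : (0 <= 1 - p <= 1)%R by have := p0; have := p1; lra.
have half1 : (0 < (2^-1 : R) <= 1)%R by lra.
have lhalf : (- ln (2^-1 : R) = ln 2)%R by rewrite lnV ?posrE// opprK.
have Q2_gt0 ks : (0 < 2^-1 * Qtail ks)%R by rewrite mulr_gt0 ?Qtail_gt0.
elim: x => [|c x IH].
  have F0 (bks : bool * seq nat) : (0 <= outlaw D0 [::] (dec bks.1 bks.2))%R by exact: outlaw_ge0.
  rewrite /KL (@esum_bool _ _ _ true) => [|bks]; last by rewrite lee_fin kl_ge0.
  (* Both codes of the empty output are charged, hence the factors 2 in the bound. *)
  have e b : \esum_(j in [set: seq nat])
      (kl (outlaw D0 [::] (dec (b, j).1 (b, j).2)) (2^-1 * Qtail (b, j).2))%:E =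
      (- ln th)%:E + (ln 2 + 2^-1 - 1)%:E.
    rewrite -KL_nil -lhalf -KL_scaler ?mass_Qtail//.
    - by apply: eq_esum => -[|k ks].
    - exact: Qtail_gt0.
    rewrite /mass esum_cons => [|s]; last by rewrite lee_fin.
    by rewrite esum1 ?adde0.
  rewrite !e -!EFinD lee_fin /= mulr0; move: lth1 c10; lra.
have f10 (bks : bool * seq nat) : (0 <= outlaw D0 x (dec bks.1 bks.2))%R by exact: outlaw_ge0.
have f20 (bks : bool * seq nat) : (0 <= (c == bks.1)%:R * taillaw bks.1 x bks.2)%R.
  by rewrite mulr_ge0 ?taillaw_ge0.
have fE (bks : bool * seq nat) : (outlaw D0 (c :: x) (dec bks.1 bks.2) =
    (1 - p) * outlaw D0 x (dec bks.1 bks.2) +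
    (1 - (1 - p)) * ((c == bks.1)%:R * taillaw bks.1 x bks.2))%R.
  by rewrite outlaw_cons; ring.
apply: le_trans (KL_convex p01 f10 f20 _ fE) _ => // {fE}.
have -> : KL (fun bks : bool * seq nat => (c == bks.1)%:R * taillaw bks.1 x bks.2)%R
    (fun bks => 2^-1 * Qtail bks.2)%R =
    KL (runlaw c 1 x) Qrun + (- ln (1 - th) + ln 2)%:E.
  rewrite [LHS](@esum_bool _ _ _ c) => [|bks]; last by rewrite lee_fin kl_ge0.
  have -> : \esum_(j in [set: seq nat])
     (kl ((c == (~~ c, j).1)%:R * taillaw (~~ c, j).1 x (~~ c, j).2) (2^-1 * Qtail (~~ c, j).2))%:E
     = (2^-1)%:E.
    rewrite /= (_ : (c == ~~ c) = false); last by case: c {IH f20}.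
    under eq_esum do rewrite mul0r kl0l EFinM.
    by rewrite esumZl// -/(mass Qtail) mass_Qtail mule1.
  have -> : \esum_(j in [set: seq nat])
     (kl ((c == (c, j).1)%:R * taillaw (c, j).1 x (c, j).2) (2^-1 * Qtail (c, j).2))%:E =
     KL (taillaw c x) (fun ks => 2^-1 * Qtail ks)%R.
    by apply: eq_esum => ks _ /=; rewrite eqxx mul1r.
  rewrite KL_scaler ?mass_taillaw ?mass_Qtail//; last 2 first.
  - by move=> ks; exact: taillaw_ge0.
  - exact: Qtail_gt0.
  rewrite KL_taillaw lhalf -!addeA -!EFinD; congr (_ + EFin _); by field.
have e2 := KL_runlaw x c (isT : 0 < 1)%N.
have h := leeD2r (- ln (1 - th) + ln 2)%:E e2; rewrite -!EFinD in h.
apply: (lee_mix p01 IH h); rewrite /= mulr1.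
rewrite -[(size x).+1]addn1 natrD.
set c1 := (A' + lam * B)%R in c10 *; set z := (size x)%:R; set u := ln th in lth *.
set v := ln (1 - th) in lth1 *; set l := ln 2 in l2 *.
have q0 := p0.
have h1 : (0 <= p * c1)%R by rewrite mulr_ge0// ltW.
have h2 : (0 <= p * - u)%R by rewrite mulr_ge0// ltW.
have h3 : (0 <= p * l)%R by rewrite mulr_ge0// ltW.
by lra.
Qed.

End divergence.
End channel.

Local Open Scope ereal_scope.

(** * From the run-length bound to the capacity *)

Lemma lead_cat c j z y :
  nseq j c ++ z = y <-> (j <= lead c y)%N /\ z = drop j y.
Proof.
elim: j y => [|j IH] [|a y] //=.
- by split => [->|[]].
- by split => [->|[]].
- by split=> // -[].
- rewrite /lead /=; case: (eqVneq a c) => [->|ac] /=; last first.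
    by split => [[ca]|[]//]; rewrite ca eqxx in ac.
  by rewrite ltnS -/(lead c y) -IH; split=> [[]|->].
Qed.

Lemma repeat_law_outlaw (R : realType) (D : nat -> R) n (x : n.-tuple bool) y :
  (forall j, 0 <= D j)%R -> repeat_law D x y = outlaw D x y.
Proof.
move=> D0; rewrite /repeat_law.
suff -> : \esum_(k in [set k : n.-tuple nat | repeat_string k x = y])
    (\prod_(i < n) D (tnth k i))%:E = (outlaw D x y)%:E by [].
elim: n x y => [|n IH] x y.
  rewrite (tuple0 x) /= /outlaw; case: eqP => [->|y0].
    rewrite (_ : [set _ | _] = [set [tuple]]).
      by rewrite esum_set1 ?big_ord0// lee_fin.
    by apply/seteqP; split => k /=; rewrite (tuple0 k).
  by rewrite esum1// => k /=; rewrite (tuple0 k) => /esym.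
case/tupleP: x => c x.
pose J j := [set k : n.-tuple nat | nseq j c ++ repeat_string k x = y].
rewrite (reindex_esum ([set: nat] `*`` J) _ (fun z => [tuple of z.1 :: z.2])); last first.
  split => [[j k] /= [_ Jk] //|[j k] [j' k'] _ _ /= /(congr1 val) /= [-> /val_inj ->]//|].
  by case/tupleP => j k /= e; exists (j, k).
pose a j (k : n.-tuple nat) := (D j * \prod_(i < n) D (tnth k i))%:E.
transitivity (\esum_(z in [set: nat] `*`` J) a z.1 z.2).
  apply: eq_esum => -[j k] _; rewrite big_ord_recl /a /= tnth0; congr (_ * _)%:E.
  by apply: eq_bigr => i _; rewrite tnthS.
have prod0 (k : n.-tuple nat) : (0 <= \prod_(i < n) D (tnth k i))%R by exact: prodr_ge0.
rewrite -esum_esum => [|j k _ _]; last by rewrite lee_fin mulr_ge0.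
(* Only [j <= lead c y] can match [y]; other replication numbers contribute empty sums, and the
   outer sum becomes finite. *)
rewrite (esumID `I_((lead c y).+1)) => [|j _]; last first.
  by apply: esum_ge0 => k _; rewrite lee_fin mulr_ge0.
rewrite [X in _ + X]esum1 ?adde0 => [|j [_ /= /negP]]; last first.
  rewrite -leqNgt => lj; rewrite esum1// => k /= /lead_cat[]; lia.
rewrite setTI esum_fset//; last by move=> j _; apply: esum_ge0 => k _; rewrite lee_fin mulr_ge0.
rewrite -fsbig_ord outlaw_consE -sumEFin; apply: eq_bigr => j _.
rewrite EFinM -IH -esumZl//.
rewrite (_ : J j = [set k : n.-tuple nat | repeat_string k x = drop j y]).
  by apply: eq_esum => k _; rewrite /a EFinM.
apply/seteqP; split => k /=; first by move=> /lead_cat[].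
by move=> e; apply/lead_cat; split=> //; rewrite -ltnS.
Qed.

(** For fixed [th] the bound at length [n] is linear in [n] with a constant overhead, so [n] goes to
    infinity first and the price [- ln (1 - th)] per run is made small by the choice of [th]. *)
Lemma repeat_capacity_le (R : realType) (p A B : R) (Q1 : nat -> R) :
  (0 < p < 1)%R -> (forall k, 0 < Q1 k)%R -> mass Q1 = 1 ->
  (0 <= B <= A)%R ->
  (forall m, (0 < m)%N -> mass (nb p m) = 1) ->
  (forall m, (0 < m)%N -> KL (nb p m) Q1 <= (A + p / (1 - p) * m%:R * B)%:E) ->
  repeat_capacity (fun j => (1 - p) * p ^+ j)%R <= (p * (A + p / (1 - p) * B))%:E.
Proof.
move=> /andP[p0 p1] Q10 mQ1 /andP[B0 BA] mnb KLnb.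
set lam := (p / (1 - p))%R.
have lam0 : (0 <= lam)%R by rewrite divr_ge0 ?subr_ge0// ltW.
have D0 j : (0 <= (1 - p) * p ^+ j)%R by rewrite mulr_ge0 ?exprn_ge0 ?subr_ge0// ltW.
rewrite /repeat_capacity; set u := (fun n : nat => _).
have ub th n : (0 < th < 1)%R -> (0 < n)%N -> u n <= ((A - ln (1 - th) + lam * B) * p +
    n%:R^-1 * ((A - ln (1 - th) + lam * B) + 2 * ln 2 - 2 * ln th - ln (1 - th)))%:E.
  move=> /andP[th0 th1] n0; rewrite /u.
  set c1 := (A - ln (1 - th) + lam * B)%R; set E := (2 * ln 2 - 2 * ln th - ln (1 - th))%R.
  apply: (@le_trans _ _ (n%:R^-1%:E * (c1 * (1 + p * n%:R) + E)%:E)).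
    apply: lee_wpmul2l; first by rewrite lee_fin.
    apply: ge_ereal_sup => _ [P PI] <-.
    apply: (mutual_info_le (dec := fun bks => dec bks.1 bks.2)
      (Q := fun bks => 2^-1 * Qtail Q1 th bks.2)%R) => //.
    - by move=> x y; rewrite repeat_law_outlaw// outlaw_ge0.
    - exact: dec_surj.
    - by move=> t; rewrite mulr_gt0 ?Qtail_gt0.
    - move=> x; have := KL_outlaw p0 p1 Q10 mQ1 th0 th1 B0 BA mnb KLnb x.
      rewrite size_tuple !addrA => /(le_trans _); apply.
      by apply: le_esum => bks _ /=; rewrite repeat_law_outlaw.
  rewrite -EFinM lee_fin le_eqVlt; apply/orP; left; apply/eqP.
  have nn0 : (n%:R != 0 :> R)%R by rewrite pnatr_eq0 -lt0n.
  by rewrite /E; field.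
(* For a sequence without limit [limn] is the default 0, below the nonnegative bound. *)
have [cu|ncu] := pselect (cvgn u); last first.
  rewrite dvgP//.
  have pB0 : (0 <= lam * B)%R by rewrite mulr_ge0.
  by rewrite lee_fin mulr_ge0//; [exact: ltW|move: B0 BA pB0; lra].
have pB0 : (0 <= lam * B)%R by rewrite mulr_ge0.
apply/lee_addgt0Pr => e e0.
(* [- ln (1 - th) = e'] adds [p * e' = e / 2] to the bound; the overhead divided by [n] takes the
   other half. *)
pose e' := (e / (2 * p))%R.
have e'0 : (0 < e')%R by rewrite divr_gt0 ?mulr_gt0.
pose th := (1 - expR (- e'))%R.
have th01 : (0 < th < 1)%R.
  by rewrite /th subr_gt0 expR_lt1 oppr_lt0 e'0/= gtrBl expR_gt0.
pose E := (A - ln (1 - th) + lam * B + 2 * ln 2 - 2 * ln th - ln (1 - th))%R.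
apply: lime_le => //; near=> n.
have n0 : (0 < n)%N by near: n; exact: nbhs_infty_gt.
have nE : (2 * E / e <= n%:R)%R by near: n; exact: nbhs_infty_ger.
apply: (le_trans (ub th n th01 n0)); rewrite -EFinD lee_fin -/E.
have -> : (ln (1 - th) = - e')%R by rewrite /th opprB addrC subrK expRK.
have -> : ((A - - e' + lam * B) * p = p * (A + lam * B) + e / 2)%R.
  by rewrite /e'; field; rewrite gt_eqF.
have : (n%:R^-1 * E <= e / 2)%R.
  rewrite mulrC ler_pdivrMr ?ltr0n//.
  by move: nE; rewrite ler_pdivrMr//; lra.
by lra.
Unshelve. all: by end_near.
Qed.

Local Close Scope ereal_scope.

(** * Series and the negative binomial law *)

(** Ordered convergence, for real terms of either sign; [esum_hasSum] passes to unconditional sums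
    when the terms are nonnegative. *)
Definition hasSum {R : realType} (f : nat -> R) (l : R) := series f @ \oo --> l.

Lemma hasSumD (R : realType) (f g : nat -> R) a b :
  hasSum f a -> hasSum g b -> hasSum (fun k => f k + g k) (a + b).
Proof.
move=> fa gb; rewrite /hasSum (_ : series _ = series f + series g).
  exact: cvgD.
by rewrite -seriesD.
Qed.

Lemma hasSumZ (R : realType) (f : nat -> R) c a :
  hasSum f a -> hasSum (fun k => c * f k) (c * a).
Proof.
move=> fa; rewrite /hasSum (_ : series _ = c *: series f).
  exact: cvgZr.
by rewrite -seriesZ.
Qed.

Arguments hasSumZ {R f} c {a}.

Lemma hasSumB (R : realType) (f g : nat -> R) a b :
  hasSum f a -> hasSum g b -> hasSum (fun k => f k - g k) (a - b).
Proof.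
move=> fa /(hasSumZ (-1)) gb; rewrite -[b]mul1r -mulNr.
have := hasSumD fa gb; congr hasSum; apply/funext => k; ring.
Qed.

Lemma eq_hasSum (R : realType) (f g : nat -> R) a :
  f =1 g -> hasSum f a -> hasSum g a.
Proof. by move=> /funext ->. Qed.

Lemma hasSum_lim (R : realType) (f : nat -> R) a : hasSum f a -> limn (series f) = a.
Proof. by move=> fa; apply: cvg_lim. Qed.

Lemma cvg_hasSum (R : realType) (f : nat -> R) : cvgn (series f) -> hasSum f (limn (series f)).
Proof. by []. Qed.

Lemma hasSum_le (R : realType) (f g : nat -> R) a b :
  hasSum f a -> hasSum g b -> (forall k, f k <= g k) -> a <= b.
Proof.
move=> fa gb fg; rewrite -(hasSum_lim fa) -(hasSum_lim gb); apply: ler_lim.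
- by apply/cvg_ex; exists a.
- by apply/cvg_ex; exists b.
- by apply: nearW => n; rewrite /series/=; apply: ler_sum.
Qed.

Lemma hasSum_ge_part (R : realType) (f : nat -> R) a n :
  (forall k, 0 <= f k) -> hasSum f a -> series f n <= a.
Proof.
move=> f0 fa; rewrite -(hasSum_lim fa); apply: nondecreasing_cvgn_le.
- exact: nondecreasing_series.
- by apply/cvg_ex; exists a.
Qed.

Lemma nonneg_cvg_series (R : realType) (f : nat -> R) M :
  (forall k, 0 <= f k) -> (forall n, series f n <= M) -> cvgn (series f).
Proof.
move=> f0 fM; apply: nondecreasing_is_cvgn; first exact: nondecreasing_series.
by exists M => _ [n _ <-].
Qed.

Lemma dominated_cvg_series (R : realType) (f g : nat -> R) :
  (forall k, `|f k| <= g k) -> cvgn (series g) -> cvgn (series f).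
Proof.
move=> fg cg; apply: normed_cvg; apply: series_le_cvg cg => // k.
- by rewrite /= normr_ge0.
- exact: le_trans (normr_ge0 _) (fg k).
Qed.

Lemma esum_hasSum (R : realType) (f : nat -> R) a :
  (forall k, 0 <= f k) -> hasSum f a ->
  (\esum_(k in [set: nat]) (f k)%:E = a%:E)%E.
Proof.
move=> f0 fa; rewrite -nneseries_esumT; last by move=> n; rewrite lee_fin.
apply/cvg_lim => //; rewrite (_ : (fun n => _) = EFin \o series f).
  by apply: cvg_EFin; [exact: nearW|exact: fa].
by apply/funext => n /=; rewrite sumEFin.
Qed.

(** Pascal's rule for generating functions: multiplication by [1 - z] lowers [m] by one, up to a
    boundary term. *)
Lemma pascal_partial (R : comRingType) (z : R) m N :
  (1 - z) * (\sum_(0 <= k < N.+1) 'C(k + m.+1, k)%:R * z ^+ k) =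
  \sum_(0 <= k < N.+1) 'C(k + m, k)%:R * z ^+ k - 'C(N + m.+1, N)%:R * z ^+ N.+1.
Proof.
elim: N => [|N IH]; first by rewrite !big_nat1 !bin0 expr0 expr1; ring.
rewrite big_nat_recr//= mulrDr IH [in RHS]big_nat_recr//= addSn binS addSnnS.
by rewrite natrD [z ^+ N.+2]exprSr; ring.
Qed.

Lemma negbin_series (R : realType) (z : R) m :
  `|z| < 1 -> hasSum (fun k => 'C(k + m, k)%:R * z ^+ k) ((1 - z)^-1 ^+ m.+1).
Proof.
move=> z1; have nz1 : `|(`|z|)| < 1 by rewrite normr_id.
(* Convergence at the absolute value comes first: there the boundary term is nonnegative and may be
   dropped, so the partial sums stay bounded. *)
have cvn : forall m, cvgn (series (fun k => 'C(k + m, k)%:R * `|z| ^+ k)).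
  elim=> [|{}m IH].
    rewrite (_ : series _ = series (geometric 1 `|z|)).
      exact: is_cvg_geometric_series.
    congr series; apply/funext => k; rewrite addn0 binn /geometric/=; ring.
  apply: (@nonneg_cvg_series _ _ (limn (series (fun k => 'C(k + m, k)%:R * `|z| ^+ k)) / (1 - `|z|))).
    by move=> k; rewrite mulr_ge0 ?exprn_ge0.
  move=> n; rewrite ler_pdivlMr ?subr_gt0// mulrC.
  have le N : series (fun k => 'C(k + m, k)%:R * `|z| ^+ k) N <=
      limn (series (fun k => 'C(k + m, k)%:R * `|z| ^+ k)).
    by apply: hasSum_ge_part => // k; rewrite mulr_ge0 ?exprn_ge0.
  case: n => [|n]; first by rewrite /series /= big_geq// mulr0; apply: le_trans (le 0%N);
    rewrite /series/= big_geq.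
  rewrite /series /= pascal_partial; apply: le_trans (le n.+1).
  by rewrite lerBlDr /series/= lerDl mulr_ge0 ?exprn_ge0.
have cv n : cvgn (series (fun k => 'C(k + n, k)%:R * z ^+ k)).
  apply: dominated_cvg_series (cvn n) => k.
  by rewrite normrM normrX ger0_norm.
have z1n : 1 - z != 0 by rewrite subr_eq0 eq_sym; apply: contraTneq z1 => ->; rewrite normr1 ltxx.
elim: m => [|m IH].
  have := @cvg_geometric_series R 1 z z1; rewrite div1r expr1.
  move=> h; apply: (@eq_hasSum _ (geometric 1 z)) h => k.
  by rewrite addn0 binn /geometric/=; ring.
pose f k := 'C(k + m.+1, k)%:R * z ^+ k.
have c := cvg_hasSum (cv m.+1); rewrite -/f in c.
have f0 : f @ \oo --> (0 : R) := cvg_series_cvg_0 (cv m.+1).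
have l1 : (fun N => (1 - z) * series f N.+1) @ \oo --> (1 - z) * limn (series f).
  by apply: cvgMr; rewrite (cvg_shiftS (series f)).
(* The boundary term is [z * f N], and [f N] tends to 0 as the term of a convergent series. *)
have l2 : (fun N => (1 - z) * series f N.+1) @ \oo --> (1 - z)^-1 ^+ m.+1.
  rewrite (_ : (fun N => _) = (fun N =>
     series (fun k => 'C(k + m, k)%:R * z ^+ k) N.+1 - z * f N)).
    rewrite -[X in _ --> X]subr0 -(mulr0 z); apply: cvgB.
      by rewrite (cvg_shiftS (series _)).
    exact: cvgMr.
  apply/funext => N; rewrite /series /= pascal_partial /f exprSr.
  by congr (_ - _); ring.
have e := cvg_unique (@Rhausdorff R) l1 l2.
rewrite (_ : _ ^+ m.+2 = limn (series f))//.
by rewrite exprS -e mulKf.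
Qed.

Arguments negbin_series {R z} m _.

Section negbin.
Variables (R : realType) (p : R).
Hypotheses (p0 : 0 < p) (p1 : p < 1).

Let d0 : 0 < 1 - p. Proof. by rewrite subr_gt0. Qed.

Lemma nb_gt0 m k : (0 < m)%N -> 0 < nb p m k.
Proof.
case: m => // m _; rewrite /nb addnS/=.
by rewrite !mulr_gt0 ?exprn_gt0// ltr0n bin_gt0 leq_addr.
Qed.

Lemma nb_pgf m s : (0 < m)%N -> `|s| <= 1 ->
  hasSum (fun k => nb p m k * s ^+ k) (((1 - p) / (1 - p * s)) ^+ m).
Proof.
case: m => // m _ s1.
have ps1 : `|p * s| < 1.
  rewrite normrM (gtr0_norm p0); apply: le_lt_trans p1.
  by rewrite -[leRHS]mulr1 ler_pM2l.
have := hasSumZ ((1 - p) ^+ m.+1) (negbin_series m ps1).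
rewrite -exprMn; apply: eq_hasSum => k; rewrite /nb addnS /= exprMn; ring.
Qed.

Lemma nb_sum m : (0 < m)%N -> hasSum (nb p m) 1.
Proof.
move=> m0; have := nb_pgf m0 (_ : `|1| <= 1); rewrite normr1 lexx => /(_ isT).
rewrite mulr1 divff ?gt_eqF// expr1n.
by apply: eq_hasSum => k; rewrite expr1n mulr1.
Qed.

Lemma nb_le1 m k : (0 < m)%N -> nb p m k <= 1.
Proof.
move=> m0; apply: le_trans (hasSum_ge_part k.+1 _ (nb_sum m0)).
  by rewrite /series /= big_nat_recr//= lerDr sumr_ge0// => i _; rewrite ltW ?nb_gt0.
by move=> i; rewrite ltW ?nb_gt0.
Qed.

(** Weighting by [k + m] is a change of parameter, so that moments of [nb p m] reduce to total
    masses at larger [m]. *)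
Lemma nb_succ m k : (0 < m)%N -> (k + m)%:R * nb p m k = m%:R / (1 - p) * nb p m.+1 k.
Proof.
move=> m0; rewrite /nb addnS /= !mulrA -natrM mul_bin_down addKn.
rewrite natrM exprS; by field; rewrite gt_eqF.
Qed.

Lemma nb_mean m : (0 < m)%N ->
  hasSum (fun k => k%:R * nb p m k) (p / (1 - p) * m%:R).
Proof.
move=> m0.
have := hasSumB (hasSumZ (m%:R / (1 - p)) (nb_sum (ltn0Sn m))) (hasSumZ m%:R (nb_sum m0)).
rewrite (_ : m%:R / (1 - p) * 1 - _ = p / (1 - p) * m%:R); last by field; rewrite gt_eqF.
by apply: eq_hasSum => k; rewrite -nb_succ// natrD; ring.
Qed.

Lemma nb_moment2 m : (0 < m)%N -> cvgn (series (fun k => k.+1%:R ^+ 2 * nb p m k)).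
Proof.
move=> m0; apply: (@dominated_cvg_series _ _
  (fun k => (m%:R / (1 - p) * (m.+1%:R / (1 - p))) * nb p m.+2 k)).
  move=> k; rewrite ger0_norm; last by rewrite mulr_ge0 ?sqr_ge0 ?ltW ?nb_gt0.
  rewrite -mulrA -nb_succ// [leRHS]mulrCA -nb_succ// [leRHS]mulrA.
  rewrite ler_pM2r ?nb_gt0// -natrM -natrX ler_nat expnS expn1 leq_mul//; lia.
apply: is_cvg_seriesZ; apply/cvg_ex; exists 1; exact: nb_sum.
Qed.

Lemma nb_moment1 m : (0 < m)%N -> cvgn (series (fun k => k.+1%:R * nb p m k)).
Proof.
move=> m0; apply: dominated_cvg_series (nb_moment2 m0) => k.
rewrite ger0_norm; last by rewrite mulr_ge0 ?ltW ?nb_gt0.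
by rewrite ler_pM2r ?nb_gt0// expr2 ler_peMr// ler1n.
Qed.

(** The generating function at 1/2 is a power of some [rho < 1], and it bounds the mass of the first
    [N] points times [2^-1 ^+ N]. *)
Lemma nb_head_small N (e : R) : 0 < e ->
  exists2 m, (0 < m)%N & series (nb p m) N <= e.
Proof.
move=> e0; pose rho := (1 - p) / (1 - p * 2^-1).
have q0 : 0 < 1 - p * 2^-1 by have := p1; have := p0; lra.
have rho0 : 0 < rho by rewrite divr_gt0.
have rho1 : `|rho| < 1.
  by rewrite gtr0_norm// ltr_pdivrMr// mul1r; have := p0; lra.
have : (fun m => rho ^+ m.+1) @ \oo --> (0 : R).
  by rewrite (cvg_shiftS (fun m => rho ^+ m)); exact: cvg_expr.
move=> /cvgr0Pnorm_lt /(_ (e * 2^-1 ^+ N)) []; first by rewrite mulr_gt0// exprn_gt0.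
move=> m _ /(_ m (leqnn m)) /=; rewrite gtr0_norm ?exprn_gt0// => h.
exists m.+1 => //; rewrite -(@ler_pM2r _ (2^-1 ^+ N)) ?exprn_gt0//.
apply: le_trans (ltW h).
have hs : `|2^-1 : R| <= 1 by rewrite ger0_norm// invf_le1// ler1n.
apply: le_trans (hasSum_ge_part N _ (nb_pgf (ltn0Sn m) hs)); last first.
  by move=> k; rewrite mulr_ge0 ?exprn_ge0// ltW ?nb_gt0.
rewrite /series /= mulr_suml; apply: ler_sum_nat => k /andP[_ kN].
rewrite ler_pM2l ?nb_gt0//; apply: ler_wiXn2l => //; last exact: ltnW.
by rewrite invf_le1// ler1n.
Qed.

Lemma mass_nb m : (0 < m)%N -> mass (nb p m) = 1%E.
Proof.
by move=> m0; apply: esum_hasSum (nb_sum m0) => k; rewrite ltW ?nb_gt0.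
Qed.

End negbin.

(** * Power series of radius of convergence at least 1 *)

(** Equivalent to a radius of convergence at least 1; in this form, stability under [pseries_diffs]
    is elementary. *)
Definition subexp {R : realType} (c : nat -> R) :=
  forall r : R, 0 < r < 1 -> exists C, forall k, `|c k| * r ^+ k <= C.

(** Each of the [k + 1] terms [x ^+ i] with [i <= k] is at least [x ^+ k]; compare with the
    geometric series. *)
Lemma natr_expr_bounded (R : realType) (x : R) k : 0 < x < 1 ->
  k.+1%:R * x ^+ k <= (1 - x)^-1.
Proof.
move=> /andP[x0 x1].
have nx : `|x| < 1 by rewrite gtr0_norm.
have h := @cvg_geometric_series R 1 x nx; rewrite div1r in h.
apply: le_trans (hasSum_ge_part k.+1 _ h); last first.
  by move=> i; rewrite /geometric/= mul1r exprn_ge0 ?ltW.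
rewrite /series /= -[k.+1%:R]mulr_natl mulr1.
rewrite -[X in X <= _](_ : \sum_(0 <= i < k.+1) x ^+ k = _); last first.
  by rewrite big_const_nat iter_addr_0 subn0 mulr_natl.
apply: ler_sum_nat => i /andP[_ ik].
by rewrite /geometric/= mul1r ler_wiXn2l ?ltW.
Qed.

Lemma subexp_natr (R : realType) (c : nat -> R) : subexp c -> subexp (fun k => k.+1%:R * c k).
Proof.
(* With [s] the square root, [r ^+ k = s ^+ k * s ^+ k]: one factor absorbs [k.+1], the other
   [c k]. *)
move=> sc r /andP[r0 r1]; pose s := Num.sqrt r.
have s0 : 0 < s by rewrite sqrtr_gt0.
have s1 : s < 1 by rewrite -sqrtr1 ltr_sqrt.
have [C hC] := sc s (introT andP (conj s0 s1)).
exists ((1 - s)^-1 * C) => k.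
rewrite -(sqr_sqrtr (ltW r0)) -/s normrM normr_nat -exprM mul2n -addnn exprD.
rewrite mulrACA; apply: ler_pM => //.
- by rewrite mulr_ge0 ?exprn_ge0// ltW.
- by rewrite mulr_ge0 ?exprn_ge0// ltW.
- by apply: natr_expr_bounded; rewrite s0.
Qed.

Lemma subexp_shift (R : realType) (c : nat -> R) : subexp c -> subexp (fun k => c k.+1).
Proof.
move=> sc r /andP[r0 r1]; have [C hC] := sc r (introT andP (conj r0 r1)).
by exists (C / r) => k; rewrite ler_pdivlMr// -mulrA -exprSr.
Qed.

Lemma subexp_diffs (R : realType) (c : nat -> R) : subexp c -> subexp (pseries_diffs c).
Proof. by move=> /subexp_shift /subexp_natr. Qed.

Lemma subexp_cvg (R : realType) (c : nat -> R) (x : R) : subexp c -> `|x| < 1 ->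
  cvgn (pseries c x).
Proof.
move=> sc x1; pose r := (`|x| + 1) / 2.
have r0 : 0 < r by rewrite divr_gt0// ltr_wpDl.
have r1 : r < 1 by rewrite /r ltr_pdivrMr//; lra.
have xr : `|x| / r < 1 by rewrite ltr_pdivrMr// mul1r /r ltr_pdivlMr//; lra.
have [C hC] := sc r (introT andP (conj r0 r1)).
apply: (@dominated_cvg_series _ _ (geometric C (`|x| / r))).
  move=> k; rewrite /geometric /= normrM normrX expr_div_n mulrA ler_pdivlMr ?exprn_gt0//.
  by rewrite mulrAC ler_wpM2r ?exprn_ge0.
by apply: is_cvg_geometric_series; rewrite ger0_norm ?divr_ge0// ltW.
Qed.

Lemma subexp_continuous (R : realType) (c : nat -> R) (x : R) : subexp c -> `|x| < 1 ->
  {for x, continuous (fun x => limn (pseries c x))}.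
Proof.
move=> sc x1; pose K := (`|x| + 1) / 2.
have K1 : `|K| < 1 by rewrite ger0_norm /K ?divr_ge0 ?addr_ge0// ltr_pdivrMr//; lra.
have xK : `|x| < `|K| by rewrite [ltRHS]ger0_norm /K ?divr_ge0 ?addr_ge0// ltr_pdivlMr//; lra.
have := pseries_snd_diffs (subexp_cvg sc K1) (subexp_cvg (subexp_diffs sc) K1)
  (subexp_cvg (subexp_diffs (subexp_diffs sc)) K1) xK.
by move=> [/derivable1_diffP/differentiable_continuous].
Qed.

(** * Exponential tilting of a reference weight *)

Section tilt.
Variables (R : realType) (p : R) (W S : nat -> R) (E0 : R).
Hypotheses (p0 : 0 < p) (p1 : p < 1) (W0 : forall k, 0 < W k) (sW : subexp W)
  (SW : forall m, (0 < m)%N -> hasSum (fun k => nb p m k * (ln (W k) - ln (nb p m k))) (S m))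
  (SE : forall m, (0 < m)%N -> E0 <= S m).

Local Notation lam := (p / (1 - p)).

(** The normalising constant [Z] of the overview; [dpgf] is [q] times its derivative, so that
    [dpgf q / pgf q] is the mean of the tilted law. *)
Definition pgf (q : R) := limn (pseries W q).
Definition dpgf (q : R) := limn (pseries (fun k => k%:R * W k) q).

Lemma subexp_dpgf : subexp (fun k => k%:R * W k).
Proof.
move=> r r01; have [C hC] := subexp_natr sW r01; exists C => k.
apply: le_trans (hC k); rewrite ler_wpM2r ?exprn_ge0//; first by case/andP: r01 => /ltW.
by rewrite !normrM !normr_nat ler_wpM2r// ler_nat.
Qed.

Let abs (q : R) : 0 < q < 1 -> `|q| < 1.
Proof. by move=> /andP[q0 q1]; rewrite gtr0_norm. Qed.

Lemma pgf_sum q : 0 < q < 1 -> hasSum (fun k => W k * q ^+ k) (pgf q).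
Proof. by move=> /abs /(subexp_cvg sW). Qed.

Lemma dpgf_sum q : 0 < q < 1 -> hasSum (fun k => k%:R * (W k * q ^+ k)) (dpgf q).
Proof.
move=> /abs /(subexp_cvg subexp_dpgf) h; have := cvg_hasSum h.
by apply: eq_hasSum => k; rewrite mulrA.
Qed.

Let Wq0 q k : 0 < q < 1 -> 0 < W k * q ^+ k.
Proof. by move=> /andP[q0 q1]; rewrite mulr_gt0 ?exprn_gt0. Qed.

Lemma pgf_ge_part q n : 0 < q < 1 -> \sum_(0 <= k < n) W k * q ^+ k <= pgf q.
Proof.
move=> q01; apply: (hasSum_ge_part n _ (pgf_sum q01)) => k.
exact/ltW/Wq0.
Qed.

Lemma pgf_gt0 q : 0 < q < 1 -> 0 < pgf q.
Proof.
move=> q01; apply: lt_le_trans (pgf_ge_part 1 q01).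
by rewrite big_nat1 Wq0.
Qed.

Lemma pgf_le q q' : 0 < q < 1 -> 0 < q' < 1 -> q <= q' -> pgf q <= pgf q'.
Proof.
move=> q01 q'01 qq; apply: hasSum_le (pgf_sum q01) (pgf_sum q'01) _ => k.
rewrite ler_pM2l//; apply: lerXn2r => //; rewrite nnegrE ltW//.
- by case/andP: q01.
- by case/andP: q'01.
Qed.

Definition tilted (q : R) (k : nat) := W k * q ^+ k / pgf q.

Lemma tilted_gt0 q k : 0 < q < 1 -> 0 < tilted q k.
Proof. by move=> q01; rewrite divr_gt0 ?Wq0 ?pgf_gt0. Qed.

Lemma tilted_sum q : 0 < q < 1 -> hasSum (tilted q) 1.
Proof.
move=> q01; have := hasSumZ (pgf q)^-1 (pgf_sum q01).
rewrite mulVf ?gt_eqF ?pgf_gt0//; apply: eq_hasSum => k; exact: mulrC.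
Qed.

Lemma KL_tilted q m : 0 < q < 1 -> (0 < m)%N ->
  KL (nb p m) (tilted q) = (- S m + ln (pgf q) - lam * m%:R * ln q)%:E.
Proof.
move=> q01 m0; apply: esum_hasSum.
  by move=> k; rewrite kl_ge0 ?tilted_gt0// ltW ?nb_gt0.
have h := hasSumD (hasSumB (hasSumB (hasSumZ (ln (pgf q) - 1) (nb_sum p0 p1 m0)) (SW m0))
  (hasSumZ (ln q) (nb_mean p0 p1 m0))) (tilted_sum q01).
rewrite (_ : _ - _ = (ln (pgf q) - 1) * 1 - S m - ln q * (lam * m%:R) + 1); last by ring.
apply: eq_hasSum h => k; have qp : 0 < q by case/andP: q01.
have -> : kl (nb p m k) (tilted q k) = nb p m k * (ln (nb p m k) -
    (ln (W k) + k%:R * ln q - ln (pgf q))) - nb p m k + tilted q k.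
  rewrite klE ?nb_gt0 ?tilted_gt0//; congr (_ * (_ - _) - _ + _).
  rewrite /tilted ln_div ?posrE ?Wq0 ?pgf_gt0// lnM ?posrE ?exprn_gt0// lnXn//.
  by rewrite mulr_natl.
ring.
Qed.

(* A finite supremum of [pgf] would bound all the divergences from one fixed law, although
   the [nb p m] escape to infinity. *)
Lemma pgf_unbounded B : exists2 q, 0 < q < 1 & B < pgf q.
Proof.
apply: contrapT => /forall2NP h.
have ZB q : 0 < q < 1 -> pgf q <= B.
  by move=> q01; have [//|/negP] := h q; rewrite -leNgt.
have B0 : 0 < B.
  have h01 : 0 < (2^-1 : R) < 1 by lra.
  exact: lt_le_trans (pgf_gt0 h01) (ZB _ h01).
(* The bound passes to [q = 1]: a partial sum exceeding [B] would already push [pgf] above [B] at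
   some [q = 1 - e]. *)
have WB n : \sum_(0 <= k < n) W k <= B.
  rewrite leNgt; apply/negP => BW.
  set s := \sum_(0 <= k < n) W k in BW.
  have s0 : 0 < s by exact: lt_trans BW.
  have [n0|n0] := posnP n; first by move: s0; rewrite /s n0 big_geq ?ltxx.
  have nn0 : (0 : R) < n%:R by rewrite ltr0n.
  (* [n * e] is half of [1 - B / s], hence [s * (1 - n * e) > B]; Bernoulli's inequality bounds
     [(1 - e) ^+ k] from below. *)
  pose e := (s - B) / (2 * s * n%:R).
  have e0 : 0 < e by rewrite divr_gt0 ?mulr_gt0 ?subr_gt0.
  have ne : n%:R * e < 1 - B / s.
    have -> : n%:R * e = (1 - B / s) / 2 by rewrite /e; field; rewrite !gt_eqF.
    have : 0 < 1 - B / s by rewrite subr_gt0 ltr_pdivrMr// mul1r.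
    by lra.
  have e1 : e < 1.
    have : e <= n%:R * e by rewrite ler_peMl ?ler1n// ltW.
    have : 0 < B / s by rewrite divr_gt0.
    by lra.
  have q01 : 0 < 1 - e < 1 by lra.
  have bern k : 1 - k%:R * e <= (1 - e) ^+ k.
    elim: k => [|k IH]; first by rewrite mul0r subr0.
    rewrite exprS; have h1 : 0 <= 1 - e by lra.
    apply: le_trans (ler_wpM2l h1 IH).
    have h2 : 0 <= k%:R * e * e by apply: mulr_ge0; [apply: mulr_ge0; [exact: ler0n|]|]; exact: ltW.
    by rewrite -[k.+1%:R]natr1; lra.
  have := le_trans (pgf_ge_part n q01) (ZB _ q01); apply/negP; rewrite -ltNge.
  apply: (@lt_le_trans _ _ (s * (1 - n%:R * e))).
    by rewrite mulrC -ltr_pdivrMr//; lra.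
  rewrite /s mulr_suml; apply: ler_sum_nat => k /andP[_ kn].
  rewrite ler_pM2l//; apply: le_trans (bern k).
  by rewrite lerD2l lerN2 ler_pM2r// ler_nat ltnW.
have cW : cvgn (series W) by apply: (nonneg_cvg_series (fun k => ltW (W0 k)) WB).
(* [T] makes [B + 1 - T / 2 < E0]; [ka] satisfies [ln ka - 1 = - T], the coefficient of the tail
   mass below. *)
pose T := 2 * (`|B + 1 - E0| + 1).
have T0 : 0 < T by rewrite mulr_gt0// ltr_wpDl.
pose ka := expR (1 - T).
have [N tailN] : exists N, forall n, (N <= n)%N -> \sum_(N <= k < n) W k <= ka.
  have ka0 : 0 < ka by rewrite expR_gt0.
  have /cvgrPdist_lt /(_ ka ka0) [N _ hN] := cvg_hasSum cW.
  exists N => n Nn; have := hN N (leqnn N) => /= h1.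
  have h2 := hasSum_ge_part n (fun k => ltW (W0 k)) (cvg_hasSum cW).
  have h3 : series W n = series W N + \sum_(N <= k < n) W k.
    by rewrite /series /= (big_cat_nat (leq0n N) Nn).
  by have := ltr_normlW h1; rewrite h3 in h2; lra.
have half0 : 0 < (2^-1 : R) by rewrite invr_gt0.
have [m m0 headN] := nb_head_small p0 p1 N half0.
(* From [ln z <= z - 1] at [z = w / (t * u)]. It is used with [t = 1] before [N], and with [t = ka]
   from [N] on, where [W / ka] has mass at most 1. *)
have logle (u w t : R) : 0 < u -> 0 < w -> 0 < t -> u * (ln w - ln u) <= w / t + u * (ln t - 1).
  move=> u0 w0 t0.
  have := ln_le_subr1 (_ : 0 < w / (t * u)); rewrite divr_gt0 ?mulr_gt0// => /(_ isT).
  rewrite ln_div ?posrE ?mulr_gt0// lnM// => /(ler_wpM2l (ltW u0)).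
  rewrite (_ : u * (w / (t * u) - 1) = w / t - u); last by field; rewrite !gt_eqF.
  by lra.
have lnka : ln ka = 1 - T by rewrite /ka expRK.
suff Sm : S m <= B + 1 - T / 2.
  have := le_trans (SE m0) Sm; rewrite /T; have := ler_norm (B + 1 - E0); lra.
have hs : hasSum (nb p m) 1 := nb_sum p0 p1 m0.
have lim1 : (fun n => B + 1 - T * (series (nb p m) n - series (nb p m) N)) @ \oo -->
   B + 1 - T * (1 - series (nb p m) N).
  apply: cvgB; first exact: cvg_cst.
  apply: cvgMr; apply: cvgB; [exact: hs|exact: cvg_cst].
apply: le_trans (ler_cvg_to (SW m0) lim1 _) _; last first.
  by rewrite lerD2l lerN2 ler_pM2l//; lra.
exists N => // n /= Nn.
rewrite /series /= (big_cat_nat (leq0n N) Nn)//= [in leRHS](big_cat_nat (leq0n N) Nn)//=.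
rewrite (_ : B + 1 - _ = B + (1 - T * \sum_(N <= k < n) nb p m k)); last by ring.
apply: lerD.
  apply: le_trans (WB N); apply: ler_sum_nat => k _.
  apply: le_trans (logle (nb p m k) (W k) 1 (nb_gt0 p0 p1 k m0) (W0 k) ltr01) _.
  rewrite ln1 divr1 sub0r mulrN1 gerDl oppr_le0 ltW ?nb_gt0//.
apply: (@le_trans _ _ (\sum_(N <= k < n) (W k / ka - T * nb p m k))).
  apply: ler_sum_nat => k _;
    apply: le_trans (logle (nb p m k) (W k) ka (nb_gt0 p0 p1 k m0) (W0 k) (expR_gt0 _)) _.
  rewrite lnka.
  by rewrite lerD2l; lra.
rewrite sumrB -mulr_suml -mulr_sumr lerD2r ler_pdivrMr ?expR_gt0// mul1r.
exact: tailN.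
Qed.

Definition tmean (q : R) := dpgf q / pgf q.

(** [ln (pgf q)] is convex in [ln q] with slope [tmean q]; this is its tangent at [q], obtained
    termwise from [1 + x <= expR x] centred at the mean. *)
Lemma ln_pgf_le q0 q : 0 < q0 -> q0 < q -> q < 1 ->
  ln (pgf q) <= ln (pgf q0) + tmean q * (ln q - ln q0).
Proof.
move=> q00 qq q1.
have q01 : 0 < q < 1 by rewrite q1 (lt_trans q00).
have q001 : 0 < q0 < 1 by rewrite q00 (lt_trans qq).
have qp : 0 < q by case/andP: q01.
set th := ln q - ln q0; set mu := tmean q.
suff h : expR (- (th * mu)) * pgf q <= pgf q0.
  have := ler_wpDl; have : ln (expR (- (th * mu)) * pgf q) <= ln (pgf q0).
    by rewrite ler_ln ?posrE ?mulr_gt0 ?expR_gt0 ?pgf_gt0.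
  rewrite lnM ?posrE ?expR_gt0 ?pgf_gt0// expRK; lra.
have hs := hasSumZ (expR (- (th * mu))) (hasSumB (hasSumZ (1 + th * mu) (pgf_sum q01))
  (hasSumZ th (dpgf_sum q01))).
apply: le_trans (hasSum_le hs (pgf_sum q001) _).
  rewrite ler_pM2l ?expR_gt0// le_eqVlt; apply/orP; left; apply/eqP.
  by rewrite /mu /tmean; field; rewrite gt_eqF ?pgf_gt0.
move=> k.
have -> : W k * q0 ^+ k = W k * q ^+ k * expR (- (th * k%:R)).
  rewrite -mulrA; congr (_ * _).
  rewrite -[q0 in LHS]lnK ?posrE// -[q in RHS]lnK ?posrE// -!expRM_natl -expRD.
  by congr expR; rewrite /th; ring.
rewrite (_ : (1 + th * mu) * _ - _ = W k * q ^+ k * (1 + (th * mu - th * k%:R))); last by ring.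
rewrite mulrCA ler_pM2l ?Wq0//.
rewrite (_ : expR (- (th * k%:R)) = expR (- (th * mu) + (th * mu - th * k%:R)));
  last by congr expR; ring.
by rewrite expRD ler_pM2l ?expR_gt0// expR_ge1Dx.
Qed.

Let pgf_cont q : 0 < q < 1 -> {for q, continuous pgf}.
Proof. by move=> /abs; exact: subexp_continuous. Qed.

Let dpgf_cont q : 0 < q < 1 -> {for q, continuous dpgf}.
Proof. by move=> /abs; apply: subexp_continuous; exact: subexp_dpgf. Qed.

(** [A - B] as a function of [q], nondecreasing and continuous on []0, 1[]. *)
Let g q := - E0 + ln (pgf q) + ln q.

Let g_le q q' : 0 < q < 1 -> 0 < q' < 1 -> q <= q' -> g q <= g q'.
Proof.
move=> q01 q01' qq; apply: lerD.
  by rewrite lerD2l ler_ln ?posrE ?pgf_gt0// pgf_le.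
by rewrite ler_ln ?posrE//; [case/andP: q01|case/andP: q01'].
Qed.

Let itv01 (a b c : R) : 0 < a -> b < 1 -> c \in `[a, b] -> 0 < c < 1.
Proof. by rewrite in_itv/= => a0 b1 /andP[ac cb]; rewrite (lt_le_trans a0)// (le_lt_trans cb). Qed.

Let g_root : exists2 q, 0 < q < 1 & g q = 0.
Proof.
have h01 : 0 < (2^-1 : R) < 1 by lra.
have [qb1 qb101 hb1] := pgf_unbounded (2 * expR E0).
(* [qb >= 1/2] and [pgf qb >= 2 * expR E0] make the two logarithms add up to at least [E0]. *)
pose qb := Num.max 2^-1 qb1.
have qb01 : 0 < qb < 1.
  by rewrite /qb lt_max gt_max; case/andP: h01 => -> ->; case/andP: qb101 => _ ->.
have gb : 0 <= g qb.
  have h1 : 2 * expR E0 <= pgf qb by rewrite (le_trans (ltW hb1))// pgf_le// /qb le_max lexx orbT.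
  have h2 : ln 2 + E0 <= ln (pgf qb).
    rewrite -{1}[E0]expRK -lnM ?posrE ?expR_gt0//.
    by rewrite ler_ln ?posrE ?mulr_gt0 ?expR_gt0 ?pgf_gt0.
  have h3 : - ln 2 <= ln qb.
    rewrite -lnV ?posrE// ler_ln ?posrE ?invr_gt0//; last by case/andP: qb01.
    by rewrite /qb le_max lexx.
  by rewrite /g; lra.
pose qa := Num.min 2^-1 (expR (E0 - ln (pgf 2^-1))).
have qa01 : 0 < qa < 1.
  by rewrite /qa lt_min gt_min expR_gt0; case/andP: h01 => -> ->.
have ga : g qa <= 0.
  have h1 : ln (pgf qa) <= ln (pgf 2^-1).
    by rewrite ler_ln ?posrE ?pgf_gt0// pgf_le// /qa ge_min lexx.
  have h2 : ln qa <= E0 - ln (pgf 2^-1).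
    rewrite -[leRHS]expRK ler_ln ?posrE ?expR_gt0//; last by case/andP: qa01.
    by rewrite /qa ge_min lexx orbT.
  by rewrite /g; lra.
have ab : qa <= qb by rewrite (@le_trans _ _ 2^-1)// ?/qa ?/qb ?ge_min ?le_max lexx.
have [a0 a1] := andP qa01; have [b0 b1] := andP qb01.
have gc : {within `[qa, qb], continuous g}.
  apply: continuous_in_subspaceT => x /set_mem /= xab.
  have x01 := itv01 a0 b1 xab.
  apply: cvgD; last by apply: continuous_ln; case/andP: x01.
  apply: cvgD; first exact: cvg_cst.
  apply: (@continuous_comp _ _ _ pgf (@ln R)); first exact: pgf_cont.
  by apply: continuous_ln; exact: pgf_gt0.
have [|q qab gq] := @IVT R g qa qb 0 ab gc.
  by rewrite ge_min le_max ga gb orbT.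
by exists q => //; exact: itv01 qab.
Qed.

Let lam0 : 0 < lam. Proof. by rewrite divr_gt0 ?subr_gt0. Qed.

Lemma tilt_choice : exists2 q, 0 < q < 1 &
  [/\ - ln q <= - E0 + ln (pgf q), lam <= tmean q &
      (- E0 + ln (pgf q) = - ln q) \/ tmean q = lam].
Proof.
have [qs qs01 gs] := g_root; have [s0 s1] := andP qs01.
have [le|lt] := leP lam (tmean qs).
  exists qs => //; rewrite /g in gs; split => //; first by lra.
  by left; lra.
(* Otherwise the slope of [ln (pgf q)] in [ln q] stays below [lam] beyond [qs], which bounds [pgf]
   and contradicts [pgf_unbounded]. *)
have [qt [st t1 ht]] : exists q, [/\ qs < q, q < 1 & lam <= tmean q].
  apply: contrapT => h.
  have [q1 q101 hq1] := pgf_unbounded (expR (ln (pgf qs) - lam * ln qs)).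
  have [q10 q11] := andP q101.
  have ls : lam * - ln qs >= 0 by rewrite mulr_ge0 ?(ltW lam0)// oppr_ge0 ln_le0// ltW.
  have sq : qs < q1.
    rewrite ltNge; apply/negP => q1s.
    have := lt_le_trans hq1 (pgf_le q101 qs01 q1s).
    rewrite -{2}[pgf qs]lnK ?posrE ?pgf_gt0// ltr_expR; lra.
  have mq : tmean q1 < lam.
    by rewrite ltNge; apply/negP => mq; apply: h; exists q1.
  have := ln_pgf_le s0 sq q11.
  have : ln q1 - ln qs >= 0 by rewrite subr_ge0 ler_ln ?posrE// ltW.
  have lq1 : ln q1 <= 0 by rewrite ln_le0// ltW.
  move=> h1; move=> /le_trans /(_ (lerD (lexx _) (ler_wpM2r h1 (ltW mq)))) h2.
  have : lam * ln q1 <= 0 by rewrite mulr_ge0_le0// ltW.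
  move: hq1; rewrite -[pgf q1]lnK ?posrE ?pgf_gt0// ltr_expR; lra.
have qt01 : 0 < qt < 1 by rewrite t1 (lt_trans s0).
have mc : {within `[qs, qt], continuous tmean}.
  apply: continuous_in_subspaceT => x /set_mem /= xab.
  have x01 := itv01 s0 t1 xab.
  apply: cvgM; first exact: dpgf_cont.
  apply: cvgV; first by rewrite gt_eqF ?pgf_gt0.
  exact: pgf_cont.
have [|q qab mq] := @IVT R tmean qs qt lam (ltW st) mc.
  by rewrite ge_min le_max (ltW lt) ht orbT.
have q01 := itv01 s0 t1 qab.
exists q => //; split; [|by rewrite mq|by right].
have := g_le qs01 q01; rewrite gs /g => /(_ _).
move: qab; rewrite in_itv/= => /andP[-> _] /(_ isT); lra.
Qed.

Lemma tilt_capacity : exists2 q, 0 < q < 1 & lam <= tmean q /\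
  (repeat_capacity (fun j => (1 - p) * p ^+ j)%R <=
   (p * (- E0 + ln (pgf q) - tmean q * ln q) / ((1 - p) * (1 + tmean q)))%:E)%E.
Proof.
have [q q01 [AB lm eqs]] := tilt_choice; exists q => //; split => //.
have d0 : 0 < 1 - p by rewrite subr_gt0.
have [q0 q1] := andP q01.
apply: (le_trans (repeat_capacity_le (A := - E0 + ln (pgf q)) (B := - ln q) (Q1 := tilted q) _ _ _
  _ _ _)).
- by rewrite p0.
- by move=> k; exact: tilted_gt0.
- apply: esum_hasSum (tilted_sum q01) => k; exact/ltW/tilted_gt0.
- by rewrite AB oppr_ge0 ln_le0 ?ltW.
- by move=> m m0; exact: mass_nb.
- move=> m m0; rewrite KL_tilted// lee_fin.
  have := SE m0; lra.
have t0 : 0 < 1 + tmean q by have := lam0; lra.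
rewrite lee_fin le_eqVlt; apply/orP; left; apply/eqP.
(* If [A = B], the factor [1 + tmean q] cancels; if the mean is [lam], then
   [(1 - p) * (1 + lam) = 1]. *)
case: eqs => [e|e].
  by rewrite e; field; rewrite !gt_eqF.
rewrite e; field; rewrite !gt_eqF//.
by rewrite (_ : _ + _ = 1)//; ring.
Qed.
End tilt.

(** * The Gamma function at positive arguments *)

Section gamma_function.
Context {R : realType}.
Local Notation mu := (@lebesgue_measure R).
Implicit Types (a x t : R).

Definition gamma_kernel a t := t `^ (a - 1) * expR (- t).

(** Kept in [\bar R], so that the functional equation can be proved before the integral is known to
    be finite. *)
Definition gammaE a := (\int[mu]_(t in `]0%R, +oo[) (gamma_kernel a t)%:E)%E.

Lemma GammaE a : Gamma a = fine (gammaE a).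
Proof. by []. Qed.

(** Compact intervals exhausting the half-line and avoiding the singularity at 0, for integration by
    parts; the first is [[1, 2]]. *)
Definition gitv n : set R := `[n.+1%:R^-1, n.+2%:R]%classic.

Lemma gitv_gt0 n t : gitv n t -> 0 < t.
Proof. by rewrite /gitv/= in_itv/= => /andP[h _]; rewrite (lt_le_trans _ h). Qed.

Lemma gitv_lt n : n.+1%:R^-1 < n.+2%:R :> R.
Proof. by rewrite (@le_lt_trans _ _ 1)// ?ltr1n// invf_le1// ler1n. Qed.

Lemma bigcup_gitv : \bigcup_n gitv n = `]0%R, +oo[%classic.
Proof.
apply/seteqP; split => [t [n _ /gitv_gt0 t0]|t]; first by rewrite /= in_itv/= t0.
rewrite /= in_itv/= andbT => t0.
have [n1 h1] : exists n1 : nat, t^-1 < n1%:R.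
  by exists (Num.Def.archi_bound t^-1); rewrite archi_boundP// invr_ge0 ltW.
have [n2 h2] : exists n2 : nat, t < n2%:R.
  by exists (Num.Def.archi_bound t); rewrite archi_boundP// ltW.
exists (n1 + n2)%N => //; rewrite /gitv /= in_itv /=; apply/andP; split.
  rewrite -[leRHS]invrK lef_pV2 ?posrE ?invr_gt0//.
  by apply: le_trans (ltW h1) _; rewrite ler_nat; lia.
by apply: le_trans (ltW h2) _; rewrite ler_nat; lia.
Qed.

Lemma measurable_gamma_kernel a D : measurable D -> measurable_fun D (gamma_kernel a).
Proof.
move=> mD; apply: (@measurable_funS _ _ _ _ setT) => //.
apply: measurable_funM.
  exact: measurable_powR.
by apply: measurableT_comp => //; exact: measurable_funN.
Qed.

Lemma gamma_kernel_ge0 a t : 0 <= gamma_kernel a t.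
Proof. by rewrite mulr_ge0 ?powR_ge0 ?expR_ge0. Qed.

Lemma gamma_part_cvg a :
  (\int[mu]_(t in gitv n) (gamma_kernel a t)%:E @[n --> \oo] --> gammaE a)%E.
Proof.
rewrite /gammaE -bigcup_gitv; apply: ge0_nondecreasing_set_cvg_integral.
- move=> m n mn; apply/subsetPset => t; rewrite /gitv /= !in_itv/= => /andP[h1 h2].
  apply/andP; split.
    by apply: le_trans h1; rewrite lef_pV2 ?posrE// ler_nat ltnS.
  by apply: le_trans h2 _; rewrite ler_nat !ltnS.
- by move=> n; exact: measurable_itv.
- by move=> n; apply/measurable_EFinP; apply: measurable_gamma_kernel; exact: measurable_itv.
- by move=> n t _; rewrite lee_fin gamma_kernel_ge0.
Qed.

Lemma derivable_pos_itv (F : R -> R) (x y : R) : 0 < x -> x < y ->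
  (forall t, 0 < t -> derivable F t 1) -> derivable_oo_LRcontinuous F x y.
Proof.
move=> x0 xy dF.
have cF t : 0 < t -> F z @[z --> t] --> F t.
  by move=> /dF /derivable1_diffP/differentiable_continuous.
split.
- by move=> t; rewrite in_itv/= => /andP[xt _]; apply: dF; exact: lt_trans xt.
- by apply: cvg_at_right_filter; exact: cF.
- by apply: cvg_at_left_filter; apply: cF; exact: lt_trans xy.
Qed.

Lemma derivable_continuous_itv (F : R -> R) (x y : R) : 0 < x ->
  (forall t, 0 < t -> derivable F t 1) -> {within `[x, y], continuous F}.
Proof.
move=> x0 dF; apply: continuous_in_subspaceT => t /set_mem /=; rewrite in_itv/= => /andP[xt _].
by have /derivable1_diffP/differentiable_continuous := dF t (lt_le_trans x0 xt).
Qed.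

Lemma derivable_powR_pos a t : 0 < t -> derivable (@powR R ^~ a) t 1.
Proof. by move=> t0; apply: derivable_powR; rewrite in_itv/= t0. Qed.

Lemma derivable_expRN t : derivable (fun t => - expR (- t)) t 1.
Proof. by []. Qed.

Lemma derive_expRN t : derive1 (fun t => - expR (- t)) t = expR (- t) :> R.
Proof.
rewrite derive1E; apply: derive_val.
have h := is_deriveN (is_derive1_comp (is_derive_expR (- t)) (is_deriveN (is_derive_id t 1))).
apply: is_derive_eq.
by rewrite mulrN1 opprK.
Qed.

Lemma gamma_parts a n : 
  (\int[mu]_(t in gitv n) (gamma_kernel (a + 1) t)%:E =
   (n.+1%:R^-1 `^ a * expR (- n.+1%:R^-1) - n.+2%:R `^ a * expR (- n.+2%:R))%:E +
   a%:E * \int[mu]_(t in gitv n) (gamma_kernel a t)%:E)%E.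
Proof.
have x0 : 0 < n.+1%:R^-1 :> R by rewrite invr_gt0.
have := @integration_by_parts R (@powR R ^~ a) (fun t => - expR (- t))
  (fun t => a * t `^ (a - 1)) (fun t => expR (- t)) _ _ (gitv_lt n).
have dp : forall t, 0 < t -> derivable (fun t => a * t `^ (a - 1)) t 1.
  by move=> t t0; apply: derivableM => //; exact: derivable_powR_pos.
have de (t : R) : derivable (fun t => expR (- t)) t 1 by [].
move=> /(_ (derivable_continuous_itv x0 dp)).
move=> /(_ (derivable_pos_itv x0 (gitv_lt n) (@derivable_powR_pos a))).
have h1 : {in `]n.+1%:R^-1, n.+2%:R[, derive1 (@powR R ^~ a) =1 (fun t => a * t `^ (a - 1))}.
  move=> t; rewrite in_itv/= => /andP[xt _]; rewrite powR_derive1// in_itv/=.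
  by rewrite (lt_trans x0 xt).
move=> /(_ h1 (derivable_continuous_itv x0 (fun t _ => de t))).
move=> /(_ (derivable_pos_itv x0 (gitv_lt n) (fun t _ => @derivable_expRN t))).
move=> /(_ (fun t _ => @derive_expRN t)) h.
rewrite (_ : (\int[mu]_(t in gitv n) _ = \int[mu]_(t in gitv n) (t `^ a * expR (- t))%:E)%E); last first.
  by apply: eq_integral => t _; rewrite /gamma_kernel addrK.
rewrite /gitv h.
rewrite -/(gitv n); have -> : (\int[mu]_(x in gitv n) (a * x `^ (a - 1) * - expR (- x))%:E =
   (- a)%:E * \int[mu]_(x in gitv n) (gamma_kernel a x)%:E)%E.
  rewrite -integralZl//=; first last.
  - apply: continuous_compact_integrable; first exact: segment_compact.
    apply: (derivable_continuous_itv x0) => t t0; apply: derivableM => //.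
    exact: derivable_powR_pos.
  - exact: measurable_itv.
  by apply: eq_integral => t _; rewrite -EFinM /gamma_kernel; congr EFin; ring.
rewrite EFinN mulNe oppeK; congr (_%:E + _)%E; ring.
Qed.

(** With [a <= m], the Taylor term of degree [m + 1] of the exponential leaves a bound of order
    [1 / n]. *)
Lemma boundary_right a : 0 <= a ->
  (fun n => n.+2%:R `^ a * expR (- n.+2%:R)) @ \oo --> (0 : R).
Proof.
move=> a0; pose m := (Num.Def.archi_bound a).
have am : a <= m%:R by rewrite ltW// archi_boundP.
have h n : n.+2%:R `^ a * expR (- n.+2%:R) <= (m.+1)`!%:R * n.+1%:R^-1 :> R.
  have n0 : 0 < n.+2%:R :> R by [].
  have e1 : n.+2%:R ^+ m.+1 / (m.+1)`!%:R <= expR n.+2%:R :> R.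
    by apply: le_trans (expR_ge1Dxn m (ltW n0)); rewrite lerDr.
  have f0 : 0 < (m.+1)`!%:R :> R by rewrite ltr0n fact_gt0.
  rewrite expRN ler_pdivrMr ?expR_gt0//.
  apply: (@le_trans _ _ (n.+2%:R ^+ m)).
    by rewrite -powR_mulrn// ler_powR// ler1n.
  apply: (@le_trans _ _ ((m.+1)`!%:R / n.+1%:R * (n.+2%:R ^+ m.+1 / (m.+1)`!%:R))).
    rewrite (_ : _ * _ = n.+2%:R ^+ m * (n.+2%:R / n.+1%:R)); last first.
      have gen (F k x y : R) : F != 0 -> k != 0 -> F / k * (y * x / F) = y * (x / k).
        by move=> F0 k0; field; rewrite F0 k0.
      by rewrite exprSr gen ?pnatr_eq0 -?lt0n ?fact_gt0.
    rewrite ler_peMr ?exprn_ge0// ler_pdivlMr// mul1r ler_nat//.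
  by rewrite ler_pM2l// divr_gt0.
apply: (@squeeze_cvgr _ _ _ _ (fun=> 0) (fun n => (m.+1)`!%:R * n.+1%:R^-1)).
- by apply: nearW => n; rewrite h mulr_ge0 ?powR_ge0 ?expR_ge0.
- exact: cvg_cst.
- by rewrite -[X in _ --> X](mulr0 (m.+1)`!%:R); apply: cvgMr; exact: cvg_harmonic.
Qed.

Lemma boundary_left a : 0 < a ->
  (fun n => n.+1%:R^-1 `^ a * expR (- n.+1%:R^-1)) @ \oo --> (0 : R).
Proof.
move=> a0.
apply: (@squeeze_cvgr _ _ _ _ (fun=> 0) (fun n => n.+1%:R^-1 `^ a)).
- apply: nearW => n; rewrite mulr_ge0 ?powR_ge0 ?expR_ge0//=.
  by rewrite ler_piMr ?powR_ge0// expR_le1 oppr_le0 invr_ge0.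
- exact: cvg_cst.
- have /cvg_at_rightP := @powR_cvg0 R a a0.
  apply; split; [by move=> n; rewrite invr_gt0|exact: cvg_harmonic].
Qed.

Lemma gammaE_rec a : 0 < a -> (gammaE (a + 1) = a%:E * gammaE a)%E.
Proof.
move=> a0; have h1 := @gamma_part_cvg (a + 1).
have h2 : (a%:E * \int[mu]_(t in gitv n) (gamma_kernel a t)%:E @[n --> \oo] --> a%:E * gammaE a)%E.
  apply: cvgeZl => //; exact: gamma_part_cvg.
have h3 : (fun n => n.+1%:R^-1 `^ a * expR (- n.+1%:R^-1) -
    n.+2%:R `^ a * expR (- n.+2%:R)) @ \oo --> (0 : R).
  rewrite -[X in _ --> X]subr0.
  by apply: cvgB; [exact: boundary_left|apply: boundary_right; exact: ltW].
have h4 : ((n.+1%:R^-1 `^ a * expR (- n.+1%:R^-1) - n.+2%:R `^ a * expR (- n.+2%:R))%:E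
   @[n --> \oo] --> 0%:E)%E.
  by apply: cvg_EFin; [exact: nearW|exact: h3].
have e : (fun n => \int[mu]_(t in gitv n) (gamma_kernel (a + 1) t)%:E)%E =
    (fun n => (n.+1%:R^-1 `^ a * expR (- n.+1%:R^-1) - n.+2%:R `^ a * expR (- n.+2%:R))%:E +
   a%:E * \int[mu]_(t in gitv n) (gamma_kernel a t)%:E)%E.
  by apply/funext => n; exact: gamma_parts.
rewrite e in h1; apply: (cvg_unique _ h1) => //.
by rewrite /= -[(a%:E * gammaE a)%E]add0e; apply: cvgeD.
Qed.

Lemma gammaE1 : gammaE 1 = 1%E.
Proof.
have h1 := @gamma_part_cvg 1.
apply: (cvg_unique _ h1) => //.
have -> : (fun n => \int[mu]_(t in gitv n) (gamma_kernel 1 t)%:E)%E =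
   (fun n => (expR (- n.+1%:R^-1) - n.+2%:R `^ 0 * expR (- n.+2%:R))%:E).
  apply/funext => n; have := gamma_parts 0 n; rewrite add0r => ->.
  by rewrite mul0e adde0 !powRr0 mul1r.
apply: cvg_EFin; first exact: nearW.
rewrite -[X in _ --> X]subr0; apply: cvgB; last exact: boundary_right.
have : expR (- n.+1%:R^-1) @[n --> \oo] --> expR (- 0 : R).
  apply: continuous_cvg; first exact: continuous_expR.
  by apply: cvgN; exact: cvg_harmonic.
by rewrite oppr0 expR0.
Qed.

Lemma gammaE_nat m : gammaE m.+1%:R = (m`!%:R)%:E.
Proof.
elim: m => [|m IH]; first exact: gammaE1.
by rewrite -natr1 gammaE_rec// IH -EFinM factS natrM.
Qed.

Lemma gammaE_ge0 a : (0 <= gammaE a)%E.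
Proof. by apply: integral_ge0 => t _; rewrite lee_fin gamma_kernel_ge0. Qed.

(** For [b >= 1] the kernel is at most the sum of the kernels at 1 and at a large integer, whose
    integrals are known; any [a > 0] then follows from the functional equation, as [a + 1 >= 1]. *)
Lemma gammaE_fin a : 0 < a -> gammaE a \is a fin_num.
Proof.
have big b : 1 <= b -> gammaE b \is a fin_num.
  move=> b1; pose m := Num.Def.archi_bound b.
  have bm : b <= m%:R by rewrite ltW// archi_boundP// (le_trans _ b1).
  rewrite ge0_fin_numE ?gammaE_ge0//.
  apply: (@le_lt_trans _ _ (gammaE 1 + gammaE m.+1%:R)%E); last first.
    by rewrite gammaE1 gammaE_nat -EFinD ltry.
  rewrite /gammaE -ge0_integralD//=; last 4 first.
  - by move=> t _; rewrite lee_fin gamma_kernel_ge0.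
  - by apply/measurable_EFinP; apply: measurable_gamma_kernel; exact: measurable_itv.
  - by move=> t _; rewrite lee_fin gamma_kernel_ge0.
  - by apply/measurable_EFinP; apply: measurable_gamma_kernel; exact: measurable_itv.
  apply: ge0_le_integral => //=.
  - by move=> t _; rewrite lee_fin gamma_kernel_ge0.
  - by apply/measurable_EFinP; apply: measurable_gamma_kernel; exact: measurable_itv.
  - apply: emeasurable_funD; apply/measurable_EFinP; apply: measurable_gamma_kernel;
    exact: measurable_itv.
  move=> t; rewrite in_itv/= andbT => t0; rewrite -EFinD lee_fin /gamma_kernel -mulrDl.
  rewrite ler_pM2r ?expR_gt0// subrr powRr0.
  have [t1|t1] := leP t 1.
    rewrite ler_wpDr ?powR_ge0//.
    by rewrite -[leRHS](powRr0 t); apply: ger_powR; rewrite ?t0// subr_ge0.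
  rewrite ler_wpDl//; apply: ler_powR; first exact: ltW.
  by rewrite lerD2r (le_trans bm)// ler_nat.
move=> a0; have := big (a + 1); rewrite lerDr (ltW a0) gammaE_rec// => /(_ isT).
move: (gammaE_ge0 a); case: (gammaE a) => // _.
by rewrite gt0_muley.
Qed.

Lemma Gamma_gt0 a : 0 < a -> 0 < Gamma a.
Proof.
move=> a0; rewrite GammaE fine_gt0// -ge0_fin_numE ?gammaE_ge0// gammaE_fin// andbT.
(* On [[1, 2]] the power is at least [1 / t >= 1/2] and the exponential at least [expR (-2)]. *)
apply: (@lt_le_trans _ _ (\int[mu]_(t in gitv 0) (expR (-2) / 2)%:E)%E).
  rewrite integral_cst; last exact: measurable_itv.
  rewrite mule_gt0// ?lte_fin ?divr_gt0 ?expR_gt0//.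
  rewrite /gitv/= lebesgue_measure_itv/= lte_fin invr1 ltr1n/=.
  by rewrite -EFinD lte_fin subr_gt0 ltr1n.
apply: (@le_trans _ _ (\int[mu]_(t in gitv 0) (gamma_kernel a t)%:E)%E).
  apply: ge0_le_integral => //=.
  - exact: measurable_itv.
  - by apply/measurable_EFinP; apply: measurable_gamma_kernel; exact: measurable_itv.
  move=> t; rewrite /gitv/= in_itv/= invr1 => /andP[t1 t2]; rewrite lee_fin /gamma_kernel mulrC.
  apply: ler_pM; rewrite ?invr_ge0 ?expR_ge0//; last by rewrite ler_expR lerN2.
  apply: (@le_trans _ _ (t `^ (-1))).
    rewrite powR_inv1; last by rewrite (le_trans _ t1).
    by rewrite lef_pV2 ?posrE// (lt_le_trans _ t1).
  by apply: ler_powR => //; lra.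
apply: ge0_subset_integral => //=.
- exact: measurable_itv.
- by apply/measurable_EFinP; apply: measurable_gamma_kernel; exact: measurable_itv.
- by move=> t _; rewrite lee_fin gamma_kernel_ge0.
- by move=> t /gitv_gt0 t0; rewrite /= in_itv/= t0.
Qed.

Lemma Gamma_rec a : 0 < a -> Gamma (a + 1) = a * Gamma a.
Proof. by move=> a0; rewrite !GammaE gammaE_rec// fineM// gammaE_fin. Qed.

Lemma Gamma_nat m : Gamma m.+1%:R = m`!%:R :> R.
Proof. by rewrite GammaE gammaE_nat. Qed.

Lemma Gamma_prod (r : R) y : 0 < r ->
  Gamma (r + y%:R) = Gamma r * \prod_(0 <= j < y) (r + j%:R).
Proof.
move=> r0; elim: y => [|y IH]; first by rewrite addr0 big_geq// mulr1.
by rewrite -natr1 addrA Gamma_rec ?ltr_wpDr// IH big_nat_recr//= mulrC mulrA.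
Qed.

End gamma_function.

(** * The capacity bound in the shape of the statement *)

Lemma hasSum_shift (R : realType) (f : nat -> R) a :
  hasSum f a <-> hasSum (fun k => f k.+1) (a - f 0%N).
Proof.
have e : series f \o S = (fun n => series (fun k => f k.+1) n + f 0%N).
  apply/funext => n /=; rewrite /series/= big_nat_recl//= addrC.
  by congr (_ + _); rewrite big_add1.
have sh : (hasSum f a) <-> (series f \o S) @ \oo --> a.
  by rewrite /hasSum -(cvg_shiftS (series f)).
rewrite sh e; split => h.
  rewrite /hasSum (_ : series _ = fun n => (series (fun k => f k.+1) n + f 0%N) - f 0%N).
    by apply: cvgB; [exact: h|exact: cvg_cst].
  by apply/funext => n; rewrite addrK.
rewrite -[X in _ --> X](subrK (f 0%N)); apply: cvgD; [exact: h|exact: cvg_cst].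
Qed.

Lemma limn_sum1 (R : realType) (f : nat -> R) a :
  hasSum f a -> limn (fun n => \sum_(1 <= y < n) f y) = a - f 0%N.
Proof.
move=> /hasSum_shift h; apply: cvg_lim => //.
rewrite -cvg_shiftS /=; apply: cvg_trans h; apply: near_eq_cvg; apply: nearW => n.
by rewrite /series /= big_add1.
Qed.

(** The common end of both parts: [W 0] is [delta], [DD] is [Delta_delta], and [C] guarantees that
    the infimum is a genuine lower bound and not a default value. *)
Lemma capacity_bound (R : realType) (p : R) (W : nat -> R) (w : R -> nat -> R)
    (DD : nat -> R) (C : R) :
  0 < p -> p < 1 -> (forall k, 0 < W k) -> subexp W ->
  (forall q k, 0 < q -> w q k.+1 = W k.+1 * q ^+ k.+1) ->
  (forall m, (0 < m)%N -> hasSum (fun k => nb p m k * (ln (W k) - ln (nb p m k)))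
     (DD m + (1 - p) * ln (W 0%N))) ->
  (forall m, (0 < m)%N -> C <= DD m) ->
  let alpha := fun q : R => (W 0%N + \big[+%R/0]_(1 <= y <oo) w q y)^-1 in
  let mu : R -> R := fun q =>
     \big[+%R/0]_(1 <= y <oo) (alpha q * y%:R * w q y) in
  let bound := fun q : R => p * (- inf [set DD x | x in [set x : nat | (1 <= x)%N]] -
       (1 - p) * ln (W 0%N) - ln (alpha q) - mu q * ln q)
       / ((1 - p) * (1 + mu q)) in
  is_true (repeat_capacity (fun y : nat => (1 - p) * p ^+ y)%R <=
   ereal_sup [set (bound q)%:E | q in [set q : R | 0 < q < 1 /\ p / (1 - p) <= mu q]%R])%E.
Proof.
move=> p0 p1 W0 sW wE SW DDC alpha mu.
set E := inf _ => bound.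
have SE m : (0 < m)%N -> E + (1 - p) * ln (W 0%N) <= DD m + (1 - p) * ln (W 0%N).
  move=> m0; rewrite lerD2r; apply: ge_inf; last by exists m.
  by exists C => _ [x x0 <-]; exact: DDC.
have [q q01 [lq cq]] := tilt_capacity p0 p1 W0 sW SW SE.
have q0 : 0 < q by case/andP: q01.
have Z0 := pgf_gt0 W0 sW q01.
have aE : alpha q = (pgf W q)^-1.
  rewrite /alpha; congr (_^-1).
  have h := pgf_sum sW q01.
  have -> : (fun n => \sum_(1 <= y < n) w q y) = (fun n => \sum_(1 <= y < n) W y * q ^+ y).
    by apply/funext => n; rewrite !big_add1; apply: eq_bigr => k _; rewrite wE.
  by rewrite (limn_sum1 h) expr0 mulr1 addrC subrK.
have mE : mu q = tmean W q.
  rewrite /mu aE.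
  have h := hasSumZ (pgf W q)^-1 (dpgf_sum sW q01).
  have -> : (fun n => \sum_(1 <= y < n) ((pgf W q)^-1 * y%:R * w q y)) =
     (fun n => \sum_(1 <= y < n) ((pgf W q)^-1 * (y%:R * (W y * q ^+ y)))).
    by apply/funext => n; rewrite !big_add1; apply: eq_bigr => k _; rewrite wE// -!mulrA.
  by rewrite (limn_sum1 h) !mul0r !mulr0 subr0 mulrC.
apply: le_trans cq _; apply: ereal_sup_ubound; exists q; first by split=> //; rewrite mE.
by rewrite /bound mE aE lnV ?posrE//; congr EFin; congr (_ * _ / _); ring.
Qed.

(** * Rising factorials and harmonic sums *)

(** The binomial coefficient of [r + y - 1] over [y], as a rising factorial: the product is easy to
    compare for different [r]. *)
Definition rfact {R : realType} (r : R) (y : nat) : R :=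
  \prod_(0 <= j < y) (r + j%:R) / y`!%:R.

Lemma rfact0 (R : realType) (r : R) : rfact r 0 = 1.
Proof. by rewrite /rfact big_geq// divr1. Qed.

Lemma rfact_gt0 (R : realType) (r : R) y : 0 < r -> 0 < rfact r y.
Proof.
move=> r0; rewrite divr_gt0 ?ltr0n ?fact_gt0//.
by apply: prodr_gt0 => j _; rewrite ltr_wpDr.
Qed.

Lemma rfact_le (R : realType) (r s : R) y : 0 <= r -> r <= s -> rfact r y <= rfact s y.
Proof.
move=> r0 rs; rewrite ler_pM2r ?invr_gt0 ?ltr0n ?fact_gt0//.
by apply: ler_prod => j _; rewrite lerD2r rs addr_ge0.
Qed.

Lemma rfact_nat (R : realType) (m y : nat) :
  rfact m.+1%:R y = 'C(y + m, y)%:R :> R.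
Proof.
rewrite /rfact; elim: y => [|y IH]; first by rewrite big_geq// divr1 bin0.
rewrite big_nat_recr//= factS natrM.
have f0 : (y`!)%:R != 0 :> R by rewrite pnatr_eq0 -lt0n fact_gt0.
have y0 : y.+1%:R != 0 :> R by [].
have e : y.+1%:R * 'C(y.+1 + m, y.+1)%:R = (m.+1%:R + y%:R) * 'C(y + m, y)%:R :> R.
  by rewrite -natrD -!natrM addSn -mul_bin_diag; congr (_ * _)%:R; lia.
apply: (mulfI y0); rewrite e -IH; field; exact/andP.
Qed.

Lemma gbinomE (R : realType) (r : R) y : 0 < r ->
  gbinom (r + y%:R - 1) y%:R = rfact r y.
Proof.
move=> r0; rewrite /gbinom.
have -> : (r + y%:R - 1 == -1) = false.
  by rewrite -subr_eq0 opprK subrK gt_eqF// ltr_wpDr.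
rewrite /= subrK (_ : r + y%:R - 1 - y%:R + 1 = r); last by ring.
rewrite natr1 Gamma_nat Gamma_prod// /rfact; field.
by rewrite pnatr_eq0 -lt0n fact_gt0 gt_eqF ?Gamma_gt0.
Qed.

Lemma rfactS (R : realType) (r : R) y :
  rfact r y.+1 = rfact r y * ((r + y%:R) / y.+1%:R).
Proof.
rewrite /rfact big_nat_recr//= factS natrM.
have f0 : (y`!)%:R != 0 :> R by rewrite pnatr_eq0 -lt0n fact_gt0.
have gen (P F k s : R) : F != 0 -> k != 0 -> P * s / (k * F) = P / F * (s / k).
  by move=> F0 k0; field; rewrite F0 k0.
by rewrite gen.
Qed.

Lemma rfact_ratio (R : realType) (r s : R) y : 0 < s ->
  rfact r y / rfact s y = \prod_(0 <= j < y) ((r + j%:R) / (s + j%:R)).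
Proof.
move=> s0; have f0 : (y`!)%:R != 0 :> R by rewrite pnatr_eq0 -lt0n fact_gt0.
rewrite prodf_div /rfact; field; rewrite f0 gt_eqF//.
by apply: prodr_gt0 => j _; rewrite ltr_wpDr.
Qed.

Lemma rfact_ge (R : realType) (k r : R) y : 0 < k <= 1 -> k <= r -> k ^+ y <= rfact r y.
Proof.
move=> /andP[k0 k1] kr; elim: y => [|y IH]; first by rewrite rfact0.
rewrite rfactS exprSr; apply: ler_pM; rewrite ?exprn_ge0 ?(ltW k0)//.
rewrite ler_pdivlMr// -natr1 mulrDr mulr1 addrC lerD//.
by rewrite ler_piMl.
Qed.

(** Applied with [r = y (1 - p) / p], for which [(r + y) / r = 1 / (1 - p)]: together with
    [harmonic_le], the sum is [- ln (1 - p)] up to [1 / r]. *)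
Lemma harmonic_ge (R : realType) (r : R) y : 0 < r ->
  ln ((r + y%:R) / r) <= \sum_(0 <= j < y) (r + j%:R)^-1.
Proof.
move=> r0; have ry k : 0 < r + k%:R by rewrite ltr_wpDr.
elim: y => [|y IH]; first by rewrite addr0 divff ?gt_eqF// ln1 big_geq.
rewrite big_nat_recr//=; apply: le_trans (lerD IH (lexx _)).
have -> : (r + y.+1%:R) / r = (r + y%:R) / r * (1 + (r + y%:R)^-1).
  by rewrite -natr1; field; rewrite !gt_eqF.
have A0 : 0 < (r + y%:R) / r by rewrite divr_gt0.
have B0 : 0 < 1 + (r + y%:R)^-1 by rewrite addr_gt0// invr_gt0.
rewrite lnM ?posrE// lerD2l.
by apply: le_ln1Dx; rewrite (@lt_trans _ _ 0)// ?ltrN10// invr_gt0.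
Qed.

Lemma harmonic_le (R : realType) (r : R) y : 0 < r ->
  \sum_(0 <= j < y) (r + j%:R)^-1 <= ln ((r + y%:R) / r) + r^-1.
Proof.
move=> r0; have ry k : 0 < r + k%:R by rewrite ltr_wpDr.
case: y => [|y]; first by rewrite big_geq// addr0 divff ?gt_eqF// ln1 add0r invr_ge0 ltW.
apply: (@le_trans _ _ (ln ((r + y%:R) / r) + r^-1)); last first.
  rewrite lerD2r ler_ln ?posrE ?divr_gt0// ler_pM2r ?invr_gt0//.
  by rewrite lerD2l ler_nat.
elim: y => [|y IH]; first by rewrite big_nat1 addr0 divff ?gt_eqF// ln1 add0r.
rewrite big_nat_recr//=; apply: le_trans (lerD IH (lexx _)) _.
rewrite addrAC lerD2r.
have -> : (r + y%:R) / r = (r + y.+1%:R) / r * (1 - (r + y.+1%:R)^-1).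
  by rewrite -natr1; field; rewrite !gt_eqF//; have := ry y.+1; rewrite -natr1 addrA.
have u0 : 0 < 1 - (r + y.+1%:R)^-1.
  rewrite subr_gt0 invf_lt1// -natr1 addrA ltrDr; exact: ry.
rewrite lnM ?posrE ?divr_gt0// -addrA gerDl.
by have := @le_ln1Dx R (- (r + y.+1%:R)^-1); rewrite ltrN2 => /(_ _); lra.
Qed.

(** * The weight of part (1) *)

Section part1.
Variables (R : realType) (p : R).
Hypotheses (p0 : 0 < p) (p1 : p < 1).
Local Notation d := (1 - p).
Local Notation b := ((1 - p) / p).
Let h := bin_entropy p.

Let d0 : 0 < d. Proof. by rewrite subr_gt0. Qed.
Let b0 : 0 < b. Proof. by rewrite divr_gt0. Qed.
Let lnd : ln d <= 0. Proof. by rewrite ln_le0// gerBl ltW. Qed.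
Let lnp : ln p <= 0. Proof. by rewrite ln_le0// ltW. Qed.

Definition gbinom_weight (y : nat) := gbinom (y%:R / p - 1) y%:R.

Lemma hpE (y : R) : y * h / p = - (b * y * ln d) - y * ln p.
Proof. by rewrite /h /bin_entropy; field; rewrite gt_eqF. Qed.

Lemma gbinom_weight_0 : gbinom_weight 0 = 1.
Proof. by rewrite /gbinom_weight /gbinom mul0r sub0r !eqxx. Qed.

(** [y / p = r + y] with [r = y (1 - p) / p > 0], so Gamma is met at positive arguments only. *)
Lemma gbinom_weight_S y : gbinom_weight y.+1 = rfact (b * y.+1%:R) y.+1.
Proof.
have e : y.+1%:R / p = b * y.+1%:R + y.+1%:R by field; rewrite gt_eqF.
by rewrite /gbinom_weight e gbinomE// mulr_gt0.
Qed.

Lemma gbinom_weight_gt0 y : 0 < gbinom_weight y.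
Proof. by case: y => [|y]; [rewrite gbinom_weight_0|rewrite gbinom_weight_S rfact_gt0// mulr_gt0]. Qed.

(** With [n] the integer part of [r], [rfact r y] is at most the binomial coefficient in
    [nb p n.+1 y], which is a probability. *)
Lemma ln_rfact_le r y : 0 < r -> ln (rfact r y) <= - ((r + 1) * ln d) - y%:R * ln p.
Proof.
move=> r0; pose n := Num.truncn r.
have /andP[n1 n2] := truncn_itv (ltW r0).
apply: (@le_trans _ _ (- (n.+1%:R * ln d) - y%:R * ln p)); last first.
  by rewrite lerD2r lerN2 -natr1 ler_wnM2r// lerD2r.
have := nb_le1 p0 p1 y (ltn0Sn n); rewrite /nb addnS/= -rfact_nat => h1.
have h2 : rfact r y * (d ^+ n.+1 * p ^+ y) <= 1.
  apply: le_trans h1; rewrite -mulrA ler_pM2r ?mulr_gt0 ?exprn_gt0//.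
  by apply: rfact_le; exact: ltW.
have : ln (rfact r y * (d ^+ n.+1 * p ^+ y)) <= 0 by apply: ln_le0.
have dp0 : 0 < d ^+ n.+1 * p ^+ y by rewrite mulr_gt0 ?exprn_gt0.
rewrite [ln (_ * (_ * _))]lnM ?posrE ?rfact_gt0// lnM ?posrE ?exprn_gt0//.
by rewrite !lnXn// -(mulr_natl (ln d)) -(mulr_natl (ln p)); lra.
Qed.

Lemma ln_gbinom_weight_le y : ln (gbinom_weight y) <= y%:R * h / p - ln d.
Proof.
case: y => [|y]; first by rewrite gbinom_weight_0 ln1 !mul0r add0r oppr_ge0.
rewrite gbinom_weight_S; apply: le_trans (ln_rfact_le _ _) _; first by rewrite mulr_gt0.
by rewrite hpE; lra.
Qed.

Lemma ln_gbinom_weight_ge y : y%:R * ln (Num.min b 1) <= ln (gbinom_weight y).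
Proof.
have k0 : 0 < Num.min b 1 by rewrite lt_min b0 ltr01.
rewrite mulr_natl -lnXn// ler_ln ?posrE ?exprn_gt0 ?gbinom_weight_gt0//.
case: y => [|y]; first by rewrite gbinom_weight_0.
rewrite gbinom_weight_S; apply: rfact_ge; first by rewrite k0 ge_min lexx orbT.
by rewrite ge_min ler_peMr ?ler1n// ltW.
Qed.

Lemma negbinE x y : (0 < x)%N -> negbin p x y = nb p x y.
Proof.
case: x => // x _; rewrite /negbin /nb addnS/= [_ + x.+1%:R]addrC gbinomE//.
by rewrite rfact_nat.
Qed.

Lemma gbinom_nat x y : (0 < x)%N -> gbinom (y%:R + x%:R - 1) y%:R = 'C((y + x).-1, y)%:R :> R.
Proof.
by case: x => // x _; rewrite [_ + x.+1%:R]addrC gbinomE// rfact_nat addnS.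
Qed.

Lemma ln_nb x y : (0 < x)%N ->
  ln (nb p x y) = ln 'C((y + x).-1, y)%:R + x%:R * ln d + y%:R * ln p.
Proof.
case: x => // x _; rewrite /nb; have c0 : 0 < 'C((y + x.+1).-1, y)%:R :> R.
  by rewrite ltr0n bin_gt0 addnS leq_addr.
by rewrite !lnM ?posrE ?mulr_gt0 ?exprn_gt0// !lnXn// !mulr_natl.
Qed.

(** Since [ln z >= 1 - 1 / z], the logarithm is at least [(r - x) * H] with [H] the harmonic sum at
    [r], close to [- ln d]. The main term is linear in [y] and centred: its mean under [nb p x] is
    0. *)
Lemma ln_ratio_ge x y : (0 < x)%N ->
  (b * y%:R - x%:R) * - ln d - 1 - 2 * x%:R / (b * y.+1%:R) <=
  ln (gbinom_weight y / 'C((y + x).-1, y)%:R).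
Proof.
case: x => // x _; have xp : 0 < x.+1%:R :> R by [].
have ld : 0 <= - ln d by rewrite oppr_ge0.
case: y => [|y].
  rewrite gbinom_weight_0 bin0 divr1 ln1 mulr0 sub0r mulr1.
  have h1 : 0 <= 2 * x.+1%:R / b by rewrite divr_ge0// ltW.
  have h2 : 0 <= x.+1%:R * - ln d by rewrite mulr_ge0.
  by lra.
rewrite gbinom_weight_S addnS/= -rfact_nat; set r := b * y.+1%:R.
have r0 : 0 < r by rewrite mulr_gt0.
rewrite rfact_ratio//.
have rj k : 0 < r + k%:R by rewrite ltr_wpDr.
have xj k : 0 < x.+1%:R + k%:R :> R by rewrite ltr_wpDr.
have lnprod n : ln (\prod_(0 <= j < n) ((r + j%:R) / (x.+1%:R + j%:R))) =
    \sum_(0 <= j < n) ln ((r + j%:R) / (x.+1%:R + j%:R)).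
  elim: n => [|n IH]; first by rewrite !big_geq// ln1.
  rewrite !big_nat_recr//= lnM ?posrE ?divr_gt0//; first by rewrite IH.
  by apply: prodr_gt0 => j _; rewrite divr_gt0.
rewrite lnprod; pose H := \sum_(0 <= j < y.+1) (r + j%:R)^-1.
apply: (@le_trans _ _ ((r - x.+1%:R) * H)); last first.
  rewrite /H mulr_sumr; apply: ler_sum => j _.
  have := ln_le_subr1 (_ : 0 < (x.+1%:R + j%:R) / (r + j%:R)).
  rewrite divr_gt0// => /(_ isT); rewrite -[in ln _]invf_div lnV ?posrE ?divr_gt0//.
  rewrite (_ : _ / _ - 1 = - ((r - x.+1%:R) / (r + j%:R))); last by field; rewrite gt_eqF.
  by rewrite lerN2.
have eK : ln ((r + y.+1%:R) / r) = - ln d.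
  rewrite -lnV ?posrE//; congr ln; rewrite /r; field.
  by rewrite !gt_eqF.
have H1 := harmonic_ge y.+1 r0; have H2 := harmonic_le y.+1 r0; rewrite eK -/H in H1 H2.
(* The factor 2 trades [1 / y] for [2 / (y + 1)], an error term that also makes sense at 0. *)
have xr : x.+1%:R / r <= 2 * x.+1%:R / (b * y.+2%:R).
  rewrite ler_pdivrMr// mulrAC ler_pdivlMr ?mulr_gt0 ?invr_gt0// /r.
  have : x.+1%:R * b * y.+2%:R <= x.+1%:R * b * (2 * y.+1%:R).
    by rewrite (ler_pM2l (mulr_gt0 xp b0)) -natrM ler_nat; lia.
  by set bb := (1 - p) / p; lra.
have xr0 : 0 < x.+1%:R / r by rewrite divr_gt0.
move: xr; set T := 2 * x.+1%:R / _; clearbody T => xr.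
have [rx|xr'] := leP x.+1%:R r.
  have h1 : (r - x.+1%:R) * - ln d <= (r - x.+1%:R) * H by rewrite ler_wpM2l// subr_ge0.
  by lra.
have h1 : (r - x.+1%:R) * (- ln d + r^-1) <= (r - x.+1%:R) * H.
  by rewrite ler_wnM2l// subr_le0 ltW.
have h2 : (r - x.+1%:R) * r^-1 = 1 - x.+1%:R / r by field; rewrite gt_eqF.
rewrite mulrDr h2 in h1.
by lra.
Qed.

(** Division by [y + 1] lowers [x] by one and shifts [y], so that the mean of [x / (Y + 1)] is
    bounded uniformly in [x]. *)
Lemma nb_div_succ x y : (1 < x)%N ->
  x%:R / y.+1%:R * nb p x y = x%:R / x.-1%:R * b * nb p x.-1 y.+1.
Proof.
case: x => [//|[//|x]] _ /=.
have e : y.+1%:R * 'C(y.+1 + x, y.+1)%:R = x.+1%:R * 'C(y + x.+1, y)%:R :> R.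
  rewrite -!natrM; congr _%:R; rewrite addSnnS mul_bin_left.
  by congr (_ * _)%N; lia.
rewrite /nb (_ : (y + x.+2).-1 = y + x.+1)%N; last by lia.
rewrite (_ : (y.+1 + x.+1).-1 = y.+1 + x)%N; last by lia.
have gen (u c c' k l : R) : k != 0 -> l != 0 -> k * c' = l * c ->
    u / k * (c * d ^+ x.+2 * p ^+ y) = u / l * b * (c' * d ^+ x.+1 * p ^+ y.+1).
  move=> k0 l0 kl; rewrite [d ^+ x.+2]exprS [p ^+ y.+1]exprS.
  have -> : c = k * c' / l by rewrite kl mulrAC mulfV// mul1r.
  by field; rewrite k0 l0 gt_eqF.
exact: gen.
Qed.

Lemma Delta_term_bound x : (0 < x)%N -> exists K, forall y,
  `|ln (gbinom_weight y / 'C((y + x).-1, y)%:R)| <= K * y.+1%:R.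
Proof.
move=> x0; set k := Num.min b 1.
have k0 : 0 < k by rewrite lt_min b0 ltr01.
have lk : ln k <= 0 by rewrite ln_le0// ge_min lexx orbT.
exists (`|h / p| - ln d - ln k - x%:R * ln d - ln p) => y.
have y1 : 1 <= y.+1%:R :> R by rewrite ler1n.
have yy : y%:R <= y.+1%:R :> R by rewrite ler_nat.
have c1 : 1 <= 'C((y + x).-1, y)%:R :> R.
  by rewrite ler1n bin_gt0; case: x x0 => // x _; rewrite addnS leq_addr.
rewrite ln_div ?posrE ?gbinom_weight_gt0// ?(lt_le_trans _ c1)//.
have c0 := ln_ge0 c1.
have c2 : ln 'C((y + x).-1, y)%:R <= - (x%:R * ln d) - y%:R * ln p.
  have := ln_le0 (nb_le1 p0 p1 y x0); rewrite ln_nb//; lra.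
have g1 := ln_gbinom_weight_le y; have g2 := ln_gbinom_weight_ge y; rewrite -/k in g2.
have e1 : y%:R * h / p <= `|h / p| * y.+1%:R.
  rewrite -mulrA mulrC; apply: (@le_trans _ _ (`|h / p| * y%:R)).
    by rewrite ler_wpM2r// ler_norm.
  by rewrite ler_wpM2l.
have e2 : - ln d <= - ln d * y.+1%:R by rewrite ler_peMr// oppr_ge0.
have e3 : - (y%:R * ln k) <= - ln k * y.+1%:R.
  by rewrite mulrC -mulNr ler_wpM2l// oppr_ge0.
have e4 : - (x%:R * ln d) <= - (x%:R * ln d) * y.+1%:R.
  by rewrite ler_peMr// oppr_ge0 mulr_ge0_le0.
have e5 : - (y%:R * ln p) <= - ln p * y.+1%:R.
  by rewrite mulrC -mulNr ler_wpM2l// oppr_ge0.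
have n1 : 0 <= `|h / p| * y.+1%:R by rewrite mulr_ge0.
have n2 : 0 <= - ln d * y.+1%:R by rewrite mulr_ge0// oppr_ge0.
have n3 : 0 <= - ln k * y.+1%:R by rewrite mulr_ge0// oppr_ge0.
have n4 : 0 <= - (x%:R * ln d) * y.+1%:R by rewrite mulr_ge0// oppr_ge0 mulr_ge0_le0.
have n5 : 0 <= - ln p * y.+1%:R by rewrite mulr_ge0// oppr_ge0.
by rewrite ler_norml; apply/andP; split; lra.
Qed.

Lemma Delta_sum x : (0 < x)%N ->
  hasSum (fun y => nb p x y * ln (gbinom_weight y / 'C((y + x).-1, y)%:R)) (Delta p x).
Proof.
move=> x0.
have -> : Delta p x = limn (series (fun y => nb p x y * ln (gbinom_weight y / 'C((y + x).-1, y)%:R))).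
  rewrite /Delta; congr (limn _); apply/funext => n; apply: eq_bigr => y _.
  by rewrite negbinE// gbinom_nat.
apply: cvg_hasSum.
have [K hK] := Delta_term_bound x0.
apply: (@dominated_cvg_series _ _ (fun y => K * (y.+1%:R * nb p x y))).
  move=> y; rewrite normrM gtr0_norm ?nb_gt0// mulrC [leRHS]mulrA.
  by rewrite ler_pM2r ?nb_gt0.
by apply: is_cvg_seriesZ; exact: nb_moment1.
Qed.

(** Uniformity in [x] makes the infimum of [Delta_delta] finite. The linear term averages out, the
    slack in [ln_ratio_ge] costs 1, and the error term averages to at most 4, or [2 / b] when
    [x = 1]. *)
Lemma Delta_ge x : (0 < x)%N -> - (5 + 2 / b) <= Delta p x.
Proof.
move=> x0.
have hm := hasSumZ b (nb_mean p0 p1 x0).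
have h1 := hasSumB (hasSumZ (- ln d) (hasSumB hm (hasSumZ x%:R (nb_sum p0 p1 x0)))) (nb_sum p0 p1 x0).
rewrite (_ : b * (p / d * x%:R) - x%:R * 1 = 0) ?mulr0 ?sub0r in h1; last first.
  by field; rewrite !gt_eqF.
have key (E : R) : (exists2 g : nat -> R, hasSum g E & forall y, 2 * x%:R / (b * y.+1%:R) * nb p x
  y <= g y) ->
    - 1 - E <= Delta p x.
  move=> [g hg gE]; apply: hasSum_le (hasSumB h1 hg) (Delta_sum x0) _ => y.
  have := ler_wpM2r (ltW (nb_gt0 p0 p1 y x0)) (ln_ratio_ge y x0).
  have := gE y.
  set T := 2 * x%:R / _; set bb := (1 - p) / p; set L := ln (gbinom_weight y / _).
  by lra.
have b20 : 0 < 2 / b by rewrite divr_gt0.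
(* [x = 1] is treated apart because [nb_div_succ] would lead to [nb p 0]; there [y + 1 >= 1]
   suffices. *)
have [x1|x1] := leqP x 1.
  have {x0 x1} x1 : x = 1%N by lia.
  apply: le_trans (key (2 / b) _); first by lra.
  exists (fun y => 2 / b * nb p x y).
    by rewrite -[X in hasSum _ X]mulr1; apply: hasSumZ; apply: nb_sum => //; rewrite x1.
  move=> y; rewrite ler_wpM2r//; first by rewrite ltW ?nb_gt0 ?x1.
  rewrite x1 mulr1 ler_pM2l// lef_pV2 ?posrE ?mulr_gt0 ?invr_gt0//.
  by rewrite ler_peMr ?ler1n// ltW.
have xm0 : (0 < x.-1)%N by lia.
apply: le_trans (key (4 * (1 - nb p x.-1 0)) _).
  by have := nb_gt0 p0 p1 0 xm0; lra.
exists (fun y => 4 * nb p x.-1 y.+1).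
  by apply: hasSumZ; exact: ((hasSum_shift (nb p x.-1) 1).1 (nb_sum p0 p1 xm0)).
move=> y.
rewrite (_ : _ * _ = 2 / b * (x%:R / y.+1%:R * nb p x y)); last first.
  have gen (u k n : R) : k != 0 -> 2 * u / (b * k) * n = 2 / b * (u / k * n).
    by move=> k0; field; rewrite k0 !gt_eqF.
  exact: gen.
rewrite nb_div_succ//; have := nb_gt0 p0 p1 y.+1 xm0.
move: (nb p x.-1 y.+1) => N N0.
have gen (u : R) : 2 / b * (u * b * N) = 2 * u * N by field; rewrite !gt_eqF.
rewrite gen ler_pM2r//.
have xx : x%:R / x.-1%:R <= 2 :> R.
  by rewrite ler_pdivrMr ?ltr0n// -natrM ler_nat; lia.
by lra.
Qed.

Lemma part1_bound (delta : R) : 0 < delta ->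
  let W := fun y => if y is 0%N then delta else gbinom_weight y * expR (- (y%:R * h / p)) in
  [/\ forall k, 0 < W k, subexp W,
      forall m, (0 < m)%N -> hasSum (fun k => nb p m k * (ln (W k) - ln (nb p m k)))
        (Delta p m + d ^+ m * ln delta) &
      forall m, (0 < m)%N -> - (5 + 2 / b) - `|ln delta| <= Delta p m + d ^+ m * ln delta].
Proof.
move=> delta0 W.
have W0 k : 0 < W k by case: k => // k; rewrite /W mulr_gt0 ?gbinom_weight_gt0 ?expR_gt0.
split=> //.
- move=> r /andP[r0 r1]; exists (Num.max delta d^-1) => k.
  rewrite gtr0_norm//; apply: (@le_trans _ _ (W k)).
    by rewrite ler_piMr ?(ltW (W0 k))// exprn_ile1 ?ltW.
  rewrite le_max; case: k => [|k]; first by rewrite lexx.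
  apply/orP; right; rewrite /W -ler_ln ?posrE ?mulr_gt0 ?gbinom_weight_gt0 ?expR_gt0 ?invr_gt0//.
  rewrite lnM ?posrE ?gbinom_weight_gt0 ?expR_gt0// expRK lnV ?posrE//.
  by have := ln_gbinom_weight_le k.+1; lra.
- move=> m m0.
  (* [h / p + ln p = - b * ln d] and the mean is [p / (1 - p) * m], so the entropy factor exactly
     offsets the [m * ln d] in [ln (nb p m k)]. *)
  have hD := hasSumB (hasSumB (hasSumB (Delta_sum m0) (hasSumZ (h / p + ln p) (nb_mean p0 p1 m0)))
    (hasSumZ (m%:R * ln d) (nb_sum p0 p1 m0))) (hasSumZ 0 (nb_sum p0 p1 m0)).
  rewrite (_ : _ - _ - _ - _ = Delta p m) in hD; last first.
    have e : h / p = - (b * ln d) - ln p by have := hpE 1; rewrite !mul1r !mulr1.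
    by rewrite e; field; rewrite !gt_eqF.
  (* Only the term at 0 changes: the weight 1 becomes [delta], and [nb p m 0 = d ^+ m]. *)
  apply/hasSum_shift; move/hasSum_shift : hD.
  have n0 : nb p m 0 = d ^+ m by rewrite /nb bin0 mul1r expr0 mulr1.
  rewrite gbinom_weight_0 bin0 divr1 ln1 ln_nb// bin0 ln1 n0 [W 0%N]/=.
  rewrite (_ : _ - (_ - _ - _ - _) = Delta p m + d ^+ m * ln delta - d ^+ m * (ln delta - (0 + m%:R
    * ln d + 0 * ln p))); last by ring.
  apply: eq_hasSum => k.
  have lW : ln (W k.+1) = ln (gbinom_weight k.+1) - k.+1%:R * h / p.
    by rewrite /W lnM ?posrE ?gbinom_weight_gt0 ?expR_gt0// expRK.
  rewrite ln_nb// lW.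
  rewrite ln_div ?posrE ?gbinom_weight_gt0//; first by field; rewrite gt_eqF.
  by rewrite ltr0n bin_gt0; case: m m0 {n0} => // m _; rewrite addnS leq_addr.
- move=> m m0; apply: lerD; first exact: Delta_ge.
  have := ler_norm (- (d ^+ m * ln delta)); rewrite normrN normrM gtr0_norm ?exprn_gt0//.
  have : d ^+ m * `|ln delta| <= `|ln delta|.
    by rewrite ler_piMl// exprn_ile1 ?(ltW d0)// gerBl ltW.
  by lra.
Qed.

End part1.

(** The square supplies the nonnegative base that [powR] requires at exponent -1; at 0 both
    expressions are 0. *)
Lemma measurable_invr (R : realType) : measurable_fun setT (fun x : R => x^-1).
Proof.
rewrite (_ : (fun x => _) = (fun x : R => x * (x ^+ 2) `^ (-1))).
  apply: measurable_funM => //.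
  have mX : measurable_fun setT (fun x : R => x ^+ 2) by exact: measurable_funX.
  have mP := @measurable_powR R (-1).
  exact (measurableT_comp mP mX).
apply/funext => x; rewrite powR_inv1 ?sqr_ge0//.
have [->|x0] := eqVneq x 0; first by rewrite invr0 mul0r.
by field.
Qed.

(** * Integrals of bounded functions over open intervals *)

Section integral.
Context {R : realType}.
Local Notation mu := (@lebesgue_measure R).
Implicit Types (u v : R) (f g : R -> R).

(** The integrands below are quotients with default values at the ends of the interval; bounds are
    asked inside only, and [ooint_closed] recovers the closed interval. *)
Definition bmeas u v f := measurable_fun setT f /\
  exists C, forall t, u < t < v -> `|f t| <= C.

Definition ooint u v f : R := \int[mu]_(t in `]u, v[) f t.

Lemma lebesgue_measure_oo u v : u <= v -> mu `]u, v[%classic = (v - u)%:E.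
Proof.
move=> uv; rewrite /= lebesgue_measure_itv/= lte_fin.
case: ltP => //= vu; have -> : v = u by apply/eqP; rewrite eq_le uv vu.
by rewrite subrr.
Qed.

Lemma bmeas_integrable u v f : u <= v -> bmeas u v f -> mu.-integrable `]u, v[ (EFin \o f).
Proof.
move=> uv [mf [C fC]]; apply: measurable_bounded_integrable => //.
- by have /= -> := lebesgue_measure_oo uv; rewrite ltry.
- exact: measurable_funTS.
- exists (`|C|); split; first exact: num_real.
  move=> x Cx t /=; rewrite in_itv/= => /fC /le_trans; apply.
  by rewrite (le_trans (ler_norm _))// ltW.
Qed.

Lemma bmeasD u v f g : bmeas u v f -> bmeas u v g -> bmeas u v (fun t => f t + g t).
Proof.
move=> [mf [C fC]] [mg [D gD]]; split; first exact: measurable_funD.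
exists (C + D) => t uv; rewrite (le_trans (ler_normD _ _))// lerD ?fC ?gD//.
Qed.

Lemma bmeasB u v f g : bmeas u v f -> bmeas u v g -> bmeas u v (fun t => f t - g t).
Proof.
move=> [mf [C fC]] [mg [D gD]]; split; first exact: measurable_funB.
exists (C + D) => t uv; rewrite (le_trans (ler_normB _ _))// lerD ?fC ?gD//.
Qed.

Lemma bmeasZ u v c f : bmeas u v f -> bmeas u v (fun t => c * f t).
Proof.
move=> [mf [C fC]]; split; first exact: measurable_funM.
by exists (`|c| * C) => t uv; rewrite normrM ler_wpM2l// fC.
Qed.

Lemma bmeas_cst u v c : bmeas u v (fun=> c).
Proof. by split=> //; exists `|c|. Qed.

Lemma bmeas_sub u v u' v' f : u <= u' -> v' <= v -> bmeas u v f -> bmeas u' v' f.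
Proof.
move=> uu vv [mf [C fC]]; split => //; exists C => t /andP[a b]; apply: fC.
by rewrite (le_lt_trans uu a) (lt_le_trans b vv).
Qed.

Lemma ooint_D u v f g : u <= v -> bmeas u v f -> bmeas u v g ->
  ooint u v (fun t => f t + g t) = ooint u v f + ooint u v g.
Proof. by move=> uv bf bg; apply: RintegralD => //; exact: bmeas_integrable. Qed.

Lemma ooint_B u v f g : u <= v -> bmeas u v f -> bmeas u v g ->
  ooint u v (fun t => f t - g t) = ooint u v f - ooint u v g.
Proof. by move=> uv bf bg; apply: RintegralB => //; exact: bmeas_integrable. Qed.

Lemma ooint_Z u v c f : u <= v -> bmeas u v f -> ooint u v (fun t => c * f t) = c * ooint u v f.
Proof. by move=> uv bf; apply: RintegralZl => //; exact: bmeas_integrable. Qed.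

Lemma ooint_eq u v f g : (forall t, u < t < v -> f t = g t) -> ooint u v f = ooint u v g.
Proof. by move=> fg; apply: eq_Rintegral => t; rewrite inE/= in_itv/= => /fg. Qed.

Lemma ooint_cst u v c : u <= v -> ooint u v (fun=> c) = c * (v - u).
Proof. by move=> uv; rewrite /ooint Rintegral_cst//; have /= -> := lebesgue_measure_oo uv. Qed.

Lemma ooint_le u v f g : u <= v -> bmeas u v f -> bmeas u v g ->
  (forall t, u < t < v -> f t <= g t) -> ooint u v f <= ooint u v g.
Proof.
move=> uv bf bg fg; apply: le_Rintegral => //; by [exact: bmeas_integrable|move=> t /=;
  rewrite in_itv/= => /fg].
Qed.

Lemma ooint_abs_le u v f C : u <= v -> measurable_fun setT f ->
  (forall t, u < t < v -> `|f t| <= C) -> `|ooint u v f| <= C * (v - u).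
Proof.
move=> uv mf fC; have bf : bmeas u v f by split => //; exists C.
have h t : u < t < v -> - C <= f t <= C by rewrite -ler_norml; exact: fC.
rewrite ler_norml -mulNr -!ooint_cst//.
by apply/andP; split; apply: ooint_le => //; try exact: bmeas_cst; move=> t /h /andP[].
Qed.

Lemma ooint_closed u v f : u <= v -> bmeas u v f -> \int[mu]_(t in `[u, v]) f t = ooint u v f.
Proof.
move=> uv bf; have [mf _] := bf; rewrite /ooint /Rintegral; congr fine.
by rewrite (@integral_itv_bndoo R u v (EFin \o f) true false)//; apply/measurable_EFinP;
  exact: measurable_funTS.
Qed.

Lemma ooint_split u w v f : u <= w -> w <= v -> bmeas u v f -> ooint u v f = ooint u w f + ooint w v f.
Proof.
move=> uw wv bf; have uv := le_trans uw wv.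
have H := @Rintegral_itvB R f (BRight u) (BLeft v) w (bmeas_integrable uv bf).
move: uw; rewrite le_eqVlt => /predU1P[->|uw].
  by rewrite [ooint w w f](_ : _ = 0) ?add0r// /ooint set_itv_ge ?Rintegral_set0// bnd_simp/= ltxx.
move: wv; rewrite le_eqVlt => /predU1P[->|wv].
  by rewrite [ooint v v f](_ : _ = 0) ?addr0// /ooint set_itv_ge ?Rintegral_set0// bnd_simp/= ltxx.
rewrite /ooint -H ?bnd_simp//; last exact: ltW.
rewrite (@Rintegral_itv_bndo_bndc R (BRight u) w); first by rewrite addrC subrK.
by apply: bmeas_integrable; [exact: ltW|apply: bmeas_sub bf => //; exact: ltW].
Qed.

Lemma cvg_ooint u v (F : nat -> R -> R) f C : u <= v ->
  (forall n, measurable_fun setT (F n)) -> measurable_fun setT f ->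
  (forall n t, u < t < v -> `|F n t| <= C) ->
  (forall t, u < t < v -> F n t @[n --> \oo] --> f t) ->
  ooint u v (F n) @[n --> \oo] --> ooint u v f.
Proof.
move=> uv mF mf FC Ff.
have [] := @dominated_convergence _ _ R mu `]u, v[%classic (measurable_itv _)
  (fun n => EFin \o F n) (EFin \o f) (fun=> C%:E).
- by move=> n; apply/measurable_EFinP; apply: measurable_funTS; exact: mF.
- by apply/measurable_EFinP; apply: measurable_funTS; exact: mf.
- apply: aeW => t /=; rewrite in_itv/= => tu; apply/fine_cvgP; split.
    by apply: nearW.
  exact: Ff.
- exact: (bmeas_integrable uv (bmeas_cst u v C)).
- by apply: aeW => t n /=; rewrite in_itv/= => tu; rewrite lee_fin FC.
move=> itf _ cv; rewrite /ooint /Rintegral; apply: fine_cvg.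
rewrite fineK; first exact: cv.
exact: integrable_fin_num.
Qed.

Lemma hasSum_ooint u v (F : nat -> R -> R) f C (a : nat -> R) : u <= v ->
  (forall n, measurable_fun setT (F n)) -> measurable_fun setT f ->
  (forall n, 0 <= a n) -> cvgn (series a) ->
  (forall n t, u < t < v -> `|F n t| <= C * a n) ->
  (forall t, u < t < v -> hasSum (F ^~ t) (f t)) ->
  hasSum (fun n => ooint u v (F n)) (ooint u v f).
Proof.
move=> uv mF mf a0 ca FC Ff.
have bF n : bmeas u v (F n) by split => //; exists (C * a n) => t; exact: FC.
have mS n : measurable_fun setT (fun t => \sum_(0 <= k < n) F k t).
  by apply: measurable_sum.
have bS n t : u < t < v -> `|\sum_(0 <= k < n) F k t| <= `|C| * limn (series a).
  move=> tu; apply: (@le_trans _ _ (`|C| * series a n)).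
    rewrite /series/= mulr_sumr (le_trans (ler_norm_sum _ _ _))//.
    apply: ler_sum => k _; apply: le_trans (FC k t tu) _.
    by rewrite ler_wpM2r// ler_norm.
  by rewrite ler_wpM2l//; exact: (hasSum_ge_part n a0 (cvg_hasSum ca)).
have := cvg_ooint uv mS mf bS Ff.
rewrite /hasSum (_ : (fun n => ooint u v _) = series (fun n => ooint u v (F n)))//.
apply/funext => n; rewrite /series/=; elim: n => [|n IH].
  rewrite big_geq// -[RHS](mul0r (v - u)) -ooint_cst//; apply: ooint_eq => t _; by rewrite big_geq.
rewrite big_nat_recr//= -IH -ooint_D//; last by split => //; exists (`|C| * limn (series a)); exact: bS.
by apply: ooint_eq => t _; rewrite big_nat_recr.
Qed.

End integral.

(** * Frullani's integral *)

Section frullani.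
Context {R : realType}.
Implicit Types (s h t : R).

(* [(1 - t) ^ s] for [t < 1]. *)
Definition onem_pow s t : R := expR (s * ln (1 - t)).

Lemma measurable_ln1B : measurable_fun setT (fun t : R => ln (1 - t)).
Proof.
have mB : measurable_fun setT (fun t : R => 1 - t) by exact: measurable_funB.
exact (measurableT_comp (@measurable_ln R) mB).
Qed.

Lemma measurable_onem_pow s : measurable_fun setT (onem_pow s).
Proof.
have m1 : measurable_fun setT (fun t : R => s * ln (1 - t)).
  by apply: measurable_funM => //; exact: measurable_ln1B.
exact (measurableT_comp (@measurable_expR R) m1).
Qed.

Lemma measurable_div (f g : R -> R) : measurable_fun setT f -> measurable_fun setT g ->
  measurable_fun setT (fun t => f t / g t).
Proof.
move=> mf mg; apply: measurable_funM => //.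
exact (measurableT_comp (@measurable_invr R) mg).
Qed.

Lemma ln1B_le t : 0 < t < 1 -> ln (1 - t) <= - t.
Proof. by move=> /andP[t0 t1]; have := @ln_le_subr1 R (1 - t); rewrite subr_gt0 => /(_ t1); lra. Qed.

Lemma ln1B_lt0 t : 0 < t < 1 -> ln (1 - t) < 0.
Proof. by move=> t01; have := ln1B_le t01; case/andP: t01; lra. Qed.

Lemma onem_pow_gt0 s t : 0 < onem_pow s t. Proof. exact: expR_gt0. Qed.

Lemma onem_powD s h t : onem_pow (s + h) t = onem_pow s t * onem_pow h t.
Proof. by rewrite /onem_pow mulrDl expRD. Qed.

Lemma onem_pow0 t : onem_pow 0 t = 1. Proof. by rewrite /onem_pow mul0r expR0. Qed.

Lemma onem_pow_nat n t : t < 1 -> onem_pow n%:R t = (1 - t) ^+ n.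
Proof. by move=> t1; rewrite /onem_pow expRM_natl lnK// posrE subr_gt0. Qed.

Lemma onem_pow_le1 s t : 0 <= s -> 0 < t < 1 -> onem_pow s t <= 1.
Proof. by move=> s0 /ln1B_lt0/ltW L0; rewrite /onem_pow -[leRHS]expR0 ler_expR mulr_ge0_le0. Qed.

Lemma ooint_onem_pow s : 0 <= s -> ooint 0 1 (onem_pow s) = (s + 1)^-1.
Proof.
rewrite le_eqVlt => /predU1P[<-|s0].
  by rewrite (ooint_eq (g := fun=> 1)) ?ooint_cst//;
    [by rewrite mul1r add0r invr1 subr0|move=> t _; exact: onem_pow0].
have cvg0 (a : R) : 0 < a -> {within `[0, 1], continuous (fun x : R => x `^ a)}.
  move=> a0; apply/continuous_within_itvP; first exact: ltr01.
  split; last 2 first.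
  - by rewrite powR0 ?gt_eqF//; exact: powR_cvg0.
  - apply: cvg_at_left_filter.
    by have /derivable1_diffP/differentiable_continuous := @derivable_powR_pos R a _ (@ltr01 R).
  move=> x; rewrite in_itv/= => /andP[x0 _].
  by have /derivable1_diffP/differentiable_continuous := @derivable_powR_pos R a _ x0.
have e : \int[lebesgue_measure]_(t in `[0, 1]) (t `^ s) = (s + 1)^-1.
  have s1 : s + 1 != 0 by rewrite gt_eqF// addr_gt0.
  have c1 : 0 < s + 1 by lra.
  rewrite /Rintegral (@continuous_FTC2 R _ (fun t => t `^ (s + 1) * (s + 1)^-1) 0 1)//=.
  - by rewrite powR1 powR0// mul0r subr0 mul1r.
  - exact: cvg0.
  - have := cvg0 _ c1 => /(continuous_within_itvP _ ltr01)[_ h0 h1].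
    split.
    + move=> x; rewrite in_itv/= => /andP[x0 _].
      by apply: derivableM => //; exact: derivable_powR_pos.
    + by apply: cvgM => //; exact: cvg_cst.
    + by apply: cvgM => //; exact: cvg_cst.
  - move=> x; rewrite in_itv/= => /andP[x0 _].
    rewrite derive1Mr; last exact: derivable_powR_pos.
    by rewrite powR_derive1 ?in_itv/= ?x0// addrK mulrAC mulfV// mul1r.
have := @Rintegration_by_substitution_onem R (fun x => x `^ s) 1.
rewrite lexx ler01 => /(_ isT (cvg0 _ s0)); rewrite e /unstable.onem subrr => ->.
have ee t : 0 < t < 1 -> (1 - t) `^ s = onem_pow s t.
  by move=> /andP[t0 t1]; rewrite /powR/onem_pow gt_eqF// subr_gt0.
rewrite ooint_closed//; first by apply: ooint_eq => t /ee.
split.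
  have mB : measurable_fun setT (fun t : R => 1 - t) by exact: measurable_funB.
  exact (measurableT_comp (@measurable_powR R s) mB).
by exists 1 => t t01; rewrite ee// gtr0_norm ?onem_pow_gt0// onem_pow_le1// ltW.
Qed.

(** [(1 - t) ^ s] is convex in [s], with derivative [ln (1 - t)] times itself; dividing the tangent
    inequalities at both ends by the negative [ln (1 - t)] reverses them. *)
Lemma onem_pow_slope s h t : 0 < t < 1 -> 
  h * onem_pow (s + h) t <= (onem_pow (s + h) t - onem_pow s t) / ln (1 - t) <= h * onem_pow s t.
Proof.
move=> t01; have L0 := ln1B_lt0 t01; have i0 : (ln (1 - t))^-1 < 0 by rewrite invr_lt0.
apply/andP; split.
  rewrite ler_ndivlMr// onem_powD (_ : _ * _ * _ = onem_pow s t * (h * ln (1 - t) * onem_pow h t));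
    last by ring.
  rewrite -[X in _ - X]mulr1 -mulrBr ler_pM2l ?onem_pow_gt0//.
  have := expR_ge1Dx (- (h * ln (1 - t))); rewrite expRN -/(onem_pow h t) => H.
  have : onem_pow h t * (1 + - (h * ln (1 - t))) <= 1.
    by rewrite -[leRHS](mulfV (lt0r_neq0 (onem_pow_gt0 h t))) (ler_wpM2l (ltW (onem_pow_gt0 h t))).
  by lra.
rewrite ler_ndivrMr// onem_powD (_ : h * _ * _ = onem_pow s t * (h * ln (1 - t))); last by ring.
rewrite -[X in _ <= _ - X]mulr1 -mulrBr ler_pM2l ?onem_pow_gt0//.
by have := expR_ge1Dx (h * ln (1 - t)); rewrite -/(onem_pow h t); lra.
Qed.

(** Frullani's integrand for [ln (1 + s)] after the substitution [expR (- x) = 1 - t]. *)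
Definition frullani_kernel s t : R := (onem_pow s t - 1) / ln (1 - t).

Lemma measurable_frullani_kernel s : measurable_fun setT (frullani_kernel s).
Proof.
by apply: measurable_div; [apply: measurable_funB => //;
  exact: measurable_onem_pow|exact: measurable_ln1B].
Qed.

Lemma frullani_kernel_bound s t : 0 <= s -> 0 < t < 1 -> 0 <= frullani_kernel s t <= s.
Proof.
move=> s0 t01; have := @onem_pow_slope 0 s t t01; rewrite add0r onem_pow0 mulr1 -/(frullani_kernel s t).
move=> /andP[h ->]; rewrite andbT; apply: le_trans h; rewrite mulr_ge0// ltW// onem_pow_gt0//.
Qed.

Lemma bmeas_frullani_kernel s : 0 <= s -> bmeas 0 1 (frullani_kernel s).
Proof.
move=> s0; split; first exact: measurable_frullani_kernel.
by exists s => t t01; have /andP[a b] := frullani_kernel_bound s0 t01; rewrite ger0_norm.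
Qed.

Lemma bmeas_onem_pow s : 0 <= s -> bmeas 0 1 (onem_pow s).
Proof.
move=> s0; split; first exact: measurable_onem_pow.
by exists 1 => t t01; rewrite gtr0_norm ?onem_pow_gt0// onem_pow_le1.
Qed.

(* Used with the difference of the two sides of Frullani's formula, whose increments are
   [O(h ^ 2)]. *)
Lemma const_of_square (D : R -> R) : (forall s h, 0 <= s -> 0 <= h -> `|D (s + h) - D s| <= h ^+ 2) ->
  forall s, 0 <= s -> D s = D 0.
Proof.
move=> HD s s0; apply/eqP; rewrite -subr_eq0 -normr_le0.
have step n k : `|D (k%:R * (s / n.+1%:R)) - D 0| <= k%:R * (s / n.+1%:R) ^+ 2.
  elim: k => [|k IH]; first by rewrite !mul0r subrr normr0.
  have h0 : 0 <= s / n.+1%:R by rewrite divr_ge0.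
  have := HD (k%:R * (s / n.+1%:R)) _ (mulr_ge0 (ler0n _ _) h0) h0.
  have -> : k%:R * (s / n.+1%:R) + s / n.+1%:R = k.+1%:R * (s / n.+1%:R).
    by rewrite -[k.+1]addn1 natrD; ring.
  move=> H; have := ler_normD (D (k.+1%:R * (s / n.+1%:R)) - D (k%:R * (s / n.+1%:R))) (D (k%:R *
    (s / n.+1%:R)) - D 0).
  rewrite addrA subrK => H'; apply: le_trans H' _.
  by rewrite -[in leRHS]natr1 [in leRHS]mulrDl mul1r [leRHS]addrC lerD.
have lim : (s ^+ 2 * n.+1%:R^-1) @[n --> \oo] --> (0 : R).
  by rewrite -[X in _ --> X](mulr0 (s ^+ 2)); apply: cvgM; [exact: cvg_cst|exact: cvg_harmonic].
apply: (ler_cvg_to (cvg_cst `|D s - D 0|) lim); apply: nearW => n.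
have := step n n.+1; have n0 : n.+1%:R != 0 :> R by rewrite pnatr_eq0.
by move: n0; move: n.+1%:R => k k0; rewrite mulrC divfK// (_ : _ * _ = s ^+ 2 / k)//; field.
Qed.

Lemma ln_slope s h : 0 <= s -> 0 <= h ->
  h / (s + h + 1) <= ln (1 + (s + h)) - ln (1 + s) <= h / (s + 1).
Proof.
move=> s0 h0; have c1 : 0 < 1 + s by lra.
have c2 : 0 < 1 + (s + h) by lra.
have n1 : 1 + s != 0 by rewrite gt_eqF.
have n2 : 1 + (s + h) != 0 by rewrite gt_eqF.
apply/andP; split.
  rewrite -[leRHS]opprB -ln_div ?posrE// lerNr.
  apply: le_trans (ln_le_subr1 (divr_gt0 c1 c2)) _.
  by rewrite le_eqVlt; apply/orP; left; apply/eqP; field; lra.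
rewrite -ln_div ?posrE//; apply: le_trans (ln_le_subr1 (divr_gt0 c2 c1)) _.
by rewrite le_eqVlt; apply/orP; left; apply/eqP; field; lra.
Qed.

Lemma slope_gap s h : 0 <= s -> 0 <= h -> h / (s + 1) - h / (s + h + 1) <= h ^+ 2.
Proof.
move=> s0 h0; have c1 : 0 < s + 1 by lra.
have c2 : 0 < s + h + 1 by lra.
rewrite (_ : _ - _ = h ^+ 2 / ((s + 1) * (s + h + 1))); last by field; rewrite !gt_eqF.
by rewrite ler_pdivrMr ?mulr_gt0// ler_peMr ?sqr_ge0//; nra.
Qed.

(** Over an increment [h] both sides grow by an amount between [h / (s + h + 1)] and [h / (s + 1)],
    by integrating [onem_pow_slope] and by [ln_slope]; this replaces differentiation under the
    integral. *)
Lemma frullani s : 0 <= s -> ooint 0 1 (frullani_kernel s) = ln (1 + s).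
Proof.
pose D s := ooint 0 1 (frullani_kernel s) - ln (1 + s).
move=> s0; apply/eqP; rewrite -subr_eq0 -/(D s) (@const_of_square D)//.
  rewrite /D addr0 ln1 subr0 (ooint_eq (g := fun=> 0)); first by rewrite ooint_cst// mul0r.
  by move=> t _; rewrite /frullani_kernel onem_pow0 subrr mul0r.
move=> {s0} {}s h s0 h0.
have sh0 : 0 <= s + h by lra.
have e : ooint 0 1 (frullani_kernel (s + h)) - ooint 0 1 (frullani_kernel s) = ooint 0 1 (fun t =>
  frullani_kernel (s + h) t - frullani_kernel s t).
  by rewrite ooint_B//; exact: bmeas_frullani_kernel.
have up : ooint 0 1 (frullani_kernel (s + h)) - ooint 0 1 (frullani_kernel s) <= h / (s + 1).
  rewrite e -ooint_onem_pow// -ooint_Z//; last exact: bmeas_onem_pow.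
  apply: ooint_le => //; [by apply: bmeasB; exact: bmeas_frullani_kernel|by apply: bmeasZ;
    exact: bmeas_onem_pow|].
  move=> t t01; have /andP[_] := @onem_pow_slope s h t t01.
  by rewrite /frullani_kernel -mulrBl; congr (_ <= _); congr (_ * _); ring.
have lo : h / (s + h + 1) <= ooint 0 1 (frullani_kernel (s + h)) - ooint 0 1 (frullani_kernel s).
  rewrite e -ooint_onem_pow// -ooint_Z//; last exact: bmeas_onem_pow.
  apply: ooint_le => //; [by apply: bmeasZ; exact: bmeas_onem_pow|by apply: bmeasB;
    exact: bmeas_frullani_kernel|].
  move=> t t01; have /andP[+ _] := @onem_pow_slope s h t t01.
  by rewrite /frullani_kernel -mulrBl; congr (_ <= _); congr (_ * _); ring.
have /andP[llo lup] := ln_slope s0 h0.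
have gap := slope_gap s0 h0.
rewrite ler_norml /D; move: up lo lup llo gap; clear.
move: (_ / _) (_ / _) (ooint _ _ _) (ooint _ _ _) (ln _) (ln _) (h ^+ 2) => x y i1 i2 l1 l2 g; lra.
Qed.

End frullani.

(** * Second-order estimates at the singularity of the denominator *)

(** As [|1 - v| <= 1], the errors of the successive steps add up without amplification. *)
Lemma expr1B_approx (R : realFieldType) (v : R) y : 0 <= v <= 2 ->
  `|(1 - v) ^+ y - 1 + y%:R * v| <= y%:R ^+ 2 * v ^+ 2.
Proof.
move=> /andP[v0 v2]; elim: y => [|y IH]; first by rewrite expr0 subrr mul0r add0r normr0 expr0n mul0r.
have -> : (1 - v) ^+ y.+1 - 1 + y.+1%:R * v =
    (1 - v) * ((1 - v) ^+ y - 1 + y%:R * v) + y%:R * v ^+ 2.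
  by rewrite exprS -natr1; ring.
apply: le_trans (ler_normD _ _) _; rewrite normrM.
have v1 : `|1 - v| <= 1 by rewrite ler_norml; apply/andP; split; lra.
rewrite [X in _ + X]ger0_norm ?mulr_ge0 ?sqr_ge0//.
apply: (@le_trans _ _ (y%:R ^+ 2 * v ^+ 2 + y%:R * v ^+ 2)).
  by rewrite lerD2r -[leRHS]mul1r; apply: ler_pM.
rewrite -mulrDl ler_wpM2r ?sqr_ge0// -natr1.
by have := ler0n R y; nra.
Qed.

(** Since [- ln (1 - t) >= t], the denominator is at least [t ^+ 2] in absolute value. *)
Lemma div_ln1B_le (R : realType) (n C t : R) : 0 < t < 1 -> `|n| <= C * t ^+ 2 ->
  `|n / (t * ln (1 - t))| <= C.
Proof.
move=> t01 H; have L0 := ln1B_lt0 t01; have L1 := ln1B_le t01; case/andP: t01 => t0 t1.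
rewrite normrM normfV normrM (gtr0_norm t0) (ltr0_norm L0) ler_pdivrMr;
  last by rewrite mulr_gt0// oppr_gt0.
have C0 : 0 <= C by have := le_trans (normr_ge0 n) H; rewrite pmulr_lge0// exprn_gt0.
apply: le_trans H _; by rewrite ler_wpM2l// expr2 ler_pM2l// lerNr.
Qed.

(** The algebra of [Lambda_kernel_bound]: [T] is [tau t], [u] is [t * T], [z] is [y * k], and [E] is
    the remainder of [expr1B_approx]. *)
Lemma num_bound (R : realFieldType) (T u z E : R) : 0 <= T -> 0 <= u -> u <= T ^+ 2 ->
  0 <= z -> `|E| <= z ^+ 2 * T ^+ 2 ->
  `|- u + z * u + z * T ^+ 2 - E * (1 + T)| <= T ^+ 2 * (1 + z) ^+ 2 * (1 + T).
Proof.
move=> T0 u0 uT z0; rewrite ler_norml => /andP[El Eu].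
have T1 : 0 <= 1 + T by rewrite addr_ge0.
have h1 := ler_wpM2r T1 El; have h2 := ler_wpM2r T1 Eu.
have h3 := ler_wpM2l z0 uT; have h4 := mulr_ge0 z0 u0.
have h5 : 0 <= T ^+ 2 * (1 + (1 + 2 * z) * T) by rewrite mulr_ge0 ?sqr_ge0// addr_ge0 ?mulr_ge0
  ?addr_ge0 ?mulr_ge0.
have h6 : 0 <= z * T ^+ 2 by rewrite mulr_ge0 ?sqr_ge0.
have e : T ^+ 2 * (1 + z) ^+ 2 * (1 + T) =
  z ^+ 2 * T ^+ 2 * (1 + T) + 2 * (z * T ^+ 2) + T ^+ 2 * (1 + (1 + 2 * z) * T) by ring.
have h7 : T ^+ 2 <= T ^+ 2 * (1 + (1 + 2 * z) * T).
  by rewrite ler_peMr ?sqr_ge0// lerDl !mulr_ge0// addr_ge0// mulr_ge0.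
rewrite ler_norml e; rewrite mulNr in h1; move: h1 h2 h3 h4 h5 h6 h7 u0 uT; clear.
move: (T ^+ 2) (T ^+ 2 * _) (z * u) (z * T ^+ 2) (z ^+ 2 * _ * _) (E * _) => *; apply/andP; split; lra.
Qed.

(** * The weight of part (2) *)

Section part2.
Variables (R : realType) (p : R).
Hypotheses (p0 : 0 < p) (p1 : p < 1).
Local Notation d := (1 - p).
Local Notation c := (2 * p / (1 + 2 * p)).
Local Notation om := (1 + 2 * p).

(** The points where the generating function of [nb p 1] equals [1 - t] and, for [s2],
    [(1 - t) (1 - p) / (1 - p (1 - t))]. Both are affine in [tau t]. *)
Definition s1 (t : R) := (p - t) / (p * (1 - t)).
Definition s2 (t : R) := (p - t * (1 + p)) / (p * (1 - t)).
Definition tau (t : R) := t / (1 - t).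

Let om0 : 0 < om. Proof. by have := p0; lra. Qed.

Let c0 : 0 < c. Proof. by rewrite divr_gt0 ?mulr_gt0. Qed.

Let c1 : c < 1. Proof. by rewrite ltr_pdivrMr//; have := p0; lra. Qed.

Lemma lt_c t : 0 < t < c -> [/\ 0 < t, 0 < 1 - t, 0 < t < 1 & (1 - t)^-1 <= om].
Proof.
move=> /andP[t0 tc]; have t1 := lt_trans tc c1.
split=> //; [by rewrite subr_gt0|by rewrite t0|].
rewrite invf_ple ?posrE ?subr_gt0// lerBrDr -lerBrDl.
have -> : 1 - om^-1 = c by field; rewrite gt_eqF.
exact: ltW.
Qed.

Lemma tau_bounds t : 0 < t < c -> [/\ t <= tau t, tau t <= om * t & tau t <= 2 * p].
Proof.
move=> /lt_c[t0 t1 _ to]; have te : tau t = t * (1 - t)^-1 by [].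
split.
- by rewrite te ler_peMr ?(ltW t0)// -[leLHS]invr1 lef_pV2 ?posrE//; lra.
- by rewrite te mulrC ler_pM2r.
- have -> : tau t = (1 - t)^-1 - 1 by rewrite te; field; rewrite gt_eqF.
  by lra.
Qed.

Lemma s1E t : t < 1 -> s1 t = 1 - (1 - p) / p * tau t.
Proof.
by move=> t1; rewrite /s1 /tau; field; rewrite [p == 0]gt_eqF// andbT gt_eqF// subr_gt0.
Qed.

Lemma s2E t : t < 1 -> s2 t = 1 - p^-1 * tau t.
Proof.
by move=> t1; rewrite /s2 /tau; field; rewrite [p == 0]gt_eqF// andbT gt_eqF// subr_gt0.
Qed.

Lemma ktau_bounds t : 0 < t < c ->
  0 <= (1 - p) / p * tau t <= 2 /\ 0 <= p^-1 * tau t <= 2.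
Proof.
move=> tc; have [t0 _ _ _] := lt_c tc; have [t2 _ t3] := tau_bounds tc.
have T0 : 0 <= tau t by rewrite (le_trans (ltW t0)).
have d0 : 0 <= 1 - p by rewrite subr_ge0 ltW.
have i0 : 0 <= p^-1 by rewrite invr_ge0 ltW.
have h : p^-1 * tau t <= 2 by rewrite ler_pdivrMl// mulrC.
move: (tau t) T0 h => T T0 h; split; apply/andP; split; rewrite ?mulr_ge0//.
by apply: le_trans h; rewrite -mulrA ler_piMl ?mulr_ge0// gerBl ltW.
Qed.

Lemma s_le1 t : 0 < t < c -> `|s1 t| <= 1 /\ `|s2 t| <= 1.
Proof.
move=> tc; have [_ _ /andP[_ t1] _] := lt_c tc; have [] := ktau_bounds tc.
rewrite s1E// s2E//; move: (_ * _) (_ * _) => u v /andP[? ?] /andP[? ?].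
by split; rewrite ler_norml; apply/andP; split; lra.
Qed.

Definition Lambda_kernel (k : R) (y : nat) (t : R) : R :=
  (1 + t - t * y%:R * k - (1 - k * tau t) ^+ y / (1 - t)) / (t * ln (1 - t)).

(** [1 + t - t * y * k] is the first-order expansion at 0 of the term subtracted from it, so the
    numerator is of order [t ^+ 2], with a constant quadratic in [y]. *)
Lemma Lambda_kernel_bound k y t : 0 < t < c -> 0 <= k * tau t <= 2 -> 0 <= k ->
  `|Lambda_kernel k y t| <= om ^+ 3 * (1 + k) ^+ 2 * y.+1%:R ^+ 2.
Proof.
move=> tc kt k0; have [t0 t1 t01 to] := lt_c tc; have [tt1 tt2 _] := tau_bounds tc.
apply: div_ln1B_le => //.
have H := expr1B_approx y kt.
set T := tau t in tt1 tt2 H *; set E := _ - 1 + _ in H.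
have tE : t = T / (1 + T).
  have -> : 1 + T = (1 - t)^-1 by rewrite /T/tau; field; rewrite gt_eqF.
  by rewrite invrK /T/tau divfK// gt_eqF.
have t1E : (1 - t)^-1 = 1 + T by rewrite /T/tau; field; rewrite gt_eqF.
have T0 : 0 <= T by rewrite (le_trans (ltW t0)).
have -> : (1 - k * T) ^+ y = E + 1 - y%:R * (k * T) by rewrite /E; ring.
rewrite t1E.
have -> : 1 + t - t * y%:R * k - (E + 1 - y%:R * (k * T)) * (1 + T) =
   - (t * T) + y%:R * k * (t * T) + y%:R * k * T ^+ 2 - E * (1 + T).
  by rewrite tE; field; rewrite gt_eqF// ltr_pwDl.
have To : 1 + T <= om by rewrite -t1E.
have tT : t * T <= T ^+ 2 by rewrite expr2 ler_wpM2r.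
have y0 : 0 <= y%:R * k by rewrite mulr_ge0.
have EE : `|E| <= (y%:R * k) ^+ 2 * T ^+ 2.
  by apply: (le_trans H); rewrite -!exprMn mulrA.
have key := num_bound T0 (mulr_ge0 (ltW t0) T0) tT y0 EE.
apply: le_trans key _.
have T2 : T ^+ 2 <= om ^+ 2 * t ^+ 2 by rewrite -exprMn lerXn2r// nnegrE// mulr_ge0 ?(ltW t0) ?(ltW om0).
have yk : (1 + y%:R * k) ^+ 2 <= (1 + k) ^+ 2 * y.+1%:R ^+ 2.
  rewrite -exprMn lerXn2r// ?nnegrE ?addr_ge0 ?mulr_ge0 ?addr_ge0// -natr1.
  by rewrite (_ : (1 + k) * _ = 1 + y%:R * k + (k + y%:R)) ?lerDl ?addr_ge0//; ring.
apply: (@le_trans _ _ (om ^+ 2 * t ^+ 2 * ((1 + k) ^+ 2 * y.+1%:R ^+ 2) * om)).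
  have a1 := sqr_ge0 T; have a2 := sqr_ge0 (1 + y%:R * k).
  exact: ler_pM (mulr_ge0 a1 a2) (addr_ge0 ler01 T0) (ler_pM a1 a2 T2 yk) To.
by rewrite le_eqVlt; apply/orP; left; apply/eqP; ring.
Qed.

Lemma measurable_1B : measurable_fun setT (fun t : R => 1 - t).
Proof. exact: measurable_funB. Qed.

Lemma measurable_den : measurable_fun setT (fun t : R => t * ln (1 - t)).
Proof. by apply: measurable_funM => //; exact: measurable_ln1B. Qed.

Lemma measurable_tau : measurable_fun setT tau.
Proof. by apply: measurable_div => //; exact: measurable_1B. Qed.

Lemma measurable_Lambda_kernel k y : measurable_fun setT (Lambda_kernel k y).
Proof.
apply: measurable_div; last exact: measurable_den.
apply: measurable_funB.
  apply: measurable_funB; first exact: measurable_funD.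
  by do 2 apply: measurable_funM => //.
apply: measurable_div; last exact: measurable_1B.
apply: measurable_funX; apply: measurable_funB => //; apply: measurable_funM => //.
exact: measurable_tau.
Qed.

Lemma bmeas_Lambda_kernel k y : 0 <= k -> (forall t, 0 < t < c -> 0 <= k * tau t <= 2) -> bmeas 0 c
  (Lambda_kernel k y).
Proof.
move=> k0 H; split; first exact: measurable_Lambda_kernel.
by exists (om ^+ 3 * (1 + k) ^+ 2 * y.+1%:R ^+ 2) => t tc; apply: Lambda_kernel_bound => //; exact: H.
Qed.

Let b0 : 0 <= d / p. Proof. by rewrite divr_ge0 ?subr_ge0 ?ltW. Qed.

Let a0 : 0 <= p^-1. Proof. by rewrite invr_ge0 ltW. Qed.

Lemma bmeas_Lambda_kernel1 y : bmeas 0 c (Lambda_kernel (d / p) y).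
Proof. by apply: bmeas_Lambda_kernel => // t /ktau_bounds[]. Qed.

Lemma bmeas_Lambda_kernel2 y : bmeas 0 c (Lambda_kernel p^-1 y).
Proof. by apply: bmeas_Lambda_kernel => // t /ktau_bounds[]. Qed.

Lemma Lambda_closed (k : R) (s : R -> R) (y : nat) : bmeas 0 c (Lambda_kernel k y) ->
  (forall t, t < 1 -> s t = 1 - k * tau t) ->
  \int[lebesgue_measure]_(t in `[0, c])
    ((1 + t - t * y%:R * k - s t ^+ y / (1 - t)) / (t * ln (1 - t))) = ooint 0 c (Lambda_kernel k y).
Proof.
move=> bl sE; rewrite -ooint_closed//; last exact: ltW.
apply: eq_Rintegral => t; rewrite inE/= in_itv/= => /andP[_ tc].
by rewrite /Lambda_kernel sE// (le_lt_trans tc).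
Qed.

Lemma Lambda1E y : Lambda1 p y = ooint 0 c (Lambda_kernel (d / p) y).
Proof.
rewrite -(@Lambda_closed _ s1); [|exact: bmeas_Lambda_kernel1|exact: s1E].
by apply: eq_Rintegral => t _; rewrite mulrA.
Qed.

Lemma Lambda2E y : Lambda2 p y = ooint 0 c (Lambda_kernel p^-1 y).
Proof. by rewrite -(@Lambda_closed _ s2); [|exact: bmeas_Lambda_kernel2|exact: s2E]. Qed.

Lemma bmeas_Linv : bmeas c 1 (fun t => (ln (1 - t))^-1).
Proof.
split; first exact: (measurableT_comp (@measurable_invr R) measurable_ln1B).
exists c^-1 => t /andP[ct t1]; have t01 : 0 < t < 1 by rewrite (lt_trans c0 ct).
have := ln1B_le t01; have := ln1B_lt0 t01; move: (ln _) => L L0 Lt.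
rewrite normfV ltr0_norm// lef_pV2 ?posrE ?oppr_gt0//; move: c0 ct; lra.
Qed.

Lemma LiE : Li (1 / om) = ooint c 1 (fun t => (ln (1 - t))^-1).
Proof.
have o1 : 0 < 1 / om by rewrite divr_gt0.
have o2 : 1 / om < 1 by rewrite ltr_pdivrMr// mul1r; have := p0; lra.
rewrite /Li Rintegration_by_substitution_onem.
- rewrite /unstable.onem -ooint_closed; [|exact: ltW|exact: bmeas_Linv].
  by have -> : 1 - 1 / om = c by field; rewrite gt_eqF.
- by rewrite !ltW.
have cV (t : R) : 0 < t < 1 -> (ln z)^-1 @[z --> t] --> (ln t)^-1.
  move=> /andP[t0 t1]; have L0 : ln t < 0 by rewrite ln_lt0// t0.
  apply: cvgV; first by rewrite lt_eqF.
  exact: continuous_ln.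
apply/continuous_within_itvP => //; split.
- by move=> t; rewrite in_itv/= => /andP[t0 t1]; apply: cV; rewrite t0 (lt_trans t1).
(* [ln 0] and [0^-1] are 0 by default, which is also the limit of [1 / ln t] at 0. *)
- rewrite ln0// invr0; apply/cvgrPdist_lt => e e0.
  have H : \forall t \near 0^'+, ln t < - e^-1 by have /cvgrNyPlt := @lnNy R; exact.
  near=> t; have Lt : ln t < - e^-1 by near: t.
  have L0 : ln t < 0 by apply: lt_trans Lt _; rewrite oppr_lt0 invr_gt0.
  by rewrite sub0r normrN normfV invf_plt ?posrE ?normr_gt0 ?lt_eqF// ltr0_norm// ltrNr.
- by apply: cvg_at_left_filter; apply: cV; rewrite o1.
Unshelve. all: end_near. Qed.

(* The integrands, left and right of [c], of [Lambda_exponent y] minus the Frullani integral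
   of [\sum_(j < y) ln (r + j)]. *)
Definition gap_near (r : R) (y : nat) (t : R) : R :=
  (s1 t ^+ y / (1 - t) - s2 t ^+ y / (1 - t) - onem_pow (r - 1) t + onem_pow (r - 1 + y%:R) t)
   / (t * ln (1 - t)).

Definition gap_far (r : R) (y : nat) (t : R) : R :=
  - (onem_pow (r - 1) t - onem_pow (r - 1 + y%:R) t) / (t * ln (1 - t)).

Definition ln_sum_kernel (r : R) (y : nat) (t : R) : R := \sum_(0 <= j < y) frullani_kernel (r - 1
  + j%:R) t.

(** A geometric sum of ratio [1 - t], which brings the denominator [t]. *)
Lemma ln_sum_kernel_closed r y t : 0 < t < 1 ->
  ln_sum_kernel r y t = (onem_pow (r - 1) t - onem_pow (r - 1 + y%:R) t - t * y%:R) / (t * ln (1 - t)).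
Proof.
move=> t01; have L0 := ln1B_lt0 t01; case/andP: t01 => t0 t1; rewrite /ln_sum_kernel.
elim: y => [|y IH]; first by rewrite big_geq// addr0 subrr mulr0 subrr mul0r.
rewrite big_nat_recr//= IH /frullani_kernel.
have -> : onem_pow (r - 1 + y.+1%:R) t = onem_pow (r - 1 + y%:R) t * (1 - t).
  by have h1 : onem_pow 1 t = 1 - t := onem_pow_nat 1 t1;
    rewrite -[y.+1%:R]natr1 addrA (@onem_powD R (r - 1 + y%:R) 1 t) h1.
by rewrite -natr1; field; rewrite (gt_eqF t0) (lt_eqF L0).
Qed.

Lemma bmeas_ln_sum_kernel r y : 1 <= r -> bmeas 0 1 (ln_sum_kernel r y).
Proof.
move=> r1; rewrite /ln_sum_kernel; elim: y => [|y IH].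
  by under eq_fun do rewrite big_geq//; exact: bmeas_cst.
under eq_fun do rewrite big_nat_recr//=; apply: bmeasD => //; apply: bmeas_frullani_kernel.
by rewrite addr_ge0// subr_ge0.
Qed.

Lemma ln_sum_kernel_bound r y t : 1 <= r -> 0 < t < 1 -> `|ln_sum_kernel r y t| <= r * y.+1%:R ^+ 2.
Proof.
move=> r1 t01; rewrite /ln_sum_kernel.
have kb (j : nat) : 0 <= frullani_kernel (r - 1 + j%:R) t <= r - 1 + j%:R.
  by apply: frullani_kernel_bound => //; rewrite addr_ge0// subr_ge0.
rewrite ger0_norm; last by apply: sumr_ge0 => j _; have /andP[] := kb j.
apply: (@le_trans _ _ (\sum_(0 <= j < y) (r * y.+1%:R))).
  rewrite big_nat_cond [leRHS]big_nat_cond; apply: ler_sum => j; rewrite andbT => /andP[_ jy].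
  have /andP[_ h] := kb j; apply: le_trans h _.
  have jy' : j%:R <= y%:R :> R by rewrite ler_nat ltnW.
  by have := ler0n R y; rewrite -natr1; nra.
rewrite sumr_const_nat subn0 -[leLHS]mulr_natr -mulrA; apply: ler_wpM2l; first by lra.
by rewrite expr2 ler_wpM2l// ler_nat.
Qed.

Lemma ooint_ln_sum_kernel r y : 1 <= r -> ooint 0 1 (ln_sum_kernel r y) = \sum_(0 <= j < y) ln (r +
  j%:R).
Proof.
move=> r1; elim: y => [|y IH].
  rewrite big_geq// (ooint_eq (g := fun=> 0)) ?ooint_cst ?mul0r// => t _; exact: big_geq.
rewrite big_nat_recr//= -IH -[ln _](_ : ooint 0 1 (frullani_kernel (r - 1 + y%:R)) = _); last first.
  have -> : r + y%:R = 1 + (r - 1 + y%:R) by ring.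
  by apply: frullani; rewrite addr_ge0 ?subr_ge0.
rewrite -ooint_D//; [|exact: bmeas_ln_sum_kernel|by apply: bmeas_frullani_kernel;
  rewrite addr_ge0 ?subr_ge0].
by apply: ooint_eq => t _; rewrite /ln_sum_kernel big_nat_recr.
Qed.

Definition Lambda_exponent (y : nat) := Lambda2 p y - Lambda1 p y - y%:R * Li (1 / om).

Lemma gap_nearE r y t : 0 < t < c -> gap_near r y t = Lambda_kernel p^-1 y t - Lambda_kernel (d /
  p) y t - ln_sum_kernel r y t.
Proof.
move=> tc; have [t0 t1 t01 _] := lt_c tc; have L0 := ln1B_lt0 t01.
rewrite ln_sum_kernel_closed// /gap_near /Lambda_kernel s1E ?s2E; [|by case/andP: t01|by case/andP: t01].
move: (_ ^+ y) (_ ^+ y) (onem_pow _ _) (onem_pow _ _) => X Y Z W.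
by field; rewrite ?(gt_eqF t0) ?(gt_eqF t1) ?(gt_eqF p0) ?(lt_eqF L0).
Qed.

Lemma gap_farE r y t : c < t < 1 -> gap_far r y t = - y%:R * (ln (1 - t))^-1 - ln_sum_kernel r y t.
Proof.
move=> /andP[ct t1]; have t0 := lt_trans c0 ct.
have t01 : 0 < t < 1 by rewrite t0.
have L0 := ln1B_lt0 t01; rewrite ln_sum_kernel_closed// /gap_far.
by field; rewrite (gt_eqF t0) (lt_eqF L0).
Qed.

(** The parameter [r] is free: [r = m] gives the average under [nb p m], and [r = y (1 - p) / p] the
    growth of the weight. *)
Lemma Lambda_exponent_sub r y : 1 <= r ->
  Lambda_exponent y - \sum_(0 <= j < y) ln (r + j%:R) = ooint 0 c (gap_near r y) + ooint c 1
    (gap_far r y).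
Proof.
move=> r1; have bk := bmeas_ln_sum_kernel y r1.
rewrite /Lambda_exponent Lambda1E Lambda2E LiE -ooint_ln_sum_kernel// (ooint_split (ltW c0) (ltW c1) bk).
have bk1 : bmeas 0 c (ln_sum_kernel r y) by exact: bmeas_sub (lexx _) (ltW c1) bk.
have bk2 : bmeas c 1 (ln_sum_kernel r y) by exact: bmeas_sub (ltW c0) (lexx _) bk.
rewrite (ooint_eq (@gap_nearE r y)) ooint_B; [|exact: ltW|by apply: bmeasB;
  [exact: bmeas_Lambda_kernel2|exact: bmeas_Lambda_kernel1]|exact: bk1].
rewrite ooint_B; [|exact: ltW|exact: bmeas_Lambda_kernel2|exact: bmeas_Lambda_kernel1].
rewrite (ooint_eq (@gap_farE r y)) ooint_B; [|exact: ltW|by apply: bmeasZ; exact: bmeas_Linv|exact: bk2].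
by rewrite ooint_Z; [ring|exact: ltW|exact: bmeas_Linv].
Qed.

Let d0 : 0 < d. Proof. by rewrite subr_gt0. Qed.

Lemma measurable_gap_near r y : measurable_fun setT (gap_near r y).
Proof.
have ms1 : measurable_fun setT s1.
  apply: measurable_div; first exact: measurable_funB.
  by apply: measurable_funM => //; exact: measurable_1B.
have ms2 : measurable_fun setT s2.
  apply: measurable_div; first by apply: measurable_funB => //; exact: measurable_funM.
  by apply: measurable_funM => //; exact: measurable_1B.
apply: measurable_div; last exact: measurable_den.
apply: measurable_funD; last exact: measurable_onem_pow.
apply: measurable_funB; last exact: measurable_onem_pow.
by apply: measurable_funB; apply: measurable_div;
  [exact: measurable_funX|exact: measurable_1B|exact: measurable_funX|exact: measurable_1B].
Qed.

Lemma measurable_gap_far r y : measurable_fun setT (gap_far r y).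
Proof.
apply: measurable_div; last exact: measurable_den.
apply: measurableT_comp; first exact: measurable_funN.
by apply: measurable_funB; exact: measurable_onem_pow.
Qed.

Lemma gap_near_bound r y t : 1 <= r -> 0 < t < c -> `|gap_near r y t| <=
  (om ^+ 3 * (1 + p^-1) ^+ 2 + om ^+ 3 * (1 + d / p) ^+ 2 + r) * y.+1%:R ^+ 2.
Proof.
move=> r1 tc; have [_ _ t01 _] := lt_c tc; have [k1 k2] := ktau_bounds tc.
rewrite gap_nearE// [leRHS]mulrDl [X in _ <= X + _]mulrDl; apply: le_trans (ler_normB _ _) _;
  apply: lerD; last exact: ln_sum_kernel_bound.
by apply: le_trans (ler_normB _ _) _; apply: lerD; exact: Lambda_kernel_bound.
Qed.

Lemma gap_far_bound r y t : 1 <= r -> c < t < 1 -> `|gap_far r y t| <= c ^- 2.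
Proof.
move=> r1 /andP[ct t1]; have t0 := lt_trans c0 ct; have t01 : 0 < t < 1 by rewrite t0.
apply: div_ln1B_le => //; apply: (@le_trans _ _ 1).
  have h1 := @onem_pow_le1 R (r - 1) t _ t01; have h2 := @onem_pow_le1 R (r - 1 + y%:R) t _ t01.
  rewrite normrN ler_norml; have := onem_pow_gt0 (r - 1) t; have := onem_pow_gt0 (r - 1 + y%:R) t.
  have r0 : 0 <= r - 1 by rewrite subr_ge0.
  have := h1 r0; have := h2 (addr_ge0 r0 (ler0n _ _)).
  by move: (onem_pow _ _) (onem_pow _ _) => u v *; apply/andP; split; lra.
by rewrite mulrC ler_pdivlMr ?exprn_gt0// mul1r lerXn2r ?nnegrE ?ltW.
Qed.

Lemma bmeas_gap_near r y : 1 <= r -> bmeas 0 c (gap_near r y).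
Proof.
move=> r1; split; first exact: measurable_gap_near.
by eexists => t tc; exact: gap_near_bound r1 tc.
Qed.

Lemma bmeas_gap_far r y : 1 <= r -> bmeas c 1 (gap_far r y).
Proof.
move=> r1; split; first exact: measurable_gap_far.
by exists (c ^- 2) => t tc; exact: gap_far_bound r1 tc.
Qed.

Lemma sum_nb_onem_pow m t : (0 < m)%N -> 0 < t < 1 ->
  hasSum (fun k => nb p m k * onem_pow (m%:R - 1 + k%:R) t)
    ((1 - t) ^+ m.-1 * (d / (1 - p * (1 - t))) ^+ m).
Proof.
move=> m0 /andP[t0 t1]; have t1' : 0 < 1 - t by rewrite subr_gt0.
have := hasSumZ ((1 - t) ^+ m.-1) (nb_pgf p0 p1 m0 (s := 1 - t) _).
rewrite gtr0_norm// gerBl (ltW t0) => /(_ isT); apply: eq_hasSum => k.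
rewrite onem_powD onem_pow_nat// (_ : m%:R - 1 = m.-1%:R) ?onem_pow_nat//;
  last by rewrite -{1}(prednK m0) -natr1 addrK.
by ring.
Qed.

Lemma sum_nb_onem_pow1 m t : (0 < m)%N -> 0 < t < 1 ->
  hasSum (fun k => nb p m k * onem_pow (m%:R - 1) t) ((1 - t) ^+ m.-1).
Proof.
move=> m0 /andP[t0 t1].
have := hasSumZ ((1 - t) ^+ m.-1) (nb_sum p0 p1 m0); rewrite mulr1; apply: eq_hasSum => k.
by rewrite (_ : m%:R - 1 = m.-1%:R) ?onem_pow_nat// 1?mulrC// -{1}(prednK m0) -natr1 addrK.
Qed.

(** By the choice of [s1] and [s2] the four averages cancel in pairs: that of [s1] with
    [onem_pow (m - 1)], that of [s2] with [onem_pow (m - 1 + k)]. *)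
Lemma sum_nb_gap_near m t : (0 < m)%N -> 0 < t < c -> hasSum (fun k => nb p m k * gap_near m%:R k t) 0.
Proof.
move=> m0 tc; have [t0 t1 t01 _] := lt_c tc; have [h1 h2] := s_le1 tc.
have L0 := ln1B_lt0 t01.
have q0 : 0 < 1 - p * (1 - t) by have := p0; have := p1; nra.
have S1 := hasSumZ (1 - t)^-1 (nb_pgf p0 p1 m0 h1).
have S2 := hasSumZ (1 - t)^-1 (nb_pgf p0 p1 m0 h2).
have := hasSumZ (t * ln (1 - t))^-1
  (hasSumD (hasSumB (hasSumB S1 S2) (sum_nb_onem_pow1 m0 t01)) (sum_nb_onem_pow m0 t01)).
have e1 : (1 - p) / (1 - p * s1 t) = 1 - t.
  have -> : 1 - p * s1 t = d / (1 - t) by rewrite /s1; field; rewrite !gt_eqF.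
  by field; rewrite !gt_eqF.
have e2 : (1 - p) / (1 - p * s2 t) = (1 - t) * (d / (1 - p * (1 - t))).
  have -> : 1 - p * s2 t = (1 - p * (1 - t)) / (1 - t) by rewrite /s2; field; rewrite !gt_eqF.
  by field; rewrite !gt_eqF.
rewrite e1 e2 exprMn (_ : (1 - t) ^+ m = (1 - t) * (1 - t) ^+ m.-1); last by rewrite -exprS prednK.
rewrite [X in hasSum _ X](_ : _ = 0); last by field; rewrite ?(gt_eqF t0) ?(gt_eqF t1) ?(lt_eqF L0).
apply: eq_hasSum => k; rewrite /gap_near.
by move: (nb p m k) (_ ^+ k) (_ ^+ k) (onem_pow _ _) (onem_pow _ _) => *; ring.
Qed.

Lemma sum_nb_gap_far m t : (0 < m)%N -> c < t < 1 -> hasSum (fun k => nb p m k * gap_far m%:R k t)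
  (- ((1 - t) ^+ m.-1 * (1 - (d / (1 - p * (1 - t))) ^+ m) / (t * ln (1 - t)))).
Proof.
move=> m0 /andP[ct t1]; have t0 := lt_trans c0 ct; have t01 : 0 < t < 1 by rewrite t0.
have := hasSumZ (- (t * ln (1 - t))^-1) (hasSumB (sum_nb_onem_pow1 m0 t01) (sum_nb_onem_pow m0 t01)).
rewrite [X in hasSum _ X -> _](_ : _ = - ((1 - t) ^+ m.-1 * (1 - (d / (1 - p * (1 - t))) ^+ m) / (t
  * ln (1 - t)))); last by ring.
by apply: eq_hasSum => k; rewrite /gap_far; ring.
Qed.

Definition Rp_kernel (m : nat) (t : R) : R :=
  (1 - t) ^+ m.-1 * (1 - (d / (1 - p * (1 - t))) ^+ m) / (t * ln (1 - t)).

Lemma measurable_Rp_kernel m : measurable_fun setT (Rp_kernel m).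
Proof.
apply: measurable_div; last exact: measurable_den.
apply: measurable_funM; first by apply: measurable_funX; exact: measurable_1B.
apply: measurable_funB => //; apply: measurable_funX; apply: measurable_div => //.
by apply: measurable_funB => //; apply: measurable_funM => //; exact: measurable_1B.
Qed.

Lemma Rp_kernel_num m t : 0 < t < 1 ->
  0 <= (1 - t) ^+ m.-1 * (1 - (d / (1 - p * (1 - t))) ^+ m) <= 1.
Proof.
move=> /andP[t0 t1]; have u0 : 0 <= 1 - t by rewrite subr_ge0 ltW.
have u1 : 1 - t <= 1 by rewrite gerBl ltW.
have dq : d <= 1 - p * (1 - t) by rewrite lerB// ler_piMr// ltW.
have q0 := lt_le_trans d0 dq.
have r0 : 0 <= d / (1 - p * (1 - t)) by rewrite divr_ge0// ltW.
have r1 : d / (1 - p * (1 - t)) <= 1 by rewrite ler_pdivrMr// mul1r.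
have := exprn_ge0 m r0; have := exprn_ile1 m r0 r1.
have := exprn_ge0 m.-1 u0; have := exprn_ile1 m.-1 u0 u1.
move: (_ ^+ m) (_ ^+ m.-1) => u v v1 v0 w1 w0; apply/andP; split; nra.
Qed.

Lemma Rp_kernel_le0 m t : 0 < t < 1 -> Rp_kernel m t <= 0.
Proof.
move=> t01; have L0 := ln1B_lt0 t01; have /andP[n0 _] := Rp_kernel_num m t01.
by rewrite /Rp_kernel mulr_ge0_le0// invr_le0 ltW// nmulr_llt0//; case/andP: t01.
Qed.

Lemma bmeas_Rp_kernel m : bmeas c 1 (Rp_kernel m).
Proof.
split; first exact: measurable_Rp_kernel.
exists (c ^- 2) => t /andP[ct t1].
have t0 := lt_trans c0 ct; have t01 : 0 < t < 1 by rewrite t0.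
apply: div_ln1B_le => //; apply: (@le_trans _ _ 1).
  by have /andP[n0 n1] := Rp_kernel_num m t01; rewrite ger0_norm.
by rewrite mulrC ler_pdivlMr ?exprn_gt0// mul1r lerXn2r ?nnegrE ?ltW.
Qed.

Lemma RpE m : Rp p m = - ooint c 1 (Rp_kernel m).
Proof. by rewrite -ooint_closed; [|exact: ltW|exact: bmeas_Rp_kernel]. Qed.

Lemma Rp_ge0 m : 0 <= Rp p m.
Proof.
rewrite RpE oppr_ge0 -[leRHS](mul0r (1 - c)) -ooint_cst; last exact: ltW.
apply: ooint_le; [exact: ltW|exact: bmeas_Rp_kernel|exact: bmeas_cst|].
by move=> t /andP[ct t1]; apply: Rp_kernel_le0; rewrite t1 (lt_trans c0).
Qed.

(** The average is taken under the integral sign; the integrands grow at most quadratically in [k],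
    so the second moment of [nb p m] dominates. *)
Lemma sum_nb_Lambda_exponent m : (0 < m)%N ->
  hasSum (fun k => nb p m k * (Lambda_exponent k - \sum_(0 <= j < k) ln (m%:R + j%:R))) (Rp p m).
Proof.
move=> m0; have m1 : 1 <= m%:R :> R by rewrite ler1n.
have nb0 k : 0 <= k.+1%:R ^+ 2 * nb p m k by rewrite mulr_ge0 ?sqr_ge0 ?nb_ge0// ltW.
have cnb := nb_moment2 p0 p1 m0.
have H1 : hasSum (fun k => nb p m k * ooint 0 c (gap_near m%:R k)) 0.
  have := @hasSum_ooint R 0 c (fun k t => nb p m k * gap_near m%:R k t) (fun=> 0)
    (om ^+ 3 * (1 + p^-1) ^+ 2 + om ^+ 3 * (1 + d / p) ^+ 2 + m%:R) _ (ltW c0)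
    (fun k => measurable_funM (measurable_cst _) (measurable_gap_near _ _)) (measurable_cst _) nb0 cnb.
  rewrite ooint_cst ?mul0r; last exact: ltW.
  move=> H; have {H} := H _ (fun t => sum_nb_gap_near m0).
  rewrite (_ : (fun n => ooint 0 c _) = (fun k => nb p m k * ooint 0 c (gap_near m%:R k))); last first.
    by apply/funext => k; rewrite ooint_Z//; [exact: ltW|exact: bmeas_gap_near].
  apply=> k t tc; rewrite normrM ger0_norm ?nb_ge0//; [|exact: ltW..].
  by rewrite mulrC mulrA ler_wpM2r ?nb_ge0 ?(ltW p0) ?(ltW p1)// gap_near_bound.
have H2 : hasSum (fun k => nb p m k * ooint c 1 (gap_far m%:R k)) (Rp p m).
  have := @hasSum_ooint R c 1 (fun k t => nb p m k * gap_far m%:R k t) (fun t => -1 * Rp_kernel m t)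
    (c ^- 2) _ (ltW c1)
    (fun k => measurable_funM (measurable_cst _) (measurable_gap_far _ _))
    (measurable_funM (measurable_cst _) (measurable_Rp_kernel m)) nb0 cnb.
  rewrite ooint_Z; [|exact: ltW|exact: bmeas_Rp_kernel].
  rewrite mulN1r -RpE => H.
  have {H} := H _ _; rewrite (_ : (fun n => ooint c 1 _) = (fun k => nb p m k * ooint c 1 (gap_far
    m%:R k))); last first.
    by apply/funext => k; rewrite ooint_Z//; [exact: ltW|exact: bmeas_gap_far].
  apply=> [k t tc|t tc]; last by rewrite mulN1r; exact: sum_nb_gap_far.
  rewrite normrM ger0_norm ?nb_ge0//; [|exact: ltW..].
  rewrite mulrC mulrA ler_wpM2r ?nb_ge0 ?(ltW p0) ?(ltW p1)//.
  by apply: le_trans (gap_far_bound k m1 tc) _;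
    rewrite ler_peMr ?invr_ge0 ?exprn_ge0 ?(ltW c0)// exprn_ege1// ler1n.
have := hasSumD H1 H2; rewrite add0r; apply: eq_hasSum => k.
by rewrite Lambda_exponent_sub// mulrDr.
Qed.

Lemma Lambda_exponent0 : Lambda_exponent 0 = 0.
Proof.
have := @Lambda_exponent_sub 1 0 (lexx _); rewrite big_geq// subr0 => ->.
rewrite (ooint_eq (g := fun=> 0)); last by move=> t _;
  rewrite /gap_near !expr0 addr0 subrr add0r addNr mul0r.
rewrite ooint_cst ?mul0r ?add0r; last exact: ltW.
rewrite (ooint_eq (g := fun=> 0)); last by move=> t _; rewrite /gap_far addr0 subrr oppr0 mul0r.
by rewrite ooint_cst ?mul0r//; exact: ltW.
Qed.

Definition W_Lambda (y : nat) : R := expR (Lambda_exponent y - y%:R * bin_entropy p / p) / y`!%:R.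

Lemma W_Lambda_gt0 y : 0 < W_Lambda y.
Proof. by rewrite divr_gt0 ?expR_gt0// ltr0n fact_gt0. Qed.

Lemma ln_W_Lambda y : ln (W_Lambda y) = Lambda_exponent y - y%:R * bin_entropy p / p - ln y`!%:R.
Proof. by rewrite ln_div ?posrE ?expR_gt0 ?ltr0n ?fact_gt0// expRK. Qed.

Lemma ln_rfact (r : R) y : 0 < r -> ln (rfact r y) + ln y`!%:R = \sum_(0 <= j < y) ln (r + j%:R).
Proof.
move=> r0; rewrite -lnM ?posrE ?rfact_gt0 ?ltr0n ?fact_gt0//.
rewrite /rfact divfK ?pnatr_eq0 -?lt0n ?fact_gt0//.
elim: y => [|y IH]; first by rewrite !big_geq// ln1.
rewrite !big_nat_recr//= lnM ?IH ?posrE ?ltr_pwDl//.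
by apply: prodr_gt0 => j _; rewrite ltr_pwDl.
Qed.

Lemma sum_W_Lambda (delta : R) m : (0 < m)%N ->
  hasSum (fun k => nb p m k * (ln (if k is 0%N then delta else W_Lambda k) - ln (nb p m k)))
    (Rp p m + d ^+ m * ln delta).
Proof.
move=> m0.
have hD := hasSumB (hasSumB (sum_nb_Lambda_exponent m0) (hasSumZ (bin_entropy p / p + ln p)
  (nb_mean p0 p1 m0)))
  (hasSumZ (m%:R * ln d) (nb_sum p0 p1 m0)).
rewrite (_ : _ - _ - _ = Rp p m) in hD; last first.
  have e : bin_entropy p / p = - ((1 - p) / p * ln d) - ln p.
    by have := hpE p0 1; rewrite !mul1r !mulr1.
  by rewrite e; field; rewrite !gt_eqF.
apply/hasSum_shift; move/hasSum_shift : hD.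
have n0 : nb p m 0 = d ^+ m by rewrite /nb bin0 mul1r expr0 mulr1.
rewrite big_geq// Lambda_exponent0 n0 -n0 ln_nb// bin0 ln1 n0.
rewrite (_ : _ - (_ - _ - _) = Rp p m + d ^+ m * ln delta - d ^+ m * (ln delta - (0 + m%:R * ln d +
  0 * ln p))); last by ring.
apply: eq_hasSum => k; rewrite ln_W_Lambda ln_nb//.
have m0' : 0 < m%:R :> R by rewrite ltr0n.
have := ln_rfact k.+1 m0'.
have -> : rfact m%:R k.+1 = 'C((k.+1 + m).-1, k.+1)%:R :> R.
  by rewrite -(prednK m0) rfact_nat addnS.
by move=> <-; field; rewrite gt_eqF.
Qed.

(** * Subexponential growth of the second weight *)

Lemma expr_dist_le (s sg D M : R) y : `|s - sg| <= D -> 0 <= sg -> `|s| <= M -> sg <= M ->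
  `|s ^+ y.+1 - sg ^+ y.+1| <= y.+1%:R * D * M ^+ y.
Proof.
move=> sD s0 sM gM; have M0 := le_trans s0 gM.
elim: y => [|y IH]; first by rewrite mul1r expr0 mulr1.
have -> : s ^+ y.+2 - sg ^+ y.+2 = s * (s ^+ y.+1 - sg ^+ y.+1) + (s - sg) * sg ^+ y.+1.
  by rewrite (exprS s y.+1) (exprS sg y.+1); ring.
have -> : y.+2%:R * D * M ^+ y.+1 = M * (y.+1%:R * D * M ^+ y) + D * M ^+ y.+1.
  by rewrite (exprS M y) -[y.+2%:R]natr1; ring.
apply: le_trans (ler_normD _ _) _; rewrite !normrM; apply: lerD; apply: ler_pM => //.
by rewrite ger0_norm ?exprn_ge0// lerXn2r.
Qed.

Lemma exprB_le (s sg D : R) y : `|s - sg| <= D -> 0 <= sg ->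
  `|s ^+ y.+1 - sg ^+ y.+1| <= y.+1%:R * D * (`|s| ^+ y + sg ^+ y).
Proof.
move=> sD s0; have D0 := le_trans (normr_ge0 _) sD.
have [h|h] := leP `|s| sg.
  apply: le_trans (expr_dist_le y sD s0 h (lexx _)) _.
  by rewrite ler_wpM2l ?mulr_ge0// lerDr exprn_ge0.
apply: le_trans (expr_dist_le y sD s0 (lexx _) (ltW h)) _.
by rewrite ler_wpM2l ?mulr_ge0// lerDl exprn_ge0.
Qed.

(** Powers of four quantities that are less than 1 in absolute value on []0, c[], so that the
    integral tends to 0 by dominated convergence. *)
Definition decay (n : nat) (t : R) : R :=
  (`|s1 t| ^+ n + onem_pow (d / p) t ^+ n) + (`|s2 t| ^+ n + onem_pow p^-1 t ^+ n).

(** Below: [1 + x <= expR x] and [- tau t <= ln (1 - t)]. Above: [expR (- u) <= 1 / (1 + u) <= 1 - u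
    + u ^+ 2] at [u = k * t], while [tau t - t = t * tau t] is of second order. *)
Lemma onem_pow_approx k t : 0 < t < c -> 0 <= k ->
  `|1 - k * tau t - onem_pow k t| <= (k * om + k ^+ 2) * t ^+ 2.
Proof.
move=> tc k0; have [t0 t1 t01 _] := lt_c tc; have [tt1 tt2 _] := tau_bounds tc.
have T1 : 0 < 1 + tau t by rewrite ltr_pwDl// (le_trans (ltW t0)).
have LT : - tau t <= ln (1 - t).
  have -> : 1 - t = (1 + tau t)^-1.
    by have -> : 1 + tau t = (1 - t)^-1; [rewrite /tau; field; rewrite gt_eqF|rewrite invrK].
  rewrite lnV ?posrE// lerN2; apply: le_ln1Dx.
  by apply: lt_le_trans tt1; apply: lt_trans t0; rewrite oppr_lt0.
have lo : 1 - k * tau t <= onem_pow k t.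
  apply: le_trans (expR_ge1Dx _); rewrite lerD2l -mulrN; exact: ler_wpM2l.
have up : onem_pow k t <= 1 - k * t + k ^+ 2 * t ^+ 2.
  apply: (@le_trans _ _ (expR (- (k * t)))).
    by rewrite /onem_pow ler_expR -mulrN ler_wpM2l// ln1B_le.
  have kt0 : 0 <= k * t by rewrite mulr_ge0// ltW.
  rewrite expRN; apply: (@le_trans _ _ (1 + k * t)^-1).
    by rewrite lef_pV2 ?posrE ?expR_gt0 ?ltr_pwDl//; exact: expR_ge1Dx.
  rewrite -exprMn -[leLHS]mul1r ler_pdivrMr ?ltr_pwDl//; move: (k * t) kt0 => u u0; nra.
rewrite distrC ger0_norm ?subr_ge0//.
have e : tau t - t = t * tau t by rewrite /tau; field; rewrite gt_eqF.
have h : k * (tau t - t) <= k * om * t ^+ 2.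
  by rewrite e -mulrA ler_wpM2l// expr2 [om * _]mulrCA ler_pM2l.
by rewrite [leRHS]mulrDl; move: h; rewrite mulrBr; move: up; move: (tau t) (onem_pow k t) => *; lra.
Qed.

(* At [r = y (1 - p) / p] the powers of [1 - t] are [y]-th powers agreeing with [s1] and [s2]
   to second order at [0], which absorbs the singular denominator. *)
Lemma gap_near_decay y t : 0 < t < c -> `|gap_near (d / p * y.+1%:R) y.+1 t| <=
  om * ((d / p * om + (d / p) ^+ 2) + (p^-1 * om + p^-1 ^+ 2)) * (y.+1%:R * decay y t).
Proof.
move=> tc; have [t0 t1 t01 to] := lt_c tc; have [h1 h2] := s_le1 tc.
have q1 := onem_pow_approx tc b0; have q2 := onem_pow_approx tc a0.
have tl1 : t < 1 by case/andP: t01.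
rewrite -s1E// in q1; rewrite -s2E// in q2.
have := exprB_le y q1 (ltW (onem_pow_gt0 _ _)).
have := exprB_le y q2 (ltW (onem_pow_gt0 _ _)).
have pN1 : onem_pow (-1) t = (1 - t)^-1 by rewrite /onem_pow mulN1r expRN lnK.
have pX k : onem_pow (k * y.+1%:R) t = onem_pow k t ^+ y.+1 by rewrite /onem_pow -expRM_natl;
  congr expR; ring.
move=> B2 B1; apply: div_ln1B_le => //.
have e : d / p * y.+1%:R - 1 + y.+1%:R = p^-1 * y.+1%:R + -1.
  by move: y.+1%:R => n; field; rewrite gt_eqF.
rewrite e !onem_powD !pN1 !pX.
rewrite (_ : _ + _ = (1 - t)^-1 * ((s1 t ^+ y.+1 - onem_pow (d / p) t ^+ y.+1) -
  (s2 t ^+ y.+1 - onem_pow p^-1 t ^+ y.+1))); last by ring.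
rewrite normrM ger0_norm ?invr_ge0 ?(ltW t1)// -[leRHS]mulrA -[leRHS]mulrA.
apply: ler_pM => //; first by rewrite invr_ge0 ltW.
apply: le_trans (ler_normB _ _) _; apply: le_trans (lerD B1 B2) _.
rewrite /decay; set u := `|s1 t| ^+ y + _; set v := `|s2 t| ^+ y + _.
have u0 : 0 <= u by rewrite addr_ge0 ?exprn_ge0 ?expR_ge0.
have v0 : 0 <= v by rewrite addr_ge0 ?exprn_ge0 ?expR_ge0.
have A0 : 0 <= d / p * om + (d / p) ^+ 2 by rewrite addr_ge0 ?sqr_ge0 ?mulr_ge0// ltW.
have B0 : 0 <= p^-1 * om + p^-1 ^+ 2 by rewrite addr_ge0 ?sqr_ge0 ?mulr_ge0// ltW.
move: A0 B0 u0 v0; clear; set A := d / p * om + _; set B := p^-1 * om + _.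
move: A B u v (ler0n R y.+1) (sqr_ge0 t) => A B u v; move: y.+1%:R (t ^+ 2) => n T n0 T0 A0 B0 u0 v0.
rewrite -subr_ge0 (_ : _ - _ = n * T * (A * v + B * u)); last by ring.
by rewrite !(mulr_ge0, addr_ge0).
Qed.

Lemma measurable_decay n : measurable_fun setT (decay n).
Proof.
have ms1 : measurable_fun setT s1.
  apply: measurable_div; first exact: measurable_funB.
  by apply: measurable_funM => //; exact: measurable_1B.
have ms2 : measurable_fun setT s2.
  apply: measurable_div; first by apply: measurable_funB => //; exact: measurable_funM.
  by apply: measurable_funM => //; exact: measurable_1B.
have mN (f : R -> R) : measurable_fun setT f -> measurable_fun setT (fun t => `|f t|).
  by move=> mf; exact: (measurableT_comp (@normr_measurable R setT) mf).
by do 2 apply: measurable_funD; apply: measurable_funX; (try exact: measurable_onem_pow); exact: mN.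
Qed.

Lemma decay_bound n t : 0 < t < c -> 0 <= decay n t <= 4.
Proof.
move=> tc; have [_ _ t01 _] := lt_c tc; have [h1 h2] := s_le1 tc.
have h3 := onem_pow_le1 b0 t01; have h4 := onem_pow_le1 a0 t01.
have e1 := exprn_ile1 n (normr_ge0 _) h1; have e2 := exprn_ile1 n (normr_ge0 _) h2.
have e3 := exprn_ile1 n (ltW (onem_pow_gt0 _ _)) h3; have e4 := exprn_ile1 n (ltW (onem_pow_gt0 _ _)) h4.
rewrite /decay; apply/andP; split; first by rewrite !addr_ge0 ?exprn_ge0 ?expR_ge0.
by move: e1 e2 e3 e4; move: (_ ^+ n) (_ ^+ n) (_ ^+ n) (_ ^+ n) => *; lra.
Qed.

Lemma ooint_decay : ooint 0 c (decay n) @[n --> \oo] --> 0.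
Proof.
have := @cvg_ooint R 0 c decay (fun=> 0) 4 (ltW c0) measurable_decay (measurable_cst _).
rewrite ooint_cst ?mul0r; last exact: ltW.
apply.
  by move=> n t tc; have /andP[m0 m4] := decay_bound n tc; rewrite ger0_norm.
move=> t tc; have [t0 t1 t01 _] := lt_c tc; have L0 := ln1B_lt0 t01.
have tl1 : t < 1 by case/andP: t01.
have T0 : 0 < tau t by rewrite divr_gt0.
have T2 : tau t < 2 * p.
  rewrite ltr_pdivrMr//; case/andP: tc => _; rewrite ltr_pdivlMr//; lra.
have d1 : d < 1 by rewrite ltrBlDr ltrDl.
have st (k : R) : 0 < k -> k <= p^-1 -> `|1 - k * tau t| < 1.
  move=> k0 kp; have h1 : 0 < k * tau t by rewrite mulr_gt0.
  have h2 : k * tau t < 2.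
    by apply: le_lt_trans (ler_wpM2r (ltW T0) kp) _; rewrite ltr_pdivrMl// mulrC.
  by rewrite ltr_norml; move: (k * _) h1 h2 => *; apply/andP; split; lra.
have pt (k : R) : 0 < k -> `|onem_pow k t| < 1.
  by move=> k0; rewrite gtr0_norm ?onem_pow_gt0// /onem_pow expR_lt1 pmulr_rlt0.
have bp : 0 < d / p by rewrite divr_gt0.
have ap : 0 < p^-1 by rewrite invr_gt0.
have ba : d / p <= p^-1 by rewrite ler_piMl ?(ltW ap)// ltW.
rewrite -[X in _ --> X](addr0 (0 : R)) -[X in _ --> X + _](addr0 (0 : R)) -[X in _ --> _ + X](addr0
  (0 : R)).
have s1t : `| `|s1 t| | < 1 by rewrite normr_id s1E// st.
have s2t : `| `|s2 t| | < 1 by rewrite normr_id s2E// st.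
by apply: cvgD; apply: cvgD; apply: cvg_expr => //; exact: pt.
Qed.

Let K := om * ((d / p * om + (d / p) ^+ 2) + (p^-1 * om + p^-1 ^+ 2)).

(** At [r = y (1 - p) / p] the entropy factor cancels the upper bound on [ln (rfact r y)] up to
    [- ln d], the far integral is bounded, and the near one is at most [y] times a null sequence. *)
Lemma ln_W_Lambda_le y : 1 <= d / p * y.+1%:R ->
  ln (W_Lambda y.+1) <= - ln d + c ^- 2 * (1 - c) + K * y.+1%:R * ooint 0 c (decay y).
Proof.
move=> r1; set r := d / p * y.+1%:R; have r0 : 0 < r := lt_le_trans ltr01 r1.
have g := Lambda_exponent_sub y.+1 r1; rewrite -/r in g.
have bM : bmeas 0 c (decay y).
  split; first exact: measurable_decay.
  by exists 4 => t tc; have /andP[m0 m4] := decay_bound y tc; rewrite ger0_norm.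
have h1 : ooint 0 c (gap_near r y.+1) <= K * y.+1%:R * ooint 0 c (decay y).
  rewrite -ooint_Z//; last exact: ltW.
  apply: ooint_le; [exact: ltW|exact: bmeas_gap_near|exact: bmeasZ|].
  move=> t tc; apply: le_trans (ler_norm _) _.
  by rewrite -mulrA; exact: gap_near_decay.
have h2 : ooint c 1 (gap_far r y.+1) <= c ^- 2 * (1 - c).
  apply: le_trans (ler_norm _) _; apply: ooint_abs_le; [exact: ltW|exact: measurable_gap_far|].
  by move=> t; exact: gap_far_bound.
have h3 := ln_rfact_le p0 p1 y.+1 r0; have h4 := ln_rfact y.+1 r0; have h5 := hpE p0 y.+1%:R.
have -> : ln (W_Lambda y.+1) = ooint 0 c (gap_near r y.+1) + ooint c 1 (gap_far r y.+1) + ln (rfact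
  r y.+1) - y.+1%:R * bin_entropy p / p.
  by rewrite -g ln_W_Lambda -h4; ring.
rewrite h5 -/r; move: h1 h2 h3; rewrite (mulrDl r 1 (ln d)) mul1r; clear.
move: (ln d) (_ * ln p) (ln (rfact _ _)) (c ^- 2 * _) (K * _ * _) (ooint 0 _ _) (ooint _ 1 _) => *; lra.
Qed.

Lemma eventually_bounded (f : nat -> R) N B : (forall n, (N <= n)%N -> `|f n| <= B) ->
  exists C, forall n, `|f n| <= C.
Proof.
move=> fB; exists (`|B| + \sum_(0 <= k < N) `|f k|) => n.
have [Nn|nN] := leqP N n.
  apply: le_trans (fB n Nn) _; apply: le_trans (ler_norm _) _.
  by rewrite lerDl sumr_ge0.
rewrite (bigD1_seq n) ?mem_index_iota ?iota_uniq//= addrCA lerDl addr_ge0// sumr_ge0//.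
Qed.

Lemma subexp_W_Lambda (delta : R) : 0 < delta -> subexp (fun y => if y is 0%N then delta else
  W_Lambda y).
Proof.
move=> delta0 r /andP[r0 r1].
pose W := fun y : nat => if y is 0%N then delta else W_Lambda y.
change (exists C, forall k, `|W k| * r ^+ k <= C); have lr : ln r < 0 by rewrite ln_lt0// r0.
have W0 k : 0 < W k by rewrite /W; case: k => // k; exact: W_Lambda_gt0.
have KM : K * ooint 0 c (decay n) @[n --> \oo] --> 0.
  by rewrite -[X in _ --> X](mulr0 K); apply: cvgM; [exact: cvg_cst|exact: ooint_decay].
(* Beyond [N] the growth rate allowed to [ln W] is less than [- ln r]. *)
have /cvgrPdist_lt/(_ (- ln r)) := KM; rewrite oppr_gt0 => /(_ lr)[N _ HN].
have [N' HN'] : exists N', forall n, (N' <= n)%N -> 1 <= d / p * n.+1%:R.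
  exists (Num.truncn (p / d)) => n Nn; rewrite -ler_pdivrMl ?divr_gt0// invf_div mulr1.
  apply/ltW; apply: lt_le_trans (truncnS_gt _) _; by rewrite ler_nat ltnS.
suff [C HC] : exists C, forall n, `|W n * r ^+ n| <= C.
  by exists C => k; apply: le_trans (HC k); rewrite normrM [`|r ^+ k|]ger0_norm ?exprn_ge0// ltW.
apply: (@eventually_bounded _ (maxn N N').+1 (expR (- ln d + c ^- 2 * (1 - c)))).
case=> [//|n]; rewrite ltnS geq_max => /andP[nN nN'].
have WR : 0 < W n.+1 * r ^+ n.+1 by rewrite mulr_gt0// exprn_gt0.
rewrite gtr0_norm// -ler_ln ?posrE ?expR_gt0// expRK.
rewrite lnM ?posrE ?exprn_gt0// lnXn//.
have := ln_W_Lambda_le (HN' n nN'); have := HN n nN;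
  rewrite /= sub0r normrN => /(le_lt_trans (ler_norm _)) h1.
have h2 : K * n.+1%:R * ooint 0 c (decay n) + ln r *+ n.+1 <= 0.
  rewrite (_ : _ + _ = n.+1%:R * (K * ooint 0 c (decay n) + ln r)); last by rewrite -mulr_natl; ring.
  rewrite pmulr_rle0 ?ltr0n//.
  by move: h1; move: (K * _) (ln r) => *; lra.
by move: h2; clear; move: (- ln d + _) (_ *+ _) (K * _ * _) (ln (W_Lambda _)) => *; lra.
Qed.

End part2.

(** * The two bounds *)

Theorem corollary17 (R : realType) (p : R) (hp0 : 0 < p) (hp1 : p < 1) :
  let d : R := 1 - p in
  let D0 : nat -> R := fun y => (1 - p) * p ^+ y in
  let h := bin_entropy p in
  (let delta := Num.min (expR (- (Delta p 1 - 1 / 2) / d)) 1 in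
   let Delta_delta := fun x : nat =>
     Delta p x - d * ln delta + d ^+ x * ln delta in
   let eps := inf [set Delta_delta x | x in [set x : nat | (1 <= x)%N]] in
   let w := fun (q : R) (y : nat) =>
     gbinom (y%:R / p - 1) y%:R * q ^+ y * expR (- (y%:R * h / p)) in
   let alpha := fun q : R => (delta + \big[+%R/0]_(1 <= y <oo) w q y)^-1 in
   let mu : R -> R := fun q =>
     \big[+%R/0]_(1 <= y <oo) (alpha q * y%:R * w q y) in
   let admissible := [set q : R | 0 < q < 1 /\ p / (1 - p) <= mu q] in
   let bound := fun q : R =>
     p * (- eps - d * ln delta - ln (alpha q) - mu q * ln q)
       / (d * (1 + mu q)) in
   (repeat_capacity D0 <= ereal_sup [set (bound q)%:E | q in admissible])%E)
  /\
  (let delta := expR (- Rp p 1 / d) in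
   let Delta_delta := fun x : nat =>
     Rp p x - d * ln delta + d ^+ x * ln delta in
   let eps := inf [set Delta_delta x | x in [set x : nat | (1 <= x)%N]] in
   let w := fun (q : R) (y : nat) =>
     q ^+ y * expR (Lambda2 p y - Lambda1 p y - y%:R * Li (1 / (1 + 2 * p))
                    - y%:R * h / p) / y`!%:R in
   let alpha := fun q : R => (delta + \big[+%R/0]_(1 <= y <oo) w q y)^-1 in
   let mu : R -> R := fun q =>
     \big[+%R/0]_(1 <= y <oo) (alpha q * y%:R * w q y) in
   let admissible := [set q : R | 0 < q < 1 /\ p / (1 - p) <= mu q] in
   let bound := fun q : R =>
     p * (- eps - d * ln delta - ln (alpha q) - mu q * ln q)
       / (d * (1 + mu q)) in
   (repeat_capacity D0 <= ereal_sup [set (bound q)%:E | q in admissible])%E).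
Proof.
have d0 : 0 < 1 - p by rewrite subr_gt0.
move=> d D0 h; split.
- move=> delta Delta_delta eps w alpha mu admissible bound.
  have delta0 : 0 < delta by rewrite lt_min expR_gt0 ltr01.
  have [W0 Wsub WS Wlb] := part1_bound hp0 hp1 delta0.
  (* [Delta_delta m + d * ln delta] is the [S m] of the tilting argument; [C] is the lower bound
     from [part1_bound] with this shift undone. *)
  apply: (capacity_bound (DD := Delta_delta) (C := - (5 + 2 / ((1 - p) / p)) - `|ln delta| - d * ln
    delta)
    hp0 hp1 W0 Wsub).
  + by move=> q k q0; rewrite /w /gbinom_weight; ring.
  + by move=> m m0; rewrite [X in hasSum _ X](_ : _ = Delta p m + (1 - p) ^+ m * ln delta);
    [exact: WS|rewrite /Delta_delta/d; ring].
  + by move=> m m0; have := Wlb m m0; rewrite /Delta_delta/d; lra.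
- move=> delta Delta_delta eps w alpha mu admissible bound.
  have delta0 : 0 < delta by exact: expR_gt0.
  have lndelta : ln delta <= 0.
    by rewrite expRK mulNr oppr_le0 divr_ge0 ?(ltW d0)// Rp_ge0.
  apply: (capacity_bound (W := fun y => if y is 0%N then delta else W_Lambda p y) (DD :=
    Delta_delta) (C := 0) hp0 hp1).
  + by case=> // k; exact: W_Lambda_gt0.
  + exact: subexp_W_Lambda.
  + by move=> q k q0; rewrite /w /W_Lambda /Lambda_exponent; ring.
  + by move=> m m0; rewrite [X in hasSum _ X](_ : _ = Rp p m + (1 - p) ^+ m * ln delta);
    [exact: sum_W_Lambda|rewrite /Delta_delta/d; ring].
  (* [Rp] is nonnegative, and so is [(d ^+ m - d) * ln delta], both factors being at most 0; hence
     [C = 0]. *)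
  + move=> m m0; rewrite /Delta_delta.
    have : d ^+ m <= d.
      by rewrite -(prednK m0) exprS ler_piMr ?(ltW d0)// exprn_ile1 ?(ltW d0)// gerBl ltW.
    by have := Rp_ge0 hp0 hp1 m; nra.
Qed.
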